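(* Let $X$ be a connected CW-complex of finite dimension $n\ge1$. If $X$ has a non-trivial homotopy group $\pi_m(X)$ for some $m>n$, then the homotopy type of $X$ is not a product of Eilenberg–Mac Lane spaces. In particular, for every $n\ge2$, the $n$-dimensional sphere does not have the homotopy type of a product of Eilenberg–Mac Lane spaces.
   Context: Homotopy types are objects, up to isomorphism, of the localization of the category of topological spaces at the weak homotopy equivalences. An Eilenberg–Mac Lane space $K(A,k)$ ($k\ge1$, $A$ a group, abelian if $k\ge2$) is a connected space with $\pi_k\simeq A$ and all other homotopy groups trivial. *)

(* Defs.v *)
From HB Require Import structures.
From mathcomp Require Import all_boot all_order all_algebra.
From mathcomp Require Import all_classical all_reals all_analysis.
Set Implicit Arguments.
Unset Strict Implicit.
Unset Printing Implicit Defensive.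
Import Order.TTheory GRing.Theory Num.Theory.
Import numFieldNormedType.Exports.
Local Open Scope classical_set_scope.
Local Open Scope ring_scope.

Section Domains.
Context (R : realType).

(* Euclidean, unlike the library's norm on row vectors, which is the maximum
   norm. *)
Definition sqnorm d (t : 'rV[R]_d) : R := \sum_i t 0 i ^+ 2.

Definition disc d : set 'rV[R]_d := [set t : 'rV[R]_d | sqnorm t <= 1].
Definition open_disc d : set 'rV[R]_d := [set t : 'rV[R]_d | sqnorm t < 1].

(* The sphere S^n is [unit_sphere n.+1], the boundary of [disc n.+1]. *)
Definition unit_sphere d : set 'rV[R]_d := [set t : 'rV[R]_d | sqnorm t = 1].

Definition cube d : set 'rV[R]_d :=
  [set t : 'rV[R]_d | forall i, 0 <= t 0 i <= 1].
Definition cube_boundary d : set 'rV[R]_d :=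
  [set t : 'rV[R]_d | @cube d t /\ exists i, t 0 i = 0 \/ t 0 i = 1].

Definition sphere (n : nat) : topologicalType := set_type (@unit_sphere n.+1).

End Domains.

Section CWComplexes.
Context (R : realType).

(* A CW structure given by its characteristic maps (J. H. C. Whitehead).  The
   map of a cell is a total function of which only the restriction to the closed
   disc matters. *)
Record cw_structure (X : topologicalType) := CWStructure {
  cw_cell : Type ;
  cw_dim : cw_cell -> nat ;
  cw_map : forall e : cw_cell, 'rV[R]_(cw_dim e) -> X ;
  cw_hausdorff : hausdorff_space X ;
  cw_continuous : forall e, {within @disc R (cw_dim e), continuous (@cw_map e)} ;
  (* open discs are mapped homeomorphically onto the open cells *)
  cw_injective : forall e s t, open_disc s -> open_disc t ->
    @cw_map e s = @cw_map e t -> s = t ;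
  cw_open : forall e (U : set 'rV[R]_(cw_dim e)),
    open U -> U `<=` @open_disc R _ ->
    exists2 V : set X, open V &
      @cw_map e @` U = V `&` @cw_map e @` @open_disc R _ ;
  cw_disjoint : forall e e' s t, open_disc s -> open_disc t ->
    @cw_map e s = @cw_map e' t -> e = e' ;
  cw_cover : forall x, exists e, (@cw_map e @` @open_disc R _) x ;
  cw_closure_finite : forall e, exists2 F : set cw_cell, finite_set F &
    (forall e', F e' -> (cw_dim e' < cw_dim e)%N) /\
    @cw_map e @` @unit_sphere R _ `<=`
      \bigcup_(e' in F) (@cw_map e' @` @open_disc R _) ;
  cw_weak_topology : forall A : set X,
    (forall e, closed (A `&` @cw_map e @` @disc R _)) -> closed A
}.

Definition cw_dimension (X : topologicalType) (C : cw_structure X) (n : nat) :=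
  (exists e : cw_cell C, cw_dim e = n) /\
  (forall e : cw_cell C, (cw_dim e <= n)%N).

End CWComplexes.

Section HomotopyGroups.
Context (R : realType).

Definition joined (X : topologicalType) (x y : X) :=
  exists p : R -> X,
    [/\ {within `[0, 1], continuous p}, p 0 = x & p 1 = y].

Definition path_connected (X : topologicalType) :=
  (exists x : X, True) /\ (forall x y : X, joined x y).

(* Elements of the n-th homotopy group at x are represented by the maps from the
   n-cube sending its boundary to x, up to homotopy relative to the boundary.
   Functions are total but their values off the cube are irrelevant. *)
Definition is_loop n (X : topologicalType) (x : X) (f : 'rV[R]_n -> X) :=
  {within @cube R n, continuous f} /\
  (forall t, cube_boundary t -> f t = x).

Definition loop_homotopic n (X : topologicalType) (x : X)
    (f g : 'rV[R]_n -> X) :=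
  exists H : R * 'rV[R]_n -> X,
    [/\ {within `[0, 1] `*` @cube R n, continuous H},
        forall t, cube t -> H (0, t) = f t,
        forall t, cube t -> H (1, t) = g t &
        forall (s : R) t, 0 <= s <= 1 -> cube_boundary t -> H (s, t) = x].

Definition set_coord n (i : 'I_n) (s : R) (t : 'rV[R]_n) : 'rV[R]_n :=
  \row_j (if j == i then s else t 0 j).

Definition loop_concat n (X : topologicalType) (i : 'I_n)
    (f g : 'rV[R]_n -> X) (t : 'rV[R]_n) : X :=
  if t 0 i <= 2^-1 then f (set_coord i (2 * t 0 i) t)
  else g (set_coord i (2 * t 0 i - 1) t).

Definition homotopy_group_trivial n (X : topologicalType) (x : X) :=
  forall f : 'rV[R]_n -> X, is_loop x f -> loop_homotopic x f (cst x).

(* For n >= 1: [phi] picks a representative of the image of each element under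
   an isomorphism from A onto the n-th homotopy group at x, whose product is
   concatenation along the first coordinate. *)
Definition homotopy_group_iso (A : groupType) n (X : topologicalType) (x : X) :=
  exists phi : A -> ('rV[R]_n -> X),
    [/\ forall a, is_loop x (phi a),
        forall a b (i : 'I_n), i = 0%N :> nat ->
          loop_homotopic x (phi (a * b)%g) (loop_concat i (phi a) (phi b)),
        forall a b, loop_homotopic x (phi a) (phi b) -> a = b &
        forall f, is_loop x f -> exists a, loop_homotopic x (phi a) f].

(* The induced map on homotopy groups is automatically a group morphism, hence
   an isomorphism as soon as it is bijective. *)
Definition homotopy_group_bijective n (X Y : topologicalType) (f : X -> Y)
    (x : X) :=
  (forall g h : 'rV[R]_n -> X, is_loop x g -> is_loop x h ->
     loop_homotopic (f x) (f \o g) (f \o h) -> loop_homotopic x g h) /\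
  (forall h : 'rV[R]_n -> Y, is_loop (f x) h ->
     exists2 g, is_loop x g & loop_homotopic (f x) (f \o g) h).

Definition weak_equivalence (X Y : topologicalType) (f : continuousType X Y) :=
  [/\ forall x x' : X, joined (f x) (f x') -> joined x x',
      forall y : Y, exists x : X, joined (f x) y &
      forall n (x : X), (0 < n)%N -> homotopy_group_bijective n f x].

End HomotopyGroups.

Section Localization.
Context (R : realType).

(* The localization of the category of topological spaces at the weak homotopy
   equivalences: its morphisms are formal composites of continuous maps and of
   formal inverses of weak equivalences ([word]), modulo the congruence
   [word_eq].  Composition [word_comp] is in diagrammatic order. *)
Inductive word : topologicalType -> topologicalType -> Type :=
| word_map (X Y : topologicalType) (f : continuousType X Y) : word X Y
| word_inv (X Y : topologicalType) (f : continuousType X Y) :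
    weak_equivalence R f -> word Y X
| word_comp (X Y Z : topologicalType) : word X Y -> word Y Z -> word X Z.

Definition word_id (X : topologicalType) : word X X :=
  word_map (idfun : continuousType X X).

Inductive word_eq : forall X Y, word X Y -> word X Y -> Prop :=
| word_eq_refl X Y (u : word X Y) : word_eq u u
| word_eq_sym X Y (u v : word X Y) : word_eq u v -> word_eq v u
| word_eq_trans X Y (u v w : word X Y) :
    word_eq u v -> word_eq v w -> word_eq u w
| word_eq_comp X Y Z (u u' : word X Y) (v v' : word Y Z) :
    word_eq u u' -> word_eq v v' -> word_eq (word_comp u v) (word_comp u' v')
| word_eq_assoc X Y Z T (u : word X Y) (v : word Y Z) (w : word Z T) :
    word_eq (word_comp u (word_comp v w)) (word_comp (word_comp u v) w)
| word_eq_idl X Y (u : word X Y) : word_eq (word_comp (word_id X) u) u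
| word_eq_idr X Y (u : word X Y) : word_eq (word_comp u (word_id Y)) u
| word_eq_map_comp (X Y Z : topologicalType)
    (f : continuousType X Y) (g : continuousType Y Z) :
    word_eq (word_comp (word_map f) (word_map g))
            (word_map (g \o f : continuousType X Z))
| word_eq_map_inv (X Y : topologicalType) (f : continuousType X Y)
    (hf : weak_equivalence R f) :
    word_eq (word_comp (word_map f) (word_inv hf)) (word_id X)
| word_eq_inv_map (X Y : topologicalType) (f : continuousType X Y)
    (hf : weak_equivalence R f) :
    word_eq (word_comp (word_inv hf) (word_map f)) (word_id Y).

Definition same_homotopy_type (X Y : topologicalType) :=
  exists (u : word X Y) (v : word Y X),
    word_eq (word_comp u v) (word_id X) /\ word_eq (word_comp v u) (word_id Y).

End Localization.

Section EilenbergMacLane.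
Context (R : realType).

Definition eilenberg_maclane (A : groupType) (k : nat) (K : topologicalType) :=
  [/\ (1 <= k)%N /\ ((2 <= k)%N -> forall a b : A, commute a b),
      path_connected R K,
      forall x : K, homotopy_group_iso R A k x &
      forall j (x : K), (1 <= j)%N -> j != k -> homotopy_group_trivial R j x].

(* The family may be empty, infinite, and have several factors of the same
   degree. *)
Definition is_product_of_eilenberg_maclane (X : topologicalType) :=
  exists (I : Type) (A : I -> groupType) (k : I -> nat)
         (K : I -> topologicalType),
    (forall i, eilenberg_maclane (A i) (k i) (K i)) /\
    same_homotopy_type R X (prod_topology K).

End EilenbergMacLane.

(* Main.v *)
(* Suppose that the CW complex X, of dimension n, is isomorphic to a product of
   Eilenberg-Mac Lane spaces K_i in the localized category.  Lifting cells
   through path fibrations, the isomorphism is realized on free loops by a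
   continuous map f from X to the product.  Let a be an m-loop of X with m > n.
   Each f_i o a is null: either the m-th homotopy group of K_i vanishes, or K_i
   has no homotopy below degree m > n and f_i itself is null-homotopic.  Hence
   f o a is null, and so is a.

   If S^n is such a product, all its homotopy groups above n therefore vanish,
   and the collapse [-1,1]^n -> S^n extends, one coordinate at a time, to a map
   Phi on [-1,1]^(2n) x [-1,1]^n which commutes with v |-> -v on the boundary, up
   to an involution of S^n that is the identity when n is even and a reflection
   when n is odd.  For even n this retracts onto S^n the Thom space of n copies
   of the tautological line bundle L over RP^(2n), and u^2 = w_n(nL) u <> 0 is
   the cohomological contradiction.  Concretely, count modulo 2 the points
   x = (x', x'') at which both Phi(x, s x') and Phi(x, s x'') hit the centre of
   S^n: moving x to (1, ..., 1) leaves the single point x = 0, whereas for s = 0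
   the two values agree and a shift of one of them makes the points disappear;
   opposite sides of the cube contribute the same points.  The count is carried
   out by a Sperner argument on a triangulation of [0,1] x [-1,1]^(2n). *)
Require Import Defs.
From mathcomp Require Import all_boot all_order all_algebra fingroup perm.
From mathcomp Require Import all_classical all_reals all_analysis.
From mathcomp Require Import ring lra zify.
Set Implicit Arguments.
Unset Strict Implicit.
Unset Printing Implicit Defensive.
Import Order.TTheory GRing.Theory Num.Theory.
Import numFieldNormedType.Exports.
Local Open Scope classical_set_scope.
Local Open Scope ring_scope.

(** Formal inverses of weak equivalences keep no base point and have no underlying map, so a word is
    followed only through the relation it induces on cube maps that are constant on the boundary, up
    to homotopies through such maps; the base point returns at the end because a freely null loop is
    null. Inverting a weak equivalence on cells is made a strict lifting problem, against the end
    point map of its mapping path space, so that no homotopies have to be glued along skeleta. When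
    the collapse is extended, only the first new coordinate is critical: its obstruction lies in
    degree n, where S^n has a non-trivial group. An explicit path of invertible matrices from -1 to
    the identity of R^n removes it; such a path exists for even n only, and for odd n a reflection
    of the target repairs the determinant. Since a reflection would spoil labels made of signs,
    linear coordinates are taken in which it exchanges two axes. Hitting the centre is read off
    these coordinates on the half of S^n of positive height; the other half gets a label of its
    own. *)

Implicit Types (T U V X Y Z : topologicalType).

(** * Continuity on subsets and quotients *)

Section WithinContinuity.

Lemma wcP T U (A : set T) (f : T -> U) :
  {within A, continuous f} <->
  forall x B, A x -> nbhs (f x) B -> \forall y \near x, A y -> B (f y).
Proof.
rewrite subspace_continuousP; split=> [cf x B Ax Bfx|cf x Ax B Bfx].
  by have := cf x Ax B Bfx.
exact: cf.
Qed.

Lemma wc_continuous T U (A : set T) (f : T -> U) :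
  continuous f -> {within A, continuous f}.
Proof. exact: continuous_subspaceT. Qed.

Lemma wc_sub T U (A B : set T) (f : T -> U) :
  (forall x, A x -> B x) -> {within B, continuous f} ->
  {within A, continuous f}.
Proof. exact: continuous_subspaceW. Qed.

Lemma wc_eq T U (A : set T) (f g : T -> U) :
  (forall x, A x -> f x = g x) -> {within A, continuous f} ->
  {within A, continuous g}.
Proof.
move=> fg /wcP cf; apply/wcP => x B Ax; rewrite -fg// => /(cf _ _ Ax).
by apply: filterS => y Bf Ay; rewrite -fg//; exact: Bf.
Qed.

Lemma wc_comp T U V (A : set T) (B : set U) (f : T -> U) (g : U -> V) :
  (forall x, A x -> B (f x)) -> {within B, continuous g} ->
  {within A, continuous f} -> {within A, continuous (g \o f)}.
Proof.
move=> AB /wcP cg /wcP cf; apply/wcP => x C Ax Cgfx.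
have := cf x _ Ax (cg (f x) C (AB _ Ax) Cgfx).
by apply: filterS => y By Ay; apply: By => //; exact: AB.
Qed.

Lemma wc_compC T U V (A : set T) (f : T -> U) (g : U -> V) :
  continuous g -> {within A, continuous f} -> {within A, continuous (g \o f)}.
Proof. by move=> cg; apply: (@wc_comp _ _ _ _ setT) => //; apply: wc_continuous. Qed.

Lemma wc_pair T U V (A : set T) (f : T -> U) (g : T -> V) :
  {within A, continuous f} -> {within A, continuous g} ->
  {within A, continuous (fun x => (f x, g x))}.
Proof.
move=> /wcP cf /wcP cg; apply/wcP => x B Ax [[P Q] [/= nP nQ] PQ].
apply: filterS2 (cf x _ Ax nP) (cg x _ Ax nQ) => y Pf Qg Ay.
by apply: PQ; split; [exact: Pf|exact: Qg].
Qed.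

Lemma wc_cst T U (A : set T) (u : U) : {within A, continuous (fun=> u)}.
Proof. by apply: wc_continuous; exact: cst_continuous. Qed.

(** The pieces are closed, so a point outside one of them has a neighbourhood that misses it. *)
Lemma wc_glue T U (D F G : set T) (f : T -> U) : closed F -> closed G ->
  (forall x, D x -> F x \/ G x) ->
  {within D `&` F, continuous f} -> {within D `&` G, continuous f} ->
  {within D, continuous f}.
Proof.
move=> cF cG DFG /wcP fF /wcP fG; apply/wcP => x B Dx Bfx.
have aux (H : set T) : closed H ->
    (forall x B, (D `&` H) x -> nbhs (f x) B ->
       \forall y \near x, (D `&` H) y -> B (f y)) ->
    \forall y \near x, D y -> H y -> B (f y).
  move=> cH fH; have [Hx|Hx] := pselect (H x).
    have := fH x B (conj Dx Hx) Bfx.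
    by apply: filterS => y Hy Dy Hy'; exact: Hy.
  have : nbhs x (~` H) by apply: open_nbhs_nbhs; split => //; exact: closed_openC.
  by apply: filterS => y nHy _ /nHy.
apply: filterS2 (aux _ cF fF) (aux _ cG fG) => y yF yG Dy.
by case: (DFG _ Dy) => [/(yF Dy)|/(yG Dy)].
Qed.

Lemma closed_le_cont T (R : realType) (u v : T -> R) :
  continuous u -> continuous v -> closed [set x | u x <= v x].
Proof.
move=> cu cv.
rewrite (_ : [set x | u x <= v x] = (fun x => v x - u x) @^-1` [set y | 0 <= y]).
  apply: (continuous_closedP _).1; last exact: closed_ge.
  by move=> x; apply: (@cvgB _ _ _ _ _ v u); [exact: cv|exact: cu].
by apply/seteqP; split=> x /=; rewrite subr_ge0.
Qed.

Lemma wc_if T U (R : realType) (D : set T) (u v : T -> R) (f g : T -> U) :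
  continuous u -> continuous v ->
  {within D `&` [set x | u x <= v x], continuous f} ->
  {within D `&` [set x | v x <= u x], continuous g} ->
  (forall x, D x -> u x = v x -> f x = g x) ->
  {within D, continuous (fun x => if u x <= v x then f x else g x)}.
Proof.
move=> cu cv cf cg fg.
apply: (@wc_glue _ _ _ [set x | u x <= v x] [set x | v x <= u x]).
- exact: closed_le_cont.
- exact: closed_le_cont.
- by move=> x _; apply/orP; exact: le_total.
- by apply: wc_eq cf => x [_ /= ->].
- apply: wc_eq cg => x [/= Dx vu]; case: ifPn => // uv.
  by apply/esym/fg => //; apply/eqP; rewrite eq_le uv.
Qed.

Lemma wc_row T (R : realType) n (A : set T) (f : T -> 'rV[R]_n) :
  (forall i, {within A, continuous (fun x => f x 0 i)}) ->
  {within A, continuous f}.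
Proof.
move=> cf; apply/wcP => x B Ax [P nP sPB].
have : \forall y \near x, forall i, A y -> P 0 i (f y 0 i).
  apply: filter_forall => i; have /wcP := cf i => /(_ x (P 0 i) Ax).
  by apply; exact: (nP 0 i).
by apply: filterS => y Py Ay; apply: sPB => i j; rewrite ord1; exact: Py.
Qed.

Lemma continuous_row T (R : realType) n (f : T -> 'rV[R]_n) :
  (forall i, continuous (fun x => f x 0 i)) -> continuous f.
Proof.
move=> cf; apply/continuous_subspace_setT; apply: wc_row => i.
by apply: wc_continuous; exact: cf.
Qed.

Lemma wc_setT T U (f : T -> U) : {within setT, continuous f} -> continuous f.
Proof. exact: (continuous_subspace_setT f).2. Qed.

Lemma closed_wc T U (A : set T) (f : T -> U) :
  (forall C, closed C -> exists2 D, closed D & A `&` f @^-1` C = A `&` D) ->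
  {within A, continuous f}.
Proof.
move=> H; apply/wcP => x B Ax; rewrite nbhsE => -[W [oW Wfx] WB].
have [D cD AD] := H (~` W) (open_closedC oW).
have nDx : (~` D) x.
  move=> Dx; have : (A `&` D) x by [].
  by rewrite -AD => -[_]; exact.
have := open_nbhs_nbhs (conj (closed_openC cD) nDx).
apply: filterS => y nDy Ay; apply: WB; apply: contrapT => nW; apply: nDy.
by have : (A `&` f @^-1` (~` W)) y by []; rewrite AD => -[].
Qed.

Lemma compact_wc_closed T U (A : set T) (f : T -> U) (C : set U) :
  {within A, continuous f} -> compact A -> closed C ->
  compact (A `&` f @^-1` C).
Proof.
move=> /continuous_closedP cf cA cC.
have /closed_subspaceP[D cD DA] := cf _ cC.
by rewrite setIC -DA setIC; exact: compact_closedI.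
Qed.

(** A continuous map from a compact set to a Hausdorff space is closed, hence a quotient map onto
    its image. This is how cylinders are collapsed below. *)
Lemma quotient_factor T U V (A : set T) (w : T -> U) (f : T -> V) (t0 : T) :
  compact A -> hausdorff_space U ->
  {within A, continuous w} -> {within A, continuous f} ->
  (forall a b, A a -> A b -> w a = w b -> f a = f b) ->
  exists2 g : U -> V, {within w @` A, continuous g} &
    forall a, A a -> g (w a) = f a.
Proof.
move=> cA hU cw cf wf.
pose g u := f (xget t0 [set a | A a /\ w a = u]).
have gE a : A a -> g (w a) = f a.
  move=> Aa; rewrite /g; case: xgetP => [b _ [Ab wba]|/(_ a) []//].
  exact: wf.
exists g => //; apply: closed_wc => C cC.
exists (w @` (A `&` f @^-1` C)).
  apply: compact_closed => //; apply: continuous_compact.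
    by apply: wc_sub cw => x [].
  exact: compact_wc_closed.
apply/seteqP; split=> [_ [[a Aa <-] /=]|_ [_ [a [Aa Ca] <-]]].
  by rewrite gE// => Ca; split; [exists a|exists a].
by split; [exists a|rewrite /= gE].
Qed.

End WithinContinuity.

Section WithinArithmetic.
Context (R : realType) (T : topologicalType) (A : set T).
Implicit Types f g : T -> R.

Lemma wcD f g : {within A, continuous f} -> {within A, continuous g} ->
  {within A, continuous (fun x => f x + g x)}.
Proof.
move=> /subspace_continuousP cf /subspace_continuousP cg.
by apply/subspace_continuousP => x Ax; apply: cvgD; [exact: cf|exact: cg].
Qed.

Lemma wcN f : {within A, continuous f} -> {within A, continuous (fun x => - f x)}.
Proof.
move=> /subspace_continuousP cf.
by apply/subspace_continuousP => x Ax; apply: cvgN; exact: cf.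
Qed.

Lemma wcB f g : {within A, continuous f} -> {within A, continuous g} ->
  {within A, continuous (fun x => f x - g x)}.
Proof. by move=> cf cg; apply: wcD => //; exact: wcN. Qed.

Lemma wcM f g : {within A, continuous f} -> {within A, continuous g} ->
  {within A, continuous (fun x => f x * g x)}.
Proof.
move=> /subspace_continuousP cf /subspace_continuousP cg.
by apply/subspace_continuousP => x Ax; apply: cvgM; [exact: cf|exact: cg].
Qed.

Lemma wcV f : {within A, continuous f} -> (forall x, A x -> f x != 0) ->
  {within A, continuous (fun x => (f x)^-1)}.
Proof.
move=> /subspace_continuousP cf f0.
by apply/subspace_continuousP => x Ax; apply: cvgV; [exact: f0|exact: cf].
Qed.

Lemma wcZ n f (g : T -> 'rV[R]_n) :
  {within A, continuous f} -> {within A, continuous g} ->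
  {within A, continuous (fun x => f x *: g x)}.
Proof.
move=> /subspace_continuousP cf /subspace_continuousP cg.
by apply/subspace_continuousP => x Ax; apply: cvgZ; [exact: cf|exact: cg].
Qed.

Lemma wcDr n (f g : T -> 'rV[R]_n) :
  {within A, continuous f} -> {within A, continuous g} ->
  {within A, continuous (fun x => f x + g x)}.
Proof.
move=> /subspace_continuousP cf /subspace_continuousP cg.
by apply/subspace_continuousP => x Ax; apply: cvgD; [exact: cf|exact: cg].
Qed.

Lemma wc_sum (I : Type) (r : seq I) (f : I -> T -> R) :
  (forall i, {within A, continuous (f i)}) ->
  {within A, continuous (fun x => \sum_(i <- r) f i x)}.
Proof.
move=> cf; elim: r => [|i r ih].
  by apply: (@wc_eq _ _ _ (fun=> 0)) => [x _|]; [rewrite big_nil|exact: wc_cst].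
apply: (@wc_eq _ _ _ (fun x => f i x + \sum_(j <- r) f j x)).
  by move=> x _; rewrite big_cons.
exact: wcD.
Qed.

Lemma wc_coord n (f : T -> 'rV[R]_n) i :
  {within A, continuous f} -> {within A, continuous (fun x => f x 0 i)}.
Proof.
exact/(wc_compC (g := fun v : 'rV[R]_n => v 0 i))/(@coord_continuous _ _ _ 0 i).
Qed.

Lemma wc_norm n (f : T -> 'rV[R]_n) :
  {within A, continuous f} -> {within A, continuous (fun x => `|f x|)}.
Proof.
exact/(wc_compC (g := fun v : 'rV[R]_n => `|v|))/norm_continuous.
Qed.

Lemma wc_sqrt f :
  {within A, continuous f} -> {within A, continuous (fun x => Num.sqrt (f x))}.
Proof. exact/(wc_compC (g := Num.sqrt))/sqrt_continuous. Qed.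

Lemma wc_max f g : {within A, continuous f} -> {within A, continuous g} ->
  {within A, continuous (fun x => Num.max (f x) (g x))}.
Proof.
move=> cf cg.
exact: (wc_compC (g := fun y : R * R => Num.max y.1 y.2) (@max_continuous _ R)
  (wc_pair cf cg)).
Qed.

Lemma wc_min f g : {within A, continuous f} -> {within A, continuous g} ->
  {within A, continuous (fun x => Num.min (f x) (g x))}.
Proof.
move=> cf cg.
exact: (wc_compC (g := fun y : R * R => Num.min y.1 y.2) (@min_continuous _ R)
  (wc_pair cf cg)).
Qed.

End WithinArithmetic.

Lemma fst_continuous U V : continuous (@fst U V).
Proof. by move=> x; exact: cvg_fst. Qed.

Lemma snd_continuous U V : continuous (@snd U V).
Proof. by move=> x; exact: cvg_snd. Qed.

Lemma wc_fst T U V (A : set T) (f : T -> U * V) :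
  {within A, continuous f} -> {within A, continuous (fun x => (f x).1)}.
Proof. exact/wc_compC/fst_continuous. Qed.

Lemma wc_snd T U V (A : set T) (f : T -> U * V) :
  {within A, continuous f} -> {within A, continuous (fun x => (f x).2)}.
Proof. exact/wc_compC/snd_continuous. Qed.

Lemma wc_id T (A : set T) : {within A, continuous id}.
Proof. by apply: wc_continuous => x. Qed.

(** * Gauges on R^d and the radial homeomorphisms between their balls *)

Section Gauges.
Context (R : realType) (d : nat).
Implicit Types (v : 'rV[R]_d) (p q : 'rV[R]_d -> R).

(** Dominating every coordinate is what makes rescalings continuous at the origin. *)
Definition is_gauge p :=
  [/\ continuous p, forall (a : R) v, 0 <= a -> p (a *: v) = a * p v,
      forall v, p v = 0 -> v = 0 & forall v i, `|v 0 i| <= p v].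

Lemma gauge_ge0 p v : is_gauge p -> 0 <= p v.
Proof.
move=> [_ hp p0 pi]; case: d v p hp p0 pi => [|d'] v p hp p0 pi.
  rewrite (_ : p v = 0)//.
  have := hp 0 v (lexx _); rewrite mul0r => <-; congr p.
  by apply/rowP => -[].
exact: le_trans (normr_ge0 _) (pi v ord0).
Qed.

Lemma gauge0 p : is_gauge p -> p 0 = 0.
Proof. by move=> [_ hp _ _]; have := hp 0 0 (lexx _); rewrite mul0r scale0r. Qed.

Lemma gauge_eq0 p v : is_gauge p -> (p v == 0) = (v == 0).
Proof.
move=> gp; apply/eqP/eqP => [|->]; last exact: gauge0.
by case: gp => _ _ p0 _; exact: p0.
Qed.

(** The radial map that carries each [p]-ball onto the [q]-ball of the same radius. *)
Definition rescale p q v := (p v / q v) *: v.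

Lemma gauge_rescale p q v : is_gauge p -> is_gauge q -> q (rescale p q v) = p v.
Proof.
move=> gp gq; rewrite /rescale.
have [->|v0] := eqVneq v 0; first by rewrite scaler0 !gauge0.
have [_ hq _ _] := gq; rewrite hq; last by rewrite divr_ge0// gauge_ge0.
by rewrite divfK// gauge_eq0.
Qed.

Lemma rescaleK p q v : is_gauge p -> is_gauge q ->
  rescale q p (rescale p q v) = v.
Proof.
move=> gp gq; rewrite {1}/rescale gauge_rescale//.
have [->|v0] := eqVneq v 0; first by rewrite /rescale !scaler0.
have [_ hp _ _] := gp; rewrite /rescale hp; last by rewrite divr_ge0// gauge_ge0.
rewrite scalerA; move: (v0); rewrite -(gauge_eq0 v gp) => pv0.
have qv0 : q v != 0 by rewrite gauge_eq0.
by rewrite [X in X *: v](_ : _ = 1) ?scale1r//; field; rewrite pv0 qv0.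
Qed.

Lemma rescale_continuous p q : is_gauge p -> is_gauge q ->
  continuous (rescale p q).
Proof.
move=> gp gq; have [cp _ _ _] := gp; have [cq _ _ qi] := gq.
apply: continuous_row => i v.
have [->|v0] := eqVneq v 0; last first.
  rewrite [X in continuous_at _ X](_ : _ = fun u => (p u / q u) * u 0 i).
    apply: (@continuousM R _ (fun u => p u / q u) (fun u => u 0 i) v);
      last exact: coord_continuous.
    apply: (@continuousM R _ p (fun u => (q u)^-1) v); first exact: cp.
    by apply: (@continuousV R _ q v); [rewrite gauge_eq0|exact: cq].
  by apply/funext => u; rewrite /rescale mxE.
(* At the origin [p u / q u] has no limit in general, but a coordinate of the image is bounded by
   its [q], which equals [p u] and tends to 0. *)
rewrite /continuous_at /rescale scaler0 mxE.
move=> B /= /nbhs_ballP[e /= e0 eB].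
have pn : \forall u \near (0 : 'rV[R]_d), ball (p 0) e (p u).
  exact: cp 0 _ (nbhsx_ballx (p 0) e e0).
suff : \forall u \near (0 : 'rV[R]_d), B (((p u / q u) *: u) 0 i) by [].
apply: filterS pn => u.
rewrite /= gauge0// /ball/= !sub0r !normrN => pu.
apply: eB; rewrite /ball/= sub0r normrN; apply: le_lt_trans (qi _ i) _.
by rewrite -/(rescale p q u) gauge_rescale// (le_lt_trans (ler_norm _) pu).
Qed.

Lemma le_coord_norm v i : `|v 0 i| <= `|v|.
Proof.
rewrite [leRHS]/Num.norm/= mx_normrE.
exact: (le_bigmax _ (fun ij : 'I_1 * 'I_d => `|v ij.1 ij.2|) (ord0, i)).
Qed.

Lemma norm_le v (a : R) : 0 <= a -> (`|v| <= a) <-> (forall i, `|v 0 i| <= a).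
Proof.
move=> a0; split=> [va i|H]; first exact: le_trans (le_coord_norm _ _) va.
rewrite /Num.norm/= mx_normrE; apply/bigmax_leP; split=> // -[i j] _ /=.
by rewrite ord1.
Qed.

Lemma norm_attained v : v != 0 -> exists i, `|v| = `|v 0 i|.
Proof.
move=> v0; have : mx_norm v != 0 by apply: contra v0 => /eqP/mx_norm_eq0 ->.
move=> /mx_norm_neq0[[i j] /= vij]; exists j.
by rewrite [LHS]/Num.norm/= vij ord1.
Qed.

Lemma norm_gauge : is_gauge (fun v => `|v|).
Proof.
split=> [|a v a0|v /eqP|v i]; first exact: norm_continuous.
- by rewrite normrZ ger0_norm.
- by rewrite normr_eq0 => /eqP.
- exact: le_coord_norm.
Qed.

Lemma sqnorm_continuous : continuous (@sqnorm R d).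
Proof.
apply: wc_setT; apply: wc_sum => i; rewrite /exprz.
by apply: wcM; apply: wc_coord; exact: wc_id.
Qed.

Lemma sqnorm_ge0 v : 0 <= sqnorm v.
Proof. by apply: sumr_ge0 => i _; exact: sqr_ge0. Qed.

Lemma sqnormZ (a : R) v : sqnorm (a *: v) = a ^+ 2 * sqnorm v.
Proof.
by rewrite /sqnorm mulr_sumr; apply: eq_bigr => i _; rewrite mxE exprMn.
Qed.

Lemma le_coord_sqnorm v i : v 0 i ^+ 2 <= sqnorm v.
Proof.
rewrite /sqnorm (bigD1 i)//= lerDl; apply: sumr_ge0 => j _; exact: sqr_ge0.
Qed.

Lemma sqnorm_eq0 v : sqnorm v = 0 -> v = 0.
Proof.
move=> v0; apply/rowP => i; rewrite mxE; apply/eqP.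
by rewrite -sqrf_eq0 eq_le sqr_ge0 -{1}v0 le_coord_sqnorm.
Qed.

Lemma sqnorm0 : sqnorm (0 : 'rV[R]_d) = 0.
Proof. by rewrite -(scale0r 0) sqnormZ expr0n mul0r. Qed.

Definition enorm v := Num.sqrt (sqnorm v).

Lemma enorm_gauge : is_gauge enorm.
Proof.
split=> [|a v a0|v|v i].
- apply: wc_setT; apply: wc_sqrt; apply: wc_continuous; exact: sqnorm_continuous.
- by rewrite /enorm sqnormZ sqrtrM ?sqr_ge0// sqrtr_sqr ger0_norm.
- move=> /eqP; rewrite /enorm sqrtr_eq0 => v0; apply: sqnorm_eq0.
  by apply/eqP; rewrite eq_le v0 sqnorm_ge0.
- by rewrite /enorm -sqrtr_sqr ler_wsqrtr// le_coord_sqnorm.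
Qed.

Lemma enorm_ge0 v : 0 <= enorm v. Proof. exact: sqrtr_ge0. Qed.

Lemma sqr_enorm v : enorm v ^+ 2 = sqnorm v.
Proof. by rewrite sqr_sqrtr// sqnorm_ge0. Qed.

Lemma enorm_le1 v : (enorm v <= 1) = (sqnorm v <= 1).
Proof. by rewrite -sqr_enorm -[X in _ = (_ <= X)](expr1n _ 2) ler_sqr ?nnegrE ?enorm_ge0. Qed.

Lemma enorm_eq1 v : (enorm v == 1) = (sqnorm v == 1).
Proof.
by rewrite -sqr_enorm -[X in _ = (_ == X)](expr1n _ 2) eqrXn2 ?enorm_ge0.
Qed.

Lemma enorm_lt1 v : (enorm v < 1) = (sqnorm v < 1).
Proof. by rewrite !lt_neqAle enorm_le1 enorm_eq1. Qed.

Lemma enormZ (a : R) v : 0 <= a -> enorm (a *: v) = a * enorm v.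
Proof. by have [_ h _ _] := enorm_gauge; exact: h. Qed.

Lemma enorm_continuous : continuous enorm.
Proof. by have [] := enorm_gauge. Qed.

End Gauges.

(** * Cubes, discs and spheres *)

Section ConsRow.
Context (R : realType).

Definition consr d (a : R) (v : 'rV[R]_d) : 'rV[R]_d.+1 :=
  \row_i (if unlift ord0 i is Some j then v 0 j else a).

Definition tailr d (w : 'rV[R]_d.+1) : 'rV[R]_d := \row_j w 0 (lift ord0 j).

Lemma consr_head d a (v : 'rV[R]_d) : consr a v 0 ord0 = a.
Proof. by rewrite mxE unlift_none. Qed.

Lemma consr_lift d a (v : 'rV[R]_d) j : consr a v 0 (lift ord0 j) = v 0 j.
Proof. by rewrite mxE liftK. Qed.

Lemma tailr_consr d a (v : 'rV[R]_d) : tailr (consr a v) = v.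
Proof. by apply/rowP => j; rewrite mxE consr_lift. Qed.

Lemma consr_eta d (w : 'rV[R]_d.+1) : consr (w 0 ord0) (tailr w) = w.
Proof. by apply/rowP => i; rewrite mxE; case: unliftP => [j|] ->; rewrite ?mxE. Qed.

Lemma sqnorm_consr d a (v : 'rV[R]_d) : sqnorm (consr a v) = a ^+ 2 + sqnorm v.
Proof.
rewrite /sqnorm big_ord_recl consr_head; congr (_ + _).
by apply: eq_bigr => i _; rewrite consr_lift.
Qed.

Lemma wc_consr T (A : set T) d (a : T -> R) (f : T -> 'rV[R]_d) :
  {within A, continuous a} -> {within A, continuous f} ->
  {within A, continuous (fun x => consr (a x) (f x))}.
Proof.
move=> ca cf; apply: wc_row => i; case: (unliftP ord0 i) => [j|] ->.
  apply: (@wc_eq _ _ _ (fun x => f x 0 j)); last exact: wc_coord.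
  by move=> x _; rewrite consr_lift.
by apply: (@wc_eq _ _ _ a) => // x _; rewrite consr_head.
Qed.

Lemma wc_tailr T (A : set T) d (f : T -> 'rV[R]_d.+1) :
  {within A, continuous f} -> {within A, continuous (fun x => tailr (f x))}.
Proof.
move=> cf; apply: wc_row => i.
apply: (@wc_eq _ _ _ (fun x => f x 0 (lift ord0 i))); last exact: wc_coord.
by move=> x _; rewrite mxE.
Qed.

Lemma forall_consr d (P : R -> Prop) a (v : 'rV[R]_d) :
  (forall i, P (consr a v 0 i)) <-> P a /\ forall i, P (v 0 i).
Proof.
split=> [H|[Pa Pv] i]; last by rewrite mxE; case: unliftP.
by split=> [|i]; [have := H ord0; rewrite consr_head|
  have := H (lift ord0 i); rewrite consr_lift].
Qed.

Lemma exists_consr d (P : R -> Prop) a (v : 'rV[R]_d) :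
  (exists i, P (consr a v 0 i)) <-> P a \/ exists i, P (v 0 i).
Proof.
split=> [[i]|[Pa|[i Pi]]].
- by rewrite mxE; case: unliftP => [j _ Pj|_]; [right; exists j|left].
- by exists ord0; rewrite consr_head.
- by exists (lift ord0 i); rewrite consr_lift.
Qed.

End ConsRow.

(** * The cube, the disc, and the collapse of the disc onto the sphere *)

Section CubeDisc.
Context (R : realType).

Lemma cubeP d (t : 'rV[R]_d) :
  cube t <-> `|2 *: t - const_mx 1| <= 1.
Proof.
rewrite norm_le//; split=> H i; have := H i; rewrite !mxE.
  by rewrite ler_norml => /andP[? ?]; apply/andP; split; lra.
by rewrite ler_norml => /andP[? ?]; apply/andP; split; lra.
Qed.

Lemma cube_boundaryP d (t : 'rV[R]_d) :
  cube_boundary t <-> `|2 *: t - const_mx 1| = 1.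
Proof.
split=> [[/cubeP ct [i ti]]|t1].
  apply/eqP; rewrite eq_le ct/=.
  apply: le_trans (le_coord_norm _ i); rewrite !mxE.
  case: ti => ->; first by rewrite mulr0 sub0r normrN normr1.
  by rewrite (_ : 2 * 1 - 1 = 1) ?normr1//; lra.
split; first by apply/cubeP; rewrite t1.
have [|i] := @norm_attained R d (2 *: t - const_mx 1).
  by rewrite -normr_eq0 t1 oner_eq0.
rewrite t1 !mxE => ti; exists i.
have := esym ti; move/eqP; rewrite eqr_norml => /andP[/orP[]/eqP h _].
  by right; lra.
by left; lra.
Qed.

Lemma compact_disc d : compact (@disc R d).
Proof.
apply: bounded_closed_compact.
  exists 1; split; first exact: num_real.
  move=> M M1 t; rewrite /disc/= -enorm_le1 => t1.
  apply: (le_trans _ (ltW M1)); rewrite norm_le// => i.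
  by apply: le_trans t1; case: (enorm_gauge R d).
rewrite /disc; apply: closed_le_cont; first exact: sqnorm_continuous.
exact: cst_continuous.
Qed.

Lemma compact_norm1 d : compact [set v : 'rV[R]_d | `|v| <= 1].
Proof.
apply: bounded_closed_compact.
  exists 1; split; first exact: num_real.
  by move=> M M1 t /= t1; exact: le_trans t1 (ltW M1).
by apply: closed_le_cont; [exact: norm_continuous|exact: cst_continuous].
Qed.

Lemma compact_cube d : compact (@cube R d).
Proof.
have := @rV_compact R d (fun=> `[0, 1]%classic) (fun=> @segment_compact R 0 1).
by congr compact; apply/seteqP; split=> t /= ct i; have := ct i; rewrite /= in_itv.
Qed.

Definition cube_disc d (t : 'rV[R]_d) : 'rV[R]_d :=
  rescale (fun v => `|v|) (@enorm R d) (2 *: t - const_mx 1).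

Definition disc_cube d (y : 'rV[R]_d) : 'rV[R]_d :=
  2^-1 *: (rescale (@enorm R d) (fun v => `|v|) y + const_mx 1).

Lemma enorm_cube_disc d (t : 'rV[R]_d) :
  enorm (cube_disc t) = `|2 *: t - const_mx 1|.
Proof.
by rewrite /cube_disc gauge_rescale//; [exact: norm_gauge|exact: enorm_gauge].
Qed.

Lemma disc_cubeE d (y : 'rV[R]_d) :
  2 *: disc_cube y - const_mx 1 = rescale (@enorm R d) (fun v => `|v|) y.
Proof. by rewrite /disc_cube scalerA divff ?pnatr_eq0// scale1r addrK. Qed.

Lemma norm_disc_cube d (y : 'rV[R]_d) :
  `|2 *: disc_cube y - const_mx 1| = enorm y.
Proof.
by rewrite disc_cubeE gauge_rescale//; [exact: enorm_gauge|exact: norm_gauge].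
Qed.

Lemma cube_discK d (t : 'rV[R]_d) : disc_cube (cube_disc t) = t.
Proof.
rewrite /disc_cube /cube_disc rescaleK; [|exact: norm_gauge|exact: enorm_gauge].
by rewrite subrK scalerA mulVf ?pnatr_eq0// scale1r.
Qed.

Lemma disc_cubeK d (y : 'rV[R]_d) : cube_disc (disc_cube y) = y.
Proof.
by rewrite /cube_disc disc_cubeE rescaleK//; [exact: enorm_gauge|exact: norm_gauge].
Qed.

Lemma cube_disc_continuous d : continuous (@cube_disc d).
Proof.
apply: wc_setT; apply: (wc_compC (g := rescale (fun v => `|v|) (@enorm R d))).
  by apply: rescale_continuous; [exact: norm_gauge|exact: enorm_gauge].
apply: wcDr; last exact: wc_cst.
by apply: wcZ; [exact: wc_cst|exact: wc_id].
Qed.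

Lemma disc_cube_continuous d : continuous (@disc_cube d).
Proof.
apply: wc_setT; apply: wcZ; first exact: wc_cst.
apply: wcDr; last exact: wc_cst.
apply: wc_continuous.
by apply: rescale_continuous; [exact: enorm_gauge|exact: norm_gauge].
Qed.

Lemma discP d (y : 'rV[R]_d) : disc y <-> enorm y <= 1.
Proof. by rewrite enorm_le1. Qed.

Lemma unit_sphereP d (y : 'rV[R]_d) : unit_sphere y <-> enorm y = 1.
Proof.
by rewrite /unit_sphere/=; split=> /eqP; [rewrite -enorm_eq1|rewrite enorm_eq1] => /eqP.
Qed.

Lemma sub_sphere_disc d (y : 'rV[R]_d) : unit_sphere y -> disc y.
Proof. by rewrite /unit_sphere /disc /= => ->. Qed.

Lemma cube_disc_disc d (t : 'rV[R]_d) : cube t -> disc (cube_disc t).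
Proof. by rewrite cubeP discP enorm_cube_disc. Qed.

Lemma cube_disc_sphere d (t : 'rV[R]_d) :
  unit_sphere (cube_disc t) <-> cube_boundary t.
Proof. by rewrite cube_boundaryP unit_sphereP enorm_cube_disc. Qed.

Lemma disc_cube_cube d (y : 'rV[R]_d) : disc y -> cube (disc_cube y).
Proof. by rewrite cubeP discP norm_disc_cube. Qed.

Lemma disc_cube_boundary d (y : 'rV[R]_d) :
  cube_boundary (disc_cube y) <-> unit_sphere y.
Proof. by rewrite cube_boundaryP unit_sphereP norm_disc_cube. Qed.

(** A point at radius sin (theta / 2) goes to angle theta from the pole of height 1, since cos theta
    = 1 - 2 sin^2 (theta / 2) and sin theta = 2 sin (theta / 2) cos (theta / 2). The centre goes to
    that pole and the boundary to [spole]. *)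
Definition collapse d (y : 'rV[R]_d) : 'rV[R]_d.+1 :=
  consr (1 - 2 * sqnorm y) ((2 * Num.sqrt (1 - sqnorm y)) *: y).

Definition spole d : 'rV[R]_d.+1 := consr (-1) 0.

Lemma spole_sphere d : unit_sphere (spole d).
Proof. by rewrite /unit_sphere/= sqnorm_consr sqnorm0 addr0 sqrrN expr1n. Qed.

Lemma collapse_continuous d : continuous (@collapse d).
Proof.
have cs A : {within A, continuous (@sqnorm R d)}.
  exact/wc_continuous/sqnorm_continuous.
apply: wc_setT; apply: wc_consr.
  by apply: wcB; [exact: wc_cst|apply: wcM => //; exact: wc_cst].
apply: wcZ; last exact: wc_id.
apply: wcM; first exact: wc_cst.
by apply: wc_sqrt; apply: wcB => //; exact: wc_cst.
Qed.

Lemma collapse_sphere d (y : 'rV[R]_d) : disc y -> unit_sphere (collapse y).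
Proof.
rewrite /disc /unit_sphere/= sqnorm_consr sqnormZ exprMn => y1.
rewrite sqr_sqrtr ?subr_ge0//; ring.
Qed.

Lemma collapse_boundary d (y : 'rV[R]_d) : unit_sphere y -> collapse y = spole d.
Proof.
rewrite /unit_sphere/= /collapse /spole => ->.
by rewrite subrr sqrtr0 mulr0 scale0r; congr consr; ring.
Qed.

Lemma collapse_inj d (y z : 'rV[R]_d) : disc y -> disc z ->
  collapse y = collapse z -> y = z \/ (unit_sphere y /\ unit_sphere z).
Proof.
rewrite /disc/= => y1 z1 yz.
have yzn : sqnorm y = sqnorm z.
  have : collapse y 0 ord0 = collapse z 0 ord0 by rewrite yz.
  rewrite !consr_head; lra.
have [y1'|y1'] := eqVneq (sqnorm y) 1; first by right; rewrite /unit_sphere/= -yzn.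
left; have : tailr (collapse y) = tailr (collapse z) by rewrite yz.
rewrite !tailr_consr yzn; apply: scalerI.
rewrite mulf_neq0 ?pnatr_eq0// sqrtr_eq0 -ltNge subr_gt0 lt_neqAle -yzn y1' y1.
by [].
Qed.

Lemma collapse_surj d (p : 'rV[R]_d.+1) : unit_sphere p -> p <> spole d ->
  exists2 y, open_disc y & collapse y = p.
Proof.
rewrite /unit_sphere/= -(consr_eta p); move: (p 0 ord0) (tailr p) => a v.
rewrite sqnorm_consr => av pb.
have a1 : -1 < a.
  have a1 : -1 <= a.
    have := sqnorm_ge0 v; have [//|alt v0] := leP (-1) a; nra.
  rewrite lt_neqAle a1 andbT; apply/negP => /eqP aE; apply: pb.
  rewrite /spole -aE; congr consr; apply: sqnorm_eq0; move: av; rewrite -aE; nra.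
(* The factor [2 * Num.sqrt (1 - sqnorm y)] of the collapse, expressed through the height
   [a = 1 - 2 * sqnorm y]. *)
pose k := 2 * Num.sqrt ((1 + a) / 2).
have k0 : k != 0.
  by rewrite mulf_neq0 ?pnatr_eq0// sqrtr_eq0 -ltNge divr_gt0//; lra.
have k2 : k ^+ 2 = 2 * (1 + a).
  by rewrite exprMn sqr_sqrtr; [field|rewrite divr_ge0//; lra].
have yn : sqnorm (k^-1 *: v) = (1 - a) / 2.
  rewrite sqnormZ exprVn k2; have -> : sqnorm v = 1 - a ^+ 2 by lra.
  by field; lra.
exists (k^-1 *: v); first by rewrite /open_disc/= yn; lra.
rewrite /collapse yn; congr consr; first by field.
rewrite scalerA (_ : 1 - (1 - a) / 2 = (1 + a) / 2); last by field.
by rewrite -/k divff// scale1r.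
Qed.

(** The identification of the cube modulo its boundary with the sphere, through which loops are
    compared with maps of spheres. *)
Definition kap d (t : 'rV[R]_d) := collapse (cube_disc t).

Lemma kap_continuous d : continuous (@kap d).
Proof.
apply: wc_setT; apply: (wc_compC (g := @collapse d)).
  exact: collapse_continuous.
exact/wc_continuous/cube_disc_continuous.
Qed.

Lemma kap_sphere d (t : 'rV[R]_d) : cube t -> unit_sphere (kap t).
Proof. by move=> ct; apply: collapse_sphere; exact: cube_disc_disc. Qed.

Lemma kap_boundary d (t : 'rV[R]_d) : cube_boundary t -> kap t = spole d.
Proof. by move=> ct; apply: collapse_boundary; exact/cube_disc_sphere. Qed.

Lemma kap_inj d (t t' : 'rV[R]_d) : cube t -> cube t' -> kap t = kap t' ->
  t = t' \/ (cube_boundary t /\ cube_boundary t').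
Proof.
move=> ct ct' /collapse_inj[||tt'|[b b']]; try exact: cube_disc_disc.
  by left; rewrite -(cube_discK t) tt' cube_discK.
by right; split; exact/cube_disc_sphere.
Qed.

Lemma kap_surj d (p : 'rV[R]_d.+1) : unit_sphere p -> p <> spole d ->
  exists2 t, cube t & kap t = p.
Proof.
move=> p1 pb; have [y y1 <-] := collapse_surj p1 pb.
exists (disc_cube y); last by rewrite /kap disc_cubeK.
by apply: disc_cube_cube; exact: ltW y1.
Qed.

End CubeDisc.

Ltac wc_step := match goal with
| |- continuous (from_subspace _ (fun q => q)) => exact: wc_id
| |- continuous (from_subspace _ (fun=> ?u)) => apply: (@wc_cst _ _ _ u)
| |- continuous (from_subspace _ (fun q => fst (@?f q))) => apply: (@wc_fst _ _ _ _ f)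
| |- continuous (from_subspace _ (fun q => snd (@?f q))) => apply: (@wc_snd _ _ _ _ f)
| |- continuous (from_subspace _ (fun q => (@?f q, @?g q))) => apply: (@wc_pair _ _ _ _ f g)
| |- continuous (from_subspace _ (fun q => - (@?f q))) => apply: (@wcN _ _ _ f)
| |- continuous (from_subspace _ (fun q => @?f q - @?g q)) =>
    first [apply: (@wcB _ _ _ f g) | apply: (@wcDr _ _ _ _ f (fun q => - g q))]
| |- continuous (from_subspace _ (fun q => @?f q + @?g q)) =>
    first [apply: (@wcD _ _ _ f g) | apply: (@wcDr _ _ _ _ f g)]
| |- continuous (from_subspace _ (fun q => @?f q * @?g q)) => apply: (@wcM _ _ _ f g)
| |- continuous (from_subspace _ (fun q => @?f q *: @?g q)) => apply: (@wcZ _ _ _ _ f g)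
| |- continuous (from_subspace _ (fun q => Num.max (@?f q) (@?g q))) => apply: (@wc_max _ _ _ f g)
| |- continuous (from_subspace _ (fun q => Num.min (@?f q) (@?g q))) => apply: (@wc_min _ _ _ f g)
| |- continuous (from_subspace _ (fun q => fun_of_matrix (@?f q) _ ?i)) => apply: (@wc_coord _ _ _ _ f i)
| |- continuous (from_subspace _ (fun q => consr (@?f q) (@?g q))) => apply: (@wc_consr _ _ _ _ f g)
| |- continuous (from_subspace _ (fun q => tailr (@?f q))) => apply: (@wc_tailr _ _ _ _ f)
| |- continuous (from_subspace _ (fun q => enorm (@?f q))) =>
    apply: (@wc_compC _ _ _ _ f (@enorm _ _)); first exact: enorm_continuous
| |- continuous (from_subspace _ (fun q => `|@?f q|)) => apply: (@wc_norm _ _ _ _ f)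
| |- continuous (from_subspace _ ( *:%R ?a)) =>
    apply: (@wcZ _ _ _ _ (fun=> a) (fun q => q))
| |- continuous (from_subspace _ (@enorm _ _)) => apply/wc_continuous/enorm_continuous
| |- continuous (from_subspace _ fst) => apply/wc_continuous/fst_continuous
| |- continuous (from_subspace _ snd) => apply/wc_continuous/snd_continuous
end.
Ltac wc_auto := repeat wc_step.

(** * Cones over spheres: null-homotopies and extensions to discs *)

Section Cones.
Context (R : realType).

Definition cyl d (A : set 'rV[R]_d) : set (R * 'rV[R]_d) := `[0, 1] `*` A.

Lemma cylP d (A : set 'rV[R]_d) q : cyl A q <-> 0 <= q.1 <= 1 /\ A q.2.
Proof. by rewrite /cyl /= in_itv. Qed.

Lemma compact_cyl d (A : set 'rV[R]_d) : compact A -> compact (cyl A).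
Proof. by move=> cA; apply: compact_setX => //; exact: segment_compact. Qed.

Lemma cyl0 d (A : set 'rV[R]_d) y : A y -> cyl A (0, y).
Proof. by move=> Ay; apply/cylP; rewrite /= lexx ler01. Qed.

Lemma cyl1 d (A : set 'rV[R]_d) y : A y -> cyl A (1, y).
Proof. by move=> Ay; apply/cylP; rewrite /= lexx ler01. Qed.

Lemma wc_reverse d Y (A : set 'rV[R]_d) (H : R * 'rV[R]_d -> Y) :
  {within cyl A, continuous H} ->
  {within cyl A, continuous (fun q => H (1 - q.1, q.2))}.
Proof.
move=> cH.
apply: (@wc_comp _ _ _ _ _ (fun q : R * 'rV[R]_d => (1 - q.1, q.2)) H) cH _.
  move=> q /cylP[/andP[q0 q1] Aq]; apply/cylP; split=> //=.
  by apply/andP; split; lra.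
by wc_auto.
Qed.

Lemma wc_concat d Y (A : set 'rV[R]_d) (K L : R * 'rV[R]_d -> Y) :
  {within cyl A, continuous K} -> {within cyl A, continuous L} ->
  (forall y, A y -> K (1, y) = L (0, y)) ->
  {within cyl A, continuous (fun q =>
    if q.1 <= 2^-1 then K (2 * q.1, q.2) else L (2 * q.1 - 1, q.2))}.
Proof.
move=> cK cL KL; apply: wc_if.
- exact: fst_continuous.
- exact: cst_continuous.
- apply: (@wc_comp _ _ _ _ _ (fun q : R * 'rV[R]_d => (2 * q.1, q.2)) K) cK _.
    move=> q [/cylP[q01 Aq] /= q2]; apply/cylP; split=> //=.
    by apply/andP; split; lra.
  by wc_auto.
- apply: (@wc_comp _ _ _ _ _ (fun q : R * 'rV[R]_d => (2 * q.1 - 1, q.2)) L) cL _.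
    move=> q [/cylP[q01 Aq] /= q2]; apply/cylP; split=> //=.
    by apply/andP; split; lra.
  by wc_auto.
- by move=> q /cylP[_ Aq] ->; rewrite divff ?pnatr_eq0// subrr KL.
Qed.

(** A chord from the sphere to [spole]. It stays in the disc and is constant when it starts at
    [spole], so the homotopies it yields are relative to the boundary of the cube. *)
Definition cone_pt d (q : R * 'rV[R]_d) : 'rV[R]_d.+1 :=
  (1 - q.1) *: kap q.2 + q.1 *: spole R d.

Lemma cone_pt_continuous d : continuous (@cone_pt d).
Proof.
apply: wc_setT; rewrite /cone_pt; wc_auto.
apply: (@wc_compC _ _ _ _ snd (@kap R d)); first exact: kap_continuous.
exact/wc_continuous/snd_continuous.
Qed.

Lemma sphere_decomp d (p : 'rV[R]_d.+1) : unit_sphere p ->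
  p 0 ord0 ^+ 2 + sqnorm (tailr p) = 1.
Proof. by rewrite /unit_sphere/= -{1}(consr_eta p) sqnorm_consr. Qed.

Lemma cone_pt_head d (q : R * 'rV[R]_d) :
  cone_pt q 0 ord0 = (1 - q.1) * kap q.2 0 ord0 - q.1.
Proof. by rewrite !mxE unlift_none mulrN1. Qed.

Lemma cone_pt_tail d (q : R * 'rV[R]_d) :
  tailr (cone_pt q) = (1 - q.1) *: tailr (kap q.2).
Proof.
apply/rowP => j; rewrite !mxE !liftK.
by rewrite [(0 : 'rV[R]_d) _ _]mxE mulr0 addr0.
Qed.

Lemma cone_pt_disc d (q : R * 'rV[R]_d) : cyl (@cube R d) q -> disc (cone_pt q).
Proof.
move=> /cylP[/andP[q0 q1] cq]; have := sphere_decomp (kap_sphere cq).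
rewrite /disc/= -(consr_eta (cone_pt q)) sqnorm_consr cone_pt_head cone_pt_tail.
rewrite sqnormZ; move: (kap _ 0 _) (sqnorm _) (sqnorm_ge0 (tailr (kap q.2))).
move=> a n n0 an.
have a1 : -1 <= a by have [//|] := leP (-1) a; nra.
have -> : n = 1 - a ^+ 2 by lra.
have -> : ((1 - q.1) * a - q.1) ^+ 2 + (1 - q.1) ^+ 2 * (1 - a ^+ 2) =
  1 - 2 * (1 - q.1) * q.1 * (1 + a) by ring.
rewrite gerBl; apply: mulr_ge0; last by lra.
by apply: mulr_ge0 => //; lra.
Qed.

Lemma cone_pt0 d (t : 'rV[R]_d) : cone_pt (0, t) = kap t.
Proof. by rewrite /cone_pt/= subr0 scale1r scale0r addr0. Qed.

Lemma cone_pt1 d (t : 'rV[R]_d) : cone_pt (1, t) = spole R d.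
Proof. by rewrite /cone_pt/= subrr scale1r scale0r add0r. Qed.

Lemma cone_ptb d (q : R * 'rV[R]_d) : kap q.2 = spole R d ->
  cone_pt q = spole R d.
Proof. by rewrite /cone_pt => ->; rewrite -scalerDl subrK scale1r. Qed.

Lemma cube0 d : cube (0 : 'rV[R]_d).
Proof. by move=> i; rewrite mxE lexx ler01. Qed.

Lemma cube_boundary0 d : cube_boundary (0 : 'rV[R]_d.+1).
Proof. by split; [exact: cube0|exists ord0; left; rewrite mxE]. Qed.

Lemma kap_onto d (p : 'rV[R]_d.+2) : unit_sphere p -> exists2 t, cube t & kap t = p.
Proof.
move=> p1; have [->|pb] := pselect (p = spole R d.+1); last exact: kap_surj.
by exists 0; [exact: cube0|apply: kap_boundary; exact: cube_boundary0].
Qed.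

(* The disc is the cone over the sphere with apex its centre. *)
Lemma cone_factor d Z (H : R * 'rV[R]_d.+1 -> Z) (z : Z) :
  {within cyl (@cube R d.+1), continuous H} ->
  (forall t, cube t -> H (1, t) = z) ->
  (forall s t t', 0 <= s <= 1 -> cube_boundary t -> cube_boundary t' ->
    H (s, t) = H (s, t')) ->
  exists2 c : 'rV[R]_d.+2 -> Z, {within @disc R d.+2, continuous c} &
    forall t, cube t -> c (kap t) = H (0, t).
Proof.
move=> cH H1 Hb.
pose w (q : R * 'rV[R]_d.+1) := (1 - q.1) *: kap q.2.
have ew q : cyl (@cube R d.+1) q -> enorm (w q) = 1 - q.1.
  move=> /cylP[/andP[q0 q1] cq]; rewrite /w enormZ; last by lra.
  by have /unit_sphereP -> := kap_sphere cq; rewrite mulr1.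
have [] := @quotient_factor (R * 'rV[R]_d.+1)%type 'rV[R]_d.+2 Z
  (cyl (@cube R d.+1)) w H (0, 0).
- exact/compact_cyl/compact_cube.
- exact: norm_hausdorff.
- rewrite /w; wc_auto; apply: (@wc_compC _ _ _ _ snd (@kap R d.+1)); last by wc_auto.
  exact: kap_continuous.
- exact: cH.
- move=> q q' cq cq' ww; have qq : q.1 = q'.1.
    by have := ew _ cq; rewrite ww ew// => /addrI/oppr_inj.
  move: cq cq' ww; case: q qq => s t /=; case: q' => s' t' /= <- {s'}.
  move=> /cylP[/= s01 ct] /cylP[/= _ ct'].
  have [->|s1] := eqVneq s 1; first by rewrite !H1.
  rewrite /w /= => /scalerI kk.
  have [|->//|[bt bt']] := kap_inj ct ct' _; last exact: Hb.
  by apply: kk; apply/negP => /eqP; lra.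
move=> c cc cE; exists c; last first.
  by move=> t ct; rewrite -cE; [rewrite /w /= subr0 scale1r|exact: cyl0].
apply: wc_sub cc => p /discP p1.
have [->|p0] := eqVneq p 0.
  exists (1, 0); last by rewrite /w /= subrr scale0r.
  by apply: cyl1; exact: cube0.
have e0 : enorm p != 0 by rewrite gauge_eq0//; exact: enorm_gauge.
have ep : 0 < enorm p by rewrite lt_neqAle eq_sym e0 enorm_ge0.
have [|t ct kt] := @kap_onto d ((enorm p)^-1 *: p).
  by apply/unit_sphereP; rewrite enormZ ?mulVf// invr_ge0 ltW.
exists (1 - enorm p, t); first by apply/cylP; split=> //=; apply/andP; split; lra.
by rewrite /w /= kt scalerA (_ : _ * _ = 1) ?scale1r//; field.
Qed.

Lemma is_loop_kap d Z (c : 'rV[R]_d.+1 -> Z) :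
  {within @unit_sphere R d.+1, continuous c} ->
  is_loop (c (spole R d)) (c \o @kap R d).
Proof.
move=> cc; split=> [|t ct]; last by rewrite /= kap_boundary.
apply: (wc_comp _ cc); first by move=> t; exact: kap_sphere.
exact/wc_continuous/kap_continuous.
Qed.

Lemma null_of_ext d Z (c : 'rV[R]_d.+1 -> Z) :
  {within @disc R d.+1, continuous c} ->
  loop_homotopic (c (spole R d)) (c \o @kap R d) (cst (c (spole R d))).
Proof.
move=> cc; exists (c \o @cone_pt d); split.
- apply: (wc_comp _ cc); first by move=> q; exact: cone_pt_disc.
  exact/wc_continuous/cone_pt_continuous.
- by move=> t _; rewrite /= cone_pt0.
- by move=> t _; rewrite /= cone_pt1.
- by move=> s t _ bt; rewrite /= cone_ptb//= kap_boundary.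
Qed.

Lemma ext_of_null d Z (c : 'rV[R]_d.+1 -> Z) :
  loop_homotopic (c (spole R d)) (c \o @kap R d) (cst (c (spole R d))) ->
  exists2 c' : 'rV[R]_d.+1 -> Z, {within @disc R d.+1, continuous c'} &
    forall p, unit_sphere p -> c' p = c p.
Proof.
case: d c => [|d] c [H [cH H0 H1 Hb]]; last first.
  have [|c' cc' c'E] := cone_factor cH H1.
    by move=> s t t' s01 bt bt'; rewrite !Hb.
  by exists c' => // p /kap_onto[t ct <-]; rewrite c'E// H0.
(* For [d = 0] the cube is a point without boundary and [kap] reaches only the pole 1; the
   null-homotopy is a path, run here along the segment from 1 to -1. *)
exists (fun p => H ((1 - p 0 ord0) / 2, 0)).
  apply: (@wc_comp _ _ _ _ _ (fun p : 'rV[R]_1 => ((1 - p 0 ord0) / 2, 0 : 'rV[R]_0)) H) cH _.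
    move=> p /discP p1; apply/cylP; split; last exact: cube0.
    have [_ _ _ /(_ p ord0)] := enorm_gauge R 1; rewrite ler_norml => /andP[? ?] /=.
    by apply/andP; split; lra.
  by wc_auto.
move=> p; rewrite -(consr_eta p); move: (p 0 ord0) (tailr p) => a v.
have -> : v = 0 by apply/rowP => -[].
rewrite /unit_sphere /= sqnorm_consr sqnorm0 addr0 consr_head => /eqP.
rewrite sqrf_eq1 => /orP[]/eqP ->; last first.
  by rewrite (_ : (1 - -1) / 2 = 1) ?H1//; [exact: cube0|lra].
rewrite subrr mul0r H0 /=; last exact: cube0.
congr c; rewrite /kap /collapse; congr consr; last by apply/rowP => -[].
by rewrite /sqnorm big_ord0 mulr0 subr0.
Qed.

Lemma ext_trivial d Z (c : 'rV[R]_d.+1 -> Z) :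
  homotopy_group_trivial R d (c (spole R d)) ->
  {within @unit_sphere R d.+1, continuous c} ->
  exists2 c' : 'rV[R]_d.+1 -> Z, {within @disc R d.+1, continuous c'} &
    forall p, unit_sphere p -> c' p = c p.
Proof. by move=> Z0 cc; apply: ext_of_null; exact/Z0/is_loop_kap. Qed.

(** Injectivity at the trivial class only: this is what extending over a disc requires, and it makes
    sense in degree 0 as well. *)
Definition pi_inj d Z Y (g : Z -> Y) :=
  forall z (h : 'rV[R]_d -> Z), is_loop z h ->
    loop_homotopic (g z) (g \o h) (cst (g z)) -> loop_homotopic z h (cst z).

Definition pi_surj d Z Y (g : Z -> Y) :=
  forall z (h : 'rV[R]_d -> Y), is_loop (g z) h ->
    exists2 e, is_loop z e & loop_homotopic (g z) (g \o e) h.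

(** The extension [b] of [g \o c] shows that the image of the class of [c] is null, and [pi_inj]
    brings this back to [c] itself. *)
Lemma ext_inj d Z Y (g : Z -> Y) (c : 'rV[R]_d.+1 -> Z)
    (b : 'rV[R]_d.+1 -> Y) :
  pi_inj d g -> {within @unit_sphere R d.+1, continuous c} ->
  {within @disc R d.+1, continuous b} ->
  (forall p, unit_sphere p -> b p = g (c p)) ->
  exists2 c' : 'rV[R]_d.+1 -> Z, {within @disc R d.+1, continuous c'} &
    forall p, unit_sphere p -> c' p = c p.
Proof.
move=> gi cc cb bgc; apply: ext_of_null; apply: gi; first exact: is_loop_kap.
have := null_of_ext cb; rewrite bgc; last exact: spole_sphere.
move=> [H [cH H0 H1 Hb]]; exists H; split=> // t ct.
by rewrite H0//= bgc//; exact: kap_sphere.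
Qed.

End Cones.

(** * Compression of discs *)

Section DiscHomotopies.
Context (R : realType).

Definition dhom d Y (f f' : 'rV[R]_d -> Y) :=
  exists K : R * 'rV[R]_d -> Y,
    [/\ {within cyl (@disc R d), continuous K},
        forall y, disc y -> K (0, y) = f y,
        forall y, disc y -> K (1, y) = f' y &
        forall s y, 0 <= s <= 1 -> unit_sphere y -> K (s, y) = f y].

Lemma dhom_trans d Y (f f' f'' : 'rV[R]_d -> Y) :
  dhom f f' -> dhom f' f'' -> dhom f f''.
Proof.
move=> [K [cK K0 K1 Ks]] [L [cL L0 L1 Ls]].
exists (fun q => if q.1 <= 2^-1 then K (2 * q.1, q.2) else L (2 * q.1 - 1, q.2)).
split=> [|y dy|y dy|s y s01 sy].
- by apply: wc_concat => // y dy; rewrite K1// L0.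
- by rewrite /= invr_ge0 ler0n mulr0 K0.
- rewrite /= ifF; last by apply: lt_geF; lra.
  by rewrite (_ : 2 * 1 - 1 = 1) ?L1//; lra.
- have sd := sub_sphere_disc sy; case: ifPn => /= s2.
    by apply: Ks => //; lra.
  rewrite Ls//; last by rewrite -ltNge in s2; lra.
  by rewrite -K1// Ks// ler01 lexx.
Qed.

(** The radial retraction onto the disc. Applied to a multiple of [y] it serves as a direction
    [y / enorm y] that remains continuous at the origin. *)
Definition clip d (y : 'rV[R]_d) := (Num.max 1 (enorm y))^-1 *: y.

Lemma clip_continuous d : continuous (@clip d).
Proof.
apply: wc_setT; rewrite /clip; apply: wcZ; last exact: wc_id.
apply: wcV; first by wc_auto.
by move=> y _; rewrite gt_eqF// lt_max ltr01.
Qed.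

Lemma clip_disc d (y : 'rV[R]_d) : disc (clip y).
Proof.
have m0 : 0 < Num.max 1 (enorm y) by rewrite lt_max ltr01.
apply/discP; rewrite /clip enormZ ?invr_ge0 ?(ltW m0)//.
by rewrite mulrC ler_pdivrMr// mul1r le_max lexx orbT.
Qed.

Lemma clip_id d (y : 'rV[R]_d) : disc y -> clip y = y.
Proof. by move/discP => y1; rewrite /clip max_l// invr1 scale1r. Qed.

Lemma clip_out d (y : 'rV[R]_d) : 1 <= enorm y -> clip y = (enorm y)^-1 *: y.
Proof. by move=> y1; rewrite /clip max_r. Qed.

Lemma clip_sphere d (y : 'rV[R]_d) : 1 <= enorm y -> unit_sphere (clip y).
Proof.
move=> y1; apply/unit_sphereP; rewrite clip_out// enormZ ?invr_ge0 ?enorm_ge0//.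
by rewrite mulVf// gt_eqF// (lt_le_trans ltr01).
Qed.

Lemma clipZ d (a b : R) (y : 'rV[R]_d) : 0 < a -> 0 < b ->
  1 <= a * enorm y -> 1 <= b * enorm y -> clip (a *: y) = clip (b *: y).
Proof.
move=> a0 b0 ya yb; rewrite !clip_out ?enormZ ?(ltW a0) ?(ltW b0)// !scalerA.
have y0 : enorm y != 0 by apply/negP => /eqP y0; rewrite y0 in ya; lra.
by congr (_ *: _); field; rewrite y0 !gt_eqF.
Qed.

Lemma wc_clip T (A : set T) d (f : T -> 'rV[R]_d) :
  {within A, continuous f} -> {within A, continuous (fun x => clip (f x))}.
Proof. exact/(wc_compC (g := @clip d))/clip_continuous. Qed.

Lemma disc_surj d Z Y (g : Z -> Y) (z : Z) (f : 'rV[R]_d -> Y) :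
  pi_surj R d g -> {within @disc R d, continuous f} ->
  (forall y, unit_sphere y -> f y = g z) ->
  exists e : 'rV[R]_d -> Z, [/\ {within @disc R d, continuous e},
    forall y, unit_sphere y -> e y = z & dhom (g \o e) f].
Proof.
move=> gs cf fb; have [|e [ce eb] [H [cH H0 H1 Hb]]] := gs z (f \o @cube_disc R d).
  split=> [|t bt]; last by apply: fb; exact/cube_disc_sphere.
  apply: (wc_comp _ cf); first exact: cube_disc_disc.
  exact/wc_continuous/cube_disc_continuous.
exists (e \o @disc_cube R d); split.
- apply: (wc_comp _ ce); first exact: disc_cube_cube.
  exact/wc_continuous/disc_cube_continuous.
- by move=> y sy; apply: eb; exact/disc_cube_boundary.
exists (fun q => H (q.1, disc_cube q.2)); split=> [|y dy|y dy|s y s01 sy].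
- apply: (wc_comp (f := fun q : R * 'rV[R]_d => (q.1, disc_cube q.2)) _ cH).
    by move=> q /cylP[q1 dq]; apply/cylP; split=> //; exact: disc_cube_cube.
  apply: wc_pair; first by wc_auto.
  apply: (@wc_compC _ _ _ _ snd (@disc_cube R d)); last by wc_auto.
  exact: disc_cube_continuous.
- by rewrite /= H0//; exact: disc_cube_cube.
- by rewrite /= H1 /= ?disc_cubeK//; exact: disc_cube_cube.
- rewrite /= Hb//; last exact/disc_cube_boundary.
  by rewrite eb//; exact/disc_cube_boundary.
Qed.

End DiscHomotopies.

Section Compression.
Context (R : realType) (d : nat) (Z Y : topologicalType) (g : Z -> Y).
Context (c : 'rV[R]_d -> Z) (b : 'rV[R]_d -> Y).
Hypotheses (cg : continuous g) (cc : {within @disc R d, continuous c}).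
Hypotheses (cb : {within @disc R d, continuous b}).
Hypothesis bc : forall y, unit_sphere y -> b y = g (c y).

Let wc_scale T (A : set T) (W : topologicalType)
    (h : 'rV[R]_d -> W) (a : T -> R) (f : T -> 'rV[R]_d) :
  {within @disc R d, continuous h} ->
  (forall x, A x -> 0 <= a x <= 1) -> {within A, continuous a} ->
  {within A, continuous f} ->
  {within A, continuous (fun x => h (a x *: clip (f x)))}.
Proof.
move=> ch a01 ca cf.
apply: (@wc_comp _ _ _ _ (@disc R d) (fun x => a x *: clip (f x)) h) => //.
  move=> x Ax; have /andP[a0 a1] := a01 _ Ax; have /discP u1 := clip_disc (f x).
  by apply/discP; rewrite enormZ// mulr_ile1 ?enorm_ge0.
by apply: wcZ => //; exact: wc_clip.
Qed.

Let wc_disc T (A : set T) (W : topologicalType)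
    (h : 'rV[R]_d -> W) (a : R) (f : T -> 'rV[R]_d) :
  {within @disc R d, continuous h} ->
  (forall x, A x -> 0 <= a /\ a * enorm (f x) <= 1) ->
  {within A, continuous f} -> {within A, continuous (fun x => h (a *: f x))}.
Proof.
move=> ch a1 cf; apply: (@wc_comp _ _ _ _ (@disc R d) (fun x => a *: f x) h) => //.
  by move=> x /a1[a0 ?]; apply/discP; rewrite enormZ.
by wc_auto.
Qed.

Let clip4 (a : R) (y : 'rV[R]_d) : 0 < a -> 1 <= a * enorm y -> 1 <= 4 * enorm y ->
  clip (4 *: y) = clip (a *: y).
Proof. by move=> a0 ay y4; apply: clipZ => //; lra. Qed.

Let sphere_scale (a : R) (y : 'rV[R]_d) : 0 <= a -> a * enorm y = 1 ->
  unit_sphere (a *: y).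
Proof. by move=> a0 ay; apply/unit_sphereP; rewrite enormZ. Qed.

(* [c] is changed near the centre of the disc by a map representing the
   difference of [b] and [g \o c], which lifts to [Z]. *)
Lemma compression : pi_surj R d g ->
  exists c' : 'rV[R]_d -> Z, [/\ {within @disc R d, continuous c'},
    forall y, unit_sphere y -> c' y = c y & dhom (g \o c') b].
Proof.
move=> gs.
have en0 := @enorm_ge0 R d.
(* [b] on the inner half and [g \o c] turned inside out on the outer half: the boundary goes to the
   single point [g (c 0)], and the class is the difference of [b] and [g \o c]. *)
pose f y := if enorm y <= 2^-1 then b (2 *: y)
            else g (c ((2 - 2 * enorm y) *: clip (4 *: y))).
have cgc : {within @disc R d, continuous (fun y => g (c y))} by exact: wc_compC.
have cf : {within @disc R d, continuous f}.
  apply: wc_if.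
  - exact: enorm_continuous.
  - exact: cst_continuous.
  - apply: wc_disc => //; last exact: wc_id.
    by move=> y [_ /= y2]; split; lra.
  - apply: (@wc_scale _ _ _ (fun y => g (c y)) (fun y => 2 - 2 * enorm y)) => //.
    + by move=> y [/discP dy /= y2]; apply/andP; split; lra.
    + by wc_auto.
    + by wc_auto.
  - move=> y _ y2; rewrite y2 (_ : 2 - 2 * 2^-1 = 1); last by lra.
    rewrite scale1r (@clip4 2) ?y2//; [|lra..].
    have s2y : unit_sphere (2 *: y) by apply: sphere_scale; rewrite ?y2//; lra.
    by rewrite clip_id ?bc//; exact: sub_sphere_disc.
have fb y : unit_sphere y -> f y = g (c 0).
  move=> /unit_sphereP y1; rewrite /f y1 ifF; last by apply: lt_geF; lra.
  by rewrite mulr1 subrr scale0r.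
have [e [ce eb [K [cK K0 K1 Ks]]]] := disc_surj gs cf fb.
have c'd y : 2^-1 <= enorm y -> disc y -> 0 <= 2 * enorm y - 1 <= 1.
  by move=> ? /discP ?; apply/andP; split; lra.
have e_half y : enorm y = 2^-1 -> e (2 *: y) = c 0.
  by move=> y2; apply: eb; apply: sphere_scale; rewrite ?y2//; lra.
(* The lifted difference sits in the inner half; outside it [c] is run from its centre to its
   boundary. *)
exists (fun y => if enorm y <= 2^-1 then e (2 *: y)
                 else c ((2 * enorm y - 1) *: clip (4 *: y))).
split.
- apply: wc_if.
  + exact: enorm_continuous.
  + exact: cst_continuous.
  + apply: wc_disc => //; last exact: wc_id.
    by move=> y [_ /= y2]; split; lra.
  + apply: (@wc_scale _ _ _ c (fun y => 2 * enorm y - 1)) => //.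
    * by move=> y [dy /= y2]; exact: c'd.
    * by wc_auto.
    * by wc_auto.
  + move=> y _ y2; rewrite e_half// y2.
    by rewrite divff ?pnatr_eq0// subrr scale0r.
- move=> y sy; have /unit_sphereP y1 := sy.
  rewrite y1 ifF; last by apply: lt_geF; lra.
  rewrite (_ : 2 * 1 - 1 = 1); last by lra.
  rewrite scale1r (@clip4 1) ?y1//; [|lra..].
  by rewrite scale1r clip_id//; exact: sub_sphere_disc.
(* This is [g \o c'] after [g \o e] has been deformed into [f]. Along a radius it follows [b], then
   [g \o c] inwards, then [g \o c] outwards; the next homotopy cancels this detour. *)
pose m y := if enorm y <= 2^-1 then f (2 *: y)
            else g (c ((2 * enorm y - 1) *: clip (4 *: y))).
apply: (@dhom_trans _ _ _ _ m).
  exists (fun q => if enorm q.2 <= 2^-1 then K (q.1, 2 *: q.2)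
            else g (c ((2 * enorm q.2 - 1) *: clip (4 *: q.2)))).
  split=> [|y dy|y dy|s y s01 sy].
  - apply: wc_if.
    + apply: wc_setT; wc_auto.
    + exact: cst_continuous.
    + apply: (@wc_comp _ _ _ _ _ (fun q : R * 'rV[R]_d => (q.1, 2 *: q.2)) K) cK _.
        move=> q [/cylP[q1 dq] /= q2]; apply/cylP; split=> //; apply/discP.
        by rewrite enormZ//; lra.
      by wc_auto.
    + apply: (@wc_scale _ _ _ (fun y => g (c y))
        (fun q : R * 'rV[R]_d => 2 * enorm q.2 - 1)) => //.
      * by move=> q [/cylP[_ dq] /= y2]; exact: c'd.
      * by wc_auto.
      * by wc_auto.
    + move=> q /cylP[q1 _] q2; rewrite Ks//; last first.
        by apply: sphere_scale; rewrite ?q2//; lra.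
      by rewrite /= e_half// q2 divff ?pnatr_eq0// subrr scale0r.
  - rewrite /=; case: ifPn => // y2; rewrite K0//.
    by apply/discP; rewrite enormZ//; lra.
  - rewrite /m /=; case: ifPn => // y2; rewrite K1//.
    by apply/discP; rewrite enormZ//; lra.
  - have /unit_sphereP y1 := sy; have h : (1 <= 2^-1 :> R) = false.
      by apply: lt_geF; lra.
    by rewrite /= y1 h.
(* The position of the detour along a radius of [c]: 1 at radius 1/4, 0 at radius 1/2, 1 again at
   radius 1. Replacing it by its maximum with [s] fills the valley and keeps both ends. *)
pose phi (y : 'rV[R]_d) := Num.max (2 - 4 * enorm y) (2 * enorm y - 1).
have phi01 s y : 4^-1 <= enorm y -> disc y -> 0 <= s <= 1 ->
    0 <= Num.max (phi y) s <= 1.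
  move=> y4 /discP y1 /andP[s0 s1]; rewrite le_max s0 orbT/= !ge_max s1 andbT.
  by apply/andP; split; lra.
have clip_quarter (y : 'rV[R]_d) : enorm y = 4^-1 -> b (4 *: y) = g (c (clip (4 *: y))).
  move=> y4; have s4 : unit_sphere (4 *: y).
    by apply: sphere_scale; rewrite ?y4//; lra.
  by rewrite clip_id ?bc//; exact: sub_sphere_disc.
apply: (@dhom_trans _ _ _ _ (fun y => b (clip (4 *: y)))).
  exists (fun q => if enorm q.2 <= 4^-1 then b (4 *: q.2)
            else g (c (Num.max (phi q.2) q.1 *: clip (4 *: q.2)))).
  split=> [|y dy|y dy|s y s01 sy].
  - apply: wc_if.
    + apply: wc_setT; wc_auto.
    + exact: cst_continuous.
    + apply: (@wc_disc _ _ _ b 4 snd) => //; last by wc_auto.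
      by move=> q [_ /= y2]; split; lra.
    + apply: (@wc_scale _ _ _ (fun y => g (c y))
        (fun q : R * 'rV[R]_d => Num.max (phi q.2) q.1)) => //.
      * by move=> q [/cylP[q1 dq] /= y2]; exact: phi01.
      * by rewrite /phi; wc_auto.
      * by wc_auto.
    + move=> q /cylP[/andP[q0 q1] dq] q4; rewrite clip_quarter//.
      congr (g (c _)); rewrite /phi q4 (_ : 2 - 4 * 4^-1 = 1); last by lra.
      by rewrite !max_l ?scale1r//; lra.
  - rewrite /m /f /=; have e2y : enorm (2 *: y) = 2 * enorm y by rewrite enormZ.
    rewrite e2y; have [y4|y4] := leP (enorm y) 4^-1.
      rewrite ifT; last by lra.
      by rewrite ifT ?scalerA; [congr b; congr (_ *: _); lra|lra].
    have [y2|y2] := leP (enorm y) 2^-1.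
      rewrite ifF; last by apply: lt_geF; lra.
      rewrite /phi max_l; last by rewrite le_max; apply/orP; left; lra.
      rewrite max_l; last by lra.
      rewrite scalerA (_ : 4 * 2 = 8); last by lra.
      by rewrite (@clip4 8); [congr (g (c (_ *: _))); lra|lra..].
    rewrite /phi max_l; last by rewrite le_max; apply/orP; right; lra.
    by rewrite max_r//; lra.
  - rewrite /=; have [y4|y4] := leP (enorm y) 4^-1.
      by rewrite clip_id//; apply/discP; rewrite enormZ//; lra.
    have /discP y1 := dy; rewrite max_r; last by rewrite /phi ge_max; apply/andP; split; lra.
    by rewrite scale1r bc//; apply: clip_sphere; rewrite enormZ//; lra.
  - have /unit_sphereP y1 := sy; rewrite /= /m y1.
    rewrite ifF; last by apply: lt_geF; lra.
    rewrite ifF; last by apply: lt_geF; lra.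
    congr (g (c (_ *: _))); rewrite /phi y1.
    by rewrite [Num.max (2 - _) _]max_r; [rewrite max_l|]; lra.
(* What is left is [b] magnified four times and clipped; the magnification is brought back to 1. *)
exists (fun q => b (clip ((4 - 3 * q.1) *: q.2))); split=> [|y dy|y dy|s y s01 sy].
- apply: (@wc_comp _ _ _ _ (@disc R d)
    (fun q : R * 'rV[R]_d => clip ((4 - 3 * q.1) *: q.2)) b) => //.
    by move=> q _; exact: clip_disc.
  by apply: wc_clip; wc_auto.
- by rewrite /= mulr0 subr0.
- by rewrite /= (_ : 4 - 3 * 1 = 1) ?scale1r ?clip_id//; lra.
- have /unit_sphereP y1 := sy; rewrite /=; congr b.
  by apply: clipZ; rewrite ?y1; lra.
Qed.

End Compression.

(** * Path objects and lifting of cells *)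

Section SubtypeContinuity.
Context (T X : topologicalType) (S : set X) (A : set T).

Lemma wc_subtype (h : T -> set_type S) :
  {within A, continuous (fun t => set_val (h t))} -> {within A, continuous h}.
Proof.
move=> /wcP ch; apply/wcP => x B Ax [B' [[W oW WB'] hx B'B]].
rewrite -WB' in hx.
have := ch x W Ax (open_nbhs_nbhs (conj oW hx)).
by apply: filterS => y Wy Ay; apply: B'B; rewrite -WB'; exact: Wy.
Qed.

Lemma wc_set_val (h : T -> set_type S) :
  {within A, continuous h} -> {within A, continuous (fun t => set_val (h t))}.
Proof.
by apply: wc_compC; exact: (@initial_continuous (set_type S) X set_val).
Qed.

End SubtypeContinuity.

Section PathObjects.
Context (R : realType).

Definition clamp (s : R) : R := Num.max 0 (Num.min 1 s).

Lemma clamp_itv s : 0 <= clamp s <= 1.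
Proof.
by rewrite /clamp le_max lexx/= ge_max ler01/= ge_min lexx.
Qed.

Lemma clamp_id s : 0 <= s <= 1 -> clamp s = s.
Proof. by move=> /andP[s0 s1]; rewrite /clamp min_r// max_r. Qed.

Lemma clampK s : clamp (clamp s) = clamp s.
Proof. by rewrite (clamp_id (clamp_itv s)). Qed.

Lemma wc_clamp T (A : set T) (f : T -> R) :
  {within A, continuous f} -> {within A, continuous (fun x => clamp (f x))}.
Proof. by move=> cf; rewrite /clamp; wc_auto. Qed.

Section PathObject.
Context (Z Y : topologicalType) (g : Z -> Y).

(* Normalizing the paths outside of [0, 1] makes them determined by their values on [0, 1]. *)
Definition path_set : set (Z * {compact-open, R -> Y}) :=
  [set e | [/\ continuous (e.2 : R -> Y), (e.2 : R -> Y) 0 = g e.1 &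
    forall s, (e.2 : R -> Y) s = (e.2 : R -> Y) (clamp s)]].

Definition path_object : topologicalType := set_type path_set.

Definition po_start (e : path_object) : Z := (set_val e).1.
Definition po_path (e : path_object) : R -> Y := (set_val e).2.
Definition po_end (e : path_object) : Y := po_path e 1.

Lemma po_prop (e : path_object) : path_set (set_val e). Proof. exact: set_valP. Qed.

Lemma po_path0 e : po_path e 0 = g (po_start e).
Proof. by case: (po_prop e). Qed.

Lemma po_path_clamp e s : po_path e s = po_path e (clamp s).
Proof. by case: (po_prop e) => _ _; exact. Qed.

Lemma po_ext e e' : po_start e = po_start e' ->
  (forall s, 0 <= s <= 1 -> po_path e s = po_path e' s) -> e = e'.
Proof.
move=> ee ss; apply/val_inj => /=.
rewrite (surjective_pairing (\val e)) (surjective_pairing (\val e')).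
congr pair; first exact: ee.
by apply/funext => s; rewrite [LHS]po_path_clamp [RHS]po_path_clamp ss// clamp_itv.
Qed.

Lemma po_start_continuous : continuous po_start.
Proof.
apply: wc_setT; apply: wc_fst; apply: wc_set_val; exact: wc_id.
Qed.

Lemma po_path_continuous : continuous (fun q : path_object * R => po_path q.1 q.2).
Proof.
have := @continuous_uncurry path_object R Y po_path (@locally_compactR R) (@Rhausdorff R).
have -> : uncurry po_path = (fun q => po_path q.1 q.2) by apply/funext => -[].
apply; last by move=> e; case: (po_prop e).
have : {within setT, continuous
    (fun e : path_object => (set_val e).2 : {compact-open, R -> Y})}.
  by apply: wc_snd; apply: wc_set_val; exact: wc_id.
exact: wc_setT.
Qed.

Lemma wc_po_path T (A : set T) (e : T -> path_object) (s : T -> R) :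
  {within A, continuous e} -> {within A, continuous s} ->
  {within A, continuous (fun t => po_path (e t) (s t))}.
Proof.
move=> ce cs; apply: (@wc_compC _ _ _ _ (fun t => (e t, s t))
  (fun q : path_object * R => po_path q.1 q.2)); first exact: po_path_continuous.
exact: wc_pair.
Qed.

(** Currying. A point of [A] is asked for because it supplies the value off [A], where the
    conditions on [G] may fail. *)
Lemma po_build T (A : set T) (a : T -> Z) (G : T * R -> Y) :
  {within A, continuous a} -> continuous G ->
  (forall t, A t -> G (t, 0) = g (a t)) ->
  (forall t s, A t -> G (t, s) = G (t, clamp s)) -> (exists t, A t) ->
  exists e : T -> path_object, {within A, continuous e} /\
    forall t, A t -> po_start (e t) = a t /\ forall s, po_path (e t) s = G (t, s).
Proof.
move=> ca cG G0 Gc [t0 At0].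
pose F t : Z * {compact-open, R -> Y} := (a t, curry G t).
have [cG1 cG2] := continuous_curry cG.
have FS t : A t -> F t \in path_set.
  move=> At; apply/mem_set; split => /=; first exact: cG2.
    by rewrite /curry G0.
  by move=> s; rewrite /curry Gc.
pose e t : path_object := insubd (exist _ (F t0) (FS _ At0)) (F t).
have eE t : A t -> set_val (e t) = F t by move=> At; exact: (insubdK _ (FS _ At)).
exists e; split; last first.
  by move=> t At; rewrite /po_start /po_path eE.
apply: wc_subtype; apply: (@wc_eq _ _ _ F); first by move=> t At; rewrite eE.
by apply: wc_pair => //; exact: wc_continuous.
Qed.

End PathObject.

(** The right lifting property against the inclusion of the sphere in the disc, with strict
    equalities. For [d = 0] the sphere is empty and this is surjectivity. *)
Definition rlp d (E Y : topologicalType) (p : E -> Y) :=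
  forall (c : 'rV[R]_d -> E) (b : 'rV[R]_d -> Y),
  {within @unit_sphere R d, continuous c} -> {within @disc R d, continuous b} ->
  (forall y, unit_sphere y -> p (c y) = b y) ->
  exists c' : 'rV[R]_d -> E, [/\ {within @disc R d, continuous c'},
    forall y, unit_sphere y -> c' y = c y & forall y, disc y -> p (c' y) = b y].

Lemma rV0_eq0 (v : 'rV[R]_0) : v = 0.
Proof. by apply/rowP => -[]. Qed.

Lemma path_clamp Y (x y : Y) : joined R x y ->
  exists p : R -> Y, [/\ continuous p, p 0 = x, p 1 = y & forall s, p s = p (clamp s)].
Proof.
move=> [p [cp p0 p1]]; exists (p \o clamp); split => [||| s].
- apply: wc_setT; apply: (wc_comp _ cp).
    by move=> s _; rewrite /= in_itv/= clamp_itv.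
  by apply: wc_clamp; exact: wc_id.
- by rewrite /= clamp_id ?lexx ?ler01.
- by rewrite /= clamp_id ?lexx ?ler01.
- by rewrite /= clampK.
Qed.

Lemma rlp_path_object0 Z Y (g : Z -> Y) :
  (forall y, exists z, joined R (g z) y) -> rlp 0 (@po_end Z Y g).
Proof.
move=> gs c b _ _ _; have [z /path_clamp[p [cp p0 p1 pc]]] := gs (b 0).
have [|||||e [ce eE]] := @po_build Z Y g 'rV[R]_0 setT (fun=> z) (fun q => p q.2).
- exact: wc_cst.
- by apply: wc_setT; apply: (@wc_compC _ _ _ _ snd p) => //; wc_auto.
- by [].
- by move=> t s _ /=.
- by exists 0.
exists e; split.
- exact: wc_sub ce.
- by move=> y; rewrite /unit_sphere/= (rV0_eq0 y) sqnorm0 => /esym/eqP; rewrite oner_eq0.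
- by move=> y _; rewrite /po_end (eE y I).2 p1 (rV0_eq0 y).
Qed.

End PathObjects.

(** * Lifting a cell through a mapping path space *)

Section PathObjectLifting.
Context (R : realType) (d : nat) (Z Y : topologicalType) (g : Z -> Y).
Context (c : 'rV[R]_d.+1 -> path_object R g) (b : 'rV[R]_d.+1 -> Y).
Hypotheses (cg : continuous g).
Hypotheses (cc : {within @unit_sphere R d.+1, continuous c}).
Hypotheses (cb : {within @disc R d.+1, continuous b}).
Hypothesis cbE : forall y, unit_sphere y -> po_end (c y) = b y.

(** A collar: between the radii 1/2 and 1 the paths of [c] are run backwards, so the boundary value
    becomes [g] of their starting points. *)
Let b' y := if enorm y <= 2^-1 then b (2 *: y)
            else po_path (c (clip (2 *: y))) (2 - 2 * enorm y).

Let en0 := @enorm_ge0 R d.+1.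

Let cb' : {within @disc R d.+1, continuous b'}.
Proof.
apply: wc_if.
- exact: enorm_continuous.
- exact: cst_continuous.
- apply: (@wc_comp _ _ _ _ (@disc R d.+1)
    (fun y : 'rV[R]_d.+1 => 2 *: y) b) => //.
    by move=> y [_ /= y2]; apply/discP; rewrite enormZ//; lra.
  by wc_auto.
- apply: wc_po_path; last by wc_auto.
  apply: (@wc_comp _ _ _ _ (@unit_sphere R d.+1)
    (fun y : 'rV[R]_d.+1 => clip (2 *: y)) c) => //.
    by move=> y [_ /= y2]; apply: clip_sphere; rewrite enormZ//; lra.
  by apply: wc_clip; wc_auto.
- move=> y _ y2; have s2 : unit_sphere (2 *: y).
    by apply/unit_sphereP; rewrite enormZ// y2; lra.
  rewrite y2 clip_id; last exact: sub_sphere_disc.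
  by rewrite -cbE// /po_end; congr (po_path _ _); lra.
Qed.

Let b'_sphere y a : unit_sphere y -> 0 <= a <= 1 ->
  b' ((1 - a / 2) *: y) = po_path (c y) a.
Proof.
move=> sy /andP[a0 a1]; have /unit_sphereP y1 := sy.
have ey : enorm ((1 - a / 2) *: y) = 1 - a / 2 by rewrite enormZ ?y1; lra.
rewrite /b' ey scalerA; have [a2|a2] := leP (1 - a / 2) 2^-1.
  have -> : a = 1 by lra.
  by rewrite (_ : 2 * (1 - 1 / 2) = 1) ?scale1r ?cbE// -?cbE//; lra.
rewrite (_ : clip _ = y); first by congr (po_path _ _); lra.
rewrite clip_out ?enormZ ?y1 ?scalerA; [|lra..].
by rewrite [X in X *: _](_ : _ = 1) ?scale1r//; field; lra.
Qed.

Let b'_half y : disc y -> b' (2^-1 *: y) = b y.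
Proof.
move=> /discP y1; rewrite /b' enormZ; last by lra.
by rewrite ifT ?scalerA ?divff ?scale1r//; lra.
Qed.

(** Injectivity extends the starting points over the disc; surjectivity, one degree higher, corrects
    this extension until its image is homotopic to [b'] relative to the boundary. The lifted paths
    follow that homotopy and then undo the collar. *)
Lemma path_object_lift : pi_inj R d g -> pi_surj R d.+1 g ->
  exists c' : 'rV[R]_d.+1 -> path_object R g,
    [/\ {within @disc R d.+1, continuous c'},
    forall y, unit_sphere y -> c' y = c y & forall y, disc y -> po_end (c' y) = b y].
Proof.
move=> gi gs.
pose c0 y := po_start (c y).
have cc0 : {within @unit_sphere R d.+1, continuous c0}.
  by apply: wc_compC cc; exact: po_start_continuous.
have b'c0 y : unit_sphere y -> b' y = g (c0 y).
  by move=> sy; rewrite -po_path0 -b'_sphere ?lexx ?ler01// mul0r subr0 scale1r.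
have [c1 cc1 c1E] := ext_inj gi cc0 cb' b'c0.
have b'c1 y : unit_sphere y -> b' y = g (c1 y).
  by move=> sy; rewrite b'c0// c1E.
have [c' [cc' c'E [K [cK K0 K1 Ks]]]] := compression cg cc1 cb' b'c1 gs.
(* The time granted to [K]. It vanishes on the sphere, where the lifted path must be that of [c]
   exactly, without a pause at its start. *)
pose tau (y : 'rV[R]_d.+1) := (1 - enorm y) / 2.
pose A : set (R * 'rV[R]_d.+1) := `[0, 2] `*` @disc R d.+1.
have AP q : A q <-> 0 <= q.1 <= 2 /\ disc q.2 by rewrite /A /= in_itv.
(* [F] runs [K] and then the collar, each in unit time, and [w] is the change of time. Over the
   sphere [w] collapses the first unit of time, so continuity of the result comes from a quotient
   map. *)
pose w (q : R * 'rV[R]_d.+1) := (if q.1 <= 1 then q.1 * tau q.2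
          else tau q.2 + (q.1 - 1) * (1 - tau q.2), q.2).
pose F (q : R * 'rV[R]_d.+1) := if q.1 <= 1 then K q else b' ((1 - (q.1 - 1) / 2) *: q.2).
have tau01 y : disc y -> 0 <= tau y <= 2^-1.
  by move=> /discP y1; rewrite /tau; have := en0 y => ?; apply/andP; split; lra.
have cw : continuous w.
  apply: wc_setT; apply: wc_pair; last by wc_auto.
  apply: wc_if.
  - exact: fst_continuous.
  - exact: cst_continuous.
  - by rewrite /tau; wc_auto.
  - by rewrite /tau; wc_auto.
  - by move=> q _ ->; ring.
have cF : {within A, continuous F}.
  apply: wc_if.
  - exact: fst_continuous.
  - exact: cst_continuous.
  - by apply: wc_sub cK => q [/AP[/andP[q0 _] dq] /= q1]; apply/cylP; rewrite q0.
  - apply: (@wc_comp _ _ _ _ (@disc R d.+1)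
      (fun q : R * 'rV[R]_d.+1 => (1 - (q.1 - 1) / 2) *: q.2) b') => //.
      move=> q [/AP[/andP[q0 q2] /discP dq] /= q1]; apply/discP.
      rewrite enormZ ?mulr_ile1 ?en0//; lra.
    by wc_auto.
  - move=> q /AP[_ dq] q1; rewrite (surjective_pairing q) q1 K1//=.
    by rewrite subrr mul0r subr0 scale1r.
have wF q q' : A q -> A q' -> w q = w q' -> F q = F q'.
  move=> /AP; case: q => u y /= [/andP[u0 u2] dy] /AP; case: q' => u' y' /=.
  move=> [/andP[u0' u2'] _] [+ yy]; rewrite -{}yy /F /= {y'}.
  have /andP[t0 t1] := tau01 _ dy.
  have [tn0|tn0] := eqVneq (tau y) 0; last first.
    have tp : 0 < tau y by rewrite lt_neqAle eq_sym tn0.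
    have aux a a' : a <= 1 -> 1 < a' ->
        a * tau y = tau y + (a' - 1) * (1 - tau y) -> False.
      move=> a1 a1' aa; have : a * tau y <= tau y by rewrite ler_piMl.
      have : 0 < (a' - 1) * (1 - tau y) by apply: mulr_gt0; lra.
      lra.
    case: (leP u 1) => u1; case: (leP u' 1) => u1' h.
    - by congr (K (_, _)); apply: (mulIf tn0).
    - by have := aux _ _ u1 u1' h.
    - by have := aux _ _ u1' u1 (esym h).
    - suff -> : u = u' by [].
      have k0 : 1 - tau y != 0 by apply/negP => /eqP; lra.
      by move: h => /addrI/(mulIf k0); lra.
  have sy : unit_sphere y by apply/unit_sphereP; rewrite /tau in tn0; lra.
  rewrite tn0 !mulr0 !add0r !subr0 !mulr1.
  case: (leP u 1) => u1; case: (leP u' 1) => u1' h; try by exfalso; lra.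
    by rewrite !Ks ?u0 ?u0'.
  by have -> : u = u' by lra.
have [] := @quotient_factor (R * 'rV[R]_d.+1)%type (R * 'rV[R]_d.+1)%type Y A w F (0, 0).
- by apply: compact_setX; [exact: segment_compact|exact: compact_disc].
- exact: norm_hausdorff.
- exact: wc_continuous.
- exact: cF.
- exact: wF.
move=> G cG GE.
have {}cG : {within cyl (@disc R d.+1), continuous G}.
  apply: wc_sub cG => -[s y] /cylP[/= /andP[s0 s1] dy].
  have /andP[t0 t1] := tau01 _ dy.
  have [st|st] := leP s (tau y).
    have [tn0|tn0] := eqVneq (tau y) 0.
      exists (0, y); first by apply/AP; rewrite /= lexx ler0n.
      by rewrite /w /= ler01 mul0r; congr pair; lra.
    have tp : 0 < tau y by rewrite lt_neqAle eq_sym tn0.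
    exists (s / tau y, y).
      apply/AP; split => //=; rewrite divr_ge0//= ler_pdivrMr//; nra.
    by rewrite /w /= ler_pdivrMr// mul1r st; congr pair; field.
  have tp : 0 < 1 - tau y by lra.
  exists (1 + (s - tau y) / (1 - tau y), y).
    apply/AP; split => //=; have h0 : 0 <= (s - tau y) / (1 - tau y).
      by rewrite divr_ge0// ltW//; lra.
    have h1 : (s - tau y) / (1 - tau y) <= 1 by rewrite ler_pdivrMr//; lra.
    by apply/andP; split; lra.
  have h0 : 0 < (s - tau y) / (1 - tau y) by rewrite divr_gt0//; lra.
  rewrite /w /= ifF; last by apply: lt_geF; lra.
  by congr pair; field; lra.
have G0 y : disc y -> G (0, y) = g (c' y).
  move=> dy; have := GE (0, y); rewrite /w /F /= ler01 mul0r K0// => -> //.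
  by apply/AP; rewrite /= lexx ler0n.
have G1 y : disc y -> G (1, y) = b y.
  move=> dy; have := GE (2, y); rewrite /w /F /= ifF; last first.
    by apply: lt_geF; lra.
  rewrite ifF; last by apply: lt_geF; lra.
  rewrite (_ : tau y + (2 - 1) * (1 - tau y) = 1); last by lra.
  rewrite (_ : 1 - (2 - 1) / 2 = 2^-1); last by lra.
  by rewrite b'_half// => ->//; apply/AP; rewrite /= lexx ler0n.
have Gs s y : 0 <= s <= 1 -> unit_sphere y -> G (s, y) = po_path (c y) s.
  move=> /andP[s0 s1] sy; have dy := sub_sphere_disc sy.
  have /unit_sphereP y1 := sy; have ty : tau y = 0 by rewrite /tau y1; lra.
  have [->|sn0] := eqVneq s 0.
    by rewrite G0// c'E// c1E// po_path0.
  have sp : 0 < s by rewrite lt_neqAle eq_sym sn0.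
  have := GE (1 + s, y); rewrite /w /F /= ifF; last first.
    by apply: lt_geF; lra.
  rewrite ifF; last by apply: lt_geF; lra.
  rewrite ty (_ : 0 + (1 + s - 1) * (1 - 0) = s); last by lra.
  rewrite (_ : 1 - (1 + s - 1) / 2 = 1 - s / 2); last by lra.
  rewrite b'_sphere ?s0// => ->//; apply/AP; split=> //=.
  by apply/andP; split; lra.
(* [G] is controlled on the cylinder only; [clamp] and [clip] make it continuous everywhere without
   changing it there. *)
have [|||||e [ce eE]] := @po_build R Z Y g 'rV[R]_d.+1 (@disc R d.+1) c'
    (fun q => G (clamp q.2, clip q.1)).
- exact: cc'.
- apply: wc_setT; apply: (@wc_comp _ _ _ _ _
    (fun q : 'rV[R]_d.+1 * R => (clamp q.2, clip q.1)) G) cG _.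
    by move=> q _; apply/cylP; split; [exact: clamp_itv|exact: clip_disc].
  by apply: wc_pair; [apply: wc_clamp|apply: wc_clip]; wc_auto.
- by move=> y dy; rewrite /= clip_id// clamp_id ?lexx ?ler01// G0.
- by move=> y s dy; rewrite /= clampK.
- by exists 0; apply/discP; rewrite /enorm sqnorm0 sqrtr0.
exists e; split=> // [y sy|y dy].
  have dy := sub_sphere_disc sy; have [e1 e2] := eE y dy.
  apply: po_ext; first by rewrite e1 c'E// c1E.
  by move=> s s01; rewrite e2/= clip_id// clamp_id// Gs.
by rewrite /po_end (eE y dy).2/= clip_id// clamp_id ?lexx ?ler01// G1.
Qed.

End PathObjectLifting.

(** * Lifting maps on a finite-dimensional CW complex, cell by cell *)

Section CWLifting.
Context (R : realType) (X : topologicalType) (C : cw_structure R X).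

(** The dimension is strictly below [k], so the induction starts from the empty set. *)
Definition skeleton (k : nat) : set X := [set x | exists e t,
  [/\ (cw_dim (c := C) e < k)%N, open_disc t & @cw_map R X C e t = x]].

Let closed_cell e : set X := @cw_map R X C e @` @disc R _.

Lemma disc_cases d (t : 'rV[R]_d) : disc t -> open_disc t \/ unit_sphere t.
Proof.
rewrite /disc /open_disc /unit_sphere/= le_eqVlt => /orP[/eqP|]; first by right.
by left.
Qed.

Lemma skeleton_sphere e t : unit_sphere t -> skeleton (cw_dim e) (@cw_map R X C e t).
Proof.
move=> st; have [F _ [Fd Fs]] := cw_closure_finite (c := C) e.
have [|e' Fe' [t' t'1 t't]] := Fs (@cw_map R X C e t); first by exists t.
by exists e', t'; split=> //; exact: Fd.
Qed.

Lemma skeleton_disc e t k : (cw_dim e < k)%N -> disc t ->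
  skeleton k (@cw_map R X C e t).
Proof.
move=> ek /disc_cases[ot|/skeleton_sphere]; first by exists e, t.
by move=> [e' [t' [e'e ? ?]]]; exists e', t'; split=> //; exact: ltn_trans ek.
Qed.

Let compact_cell_pre Y (psi : X -> Y) (B : set Y) e :
  {within @disc R _, continuous (psi \o @cw_map R X C e)} -> closed B ->
  closed (@cw_map R X C e @` (@disc R _ `&` (psi \o @cw_map R X C e) @^-1` B)).
Proof.
move=> cpsi cB; apply: compact_closed; first exact: (cw_hausdorff C).
apply: continuous_compact.
  by apply: (wc_sub _ (@cw_continuous R X C e)) => t [].
by apply: compact_wc_closed cpsi _ cB; exact: compact_disc.
Qed.

Let closed_closed_cell e : closed (closed_cell e).
Proof.
apply: compact_closed; first exact: (cw_hausdorff C).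
by apply: continuous_compact; [exact: cw_continuous|exact: compact_disc].
Qed.

(** The weak topology tests all cells. A closed cell of dimension at least [k] meets [A] only along
    its boundary, inside finitely many cells of smaller dimension, which allows a strong induction
    on the dimension. *)
Lemma skeleton_closed (A : set X) k : A `<=` skeleton k ->
  (forall e, (cw_dim (c := C) e < k)%N -> closed (A `&` closed_cell e)) -> closed A.
Proof.
move=> Ak cA; apply: (cw_weak_topology (c := C)) => e; rewrite -/(closed_cell e).
have [n] := ubnP (cw_dim e); elim: n e => // n ih e en.
have [ek|ke] := ltnP (cw_dim e) k; first exact: cA.
have [F finF [Fd Fs]] := cw_closure_finite (c := C) e.
rewrite (_ : _ `&` _ = closed_cell e `&` \bigcup_(e' in F) (A `&` closed_cell e')).
  apply: closedI => //.
  apply: (@closed_bigcup X {classic (cw_cell C)} F) => // e' Fe'; apply: ih.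
  exact: leq_trans (Fd _ Fe') en.
apply/seteqP; split=> [x [Ax ex]|x [ex [e' _ []]]//]; split=> //.
have [t dt tx] := ex; have [e2 [t2 [e2k ot2 t2x]]] := Ak _ Ax.
case: (disc_cases dt) => [ot|st].
  have ee2 : e = e2 by apply: (cw_disjoint (c := C) ot ot2); rewrite tx t2x.
  by move: ke; rewrite ee2 leqNgt e2k.
have [|e' Fe' [t' ot' t'x]] := Fs x; first by exists t.
by exists e' => //; split=> //; exists t' => //; exact: ltW ot'.
Qed.

Lemma skeleton_continuous Y (psi : X -> Y) k :
  (forall e, (cw_dim (c := C) e < k)%N ->
    {within @disc R _, continuous (psi \o @cw_map R X C e)}) ->
  {within skeleton k, continuous psi}.
Proof.
move=> cpsi; apply: closed_wc => B cB.
exists (skeleton k `&` psi @^-1` B); last by rewrite setIA setIid.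
apply: (@skeleton_closed _ k) => [x []//|e ek].
rewrite (_ : _ `&` _ = @cw_map R X C e @`
    (@disc R _ `&` (psi \o @cw_map R X C e) @^-1` B)).
  by apply: compact_cell_pre => //; exact: cpsi.
apply/seteqP; split=> [x [[_ Bx] [t dt tx]]|x [t [dt Bt] <-]].
  by exists t => //; split=> //=; rewrite tx.
by split; [split=> //; exact: skeleton_disc|exists t].
Qed.

Section Lifting.
Context (E Y : topologicalType) (p : E -> Y) (phi : X -> Y) (e0 : E).
Hypothesis cphi : continuous phi.
Hypothesis p_rlp : forall e : cw_cell C, rlp R (cw_dim e) p.

Let cw_lift_skeleton k : exists psi : X -> E,
  (forall e, (cw_dim (c := C) e < k)%N ->
    {within @disc R _, continuous (psi \o @cw_map R X C e)}) /\
  forall x, skeleton k x -> p (psi x) = phi x.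
Proof.
elim: k => [|k [psi [cpsi ppsi]]].
  by exists (fun=> e0); split=> // x [e [t []]].
have csk := skeleton_continuous cpsi.
have ext (e : cw_cell C) : exists G : 'rV[R]_(cw_dim e) -> E, cw_dim e = k ->
    [/\ {within @disc R _, continuous G},
    forall y, unit_sphere y -> G y = psi (@cw_map R X C e y) &
    forall y, disc y -> p (G y) = phi (@cw_map R X C e y)].
  have [ek|ek] := pselect (cw_dim e = k); last by exists (fun=> e0).
  have [|||G GE] := @p_rlp e (psi \o @cw_map R X C e) (phi \o @cw_map R X C e).
  - apply: (wc_comp _ csk).
      by move=> t /skeleton_sphere; rewrite ek.
    by apply: (wc_sub _ (@cw_continuous R X C e)); exact: sub_sphere_disc.
  - exact/wc_compC/cw_continuous.
  - by move=> y sy; apply: ppsi; rewrite -ek; exact: skeleton_sphere.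
  by exists G.
pose G e := sval (cid (ext e)).
have GE e : cw_dim e = k -> [/\ {within @disc R _, continuous (G e)},
    forall y, unit_sphere y -> G e y = psi (@cw_map R X C e y) &
    forall y, disc y -> p (G e y) = phi (@cw_map R X C e y)].
  exact: (svalP (cid (ext e))).
(* A point has a unique open cell [ce] and a unique coordinate [co] in it, so the map can be
   redefined on the open [k]-cells without conflict. *)
pose ce x := sval (cid (cw_cover C x)).
have ceP x : exists t, open_disc t /\ @cw_map R X C (ce x) t = x.
  by have [t ot tx] := svalP (cid (cw_cover C x)); exists t.
pose co x := sval (cid (ceP x)).
have coP x : open_disc (co x) /\ @cw_map R X C (ce x) (co x) = x.
  exact: (svalP (cid (ceP x))).
pose psi' x := if cw_dim (ce x) == k then G (ce x) (co x) else psi x.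
have psi'E e t : open_disc t -> cw_dim e = k -> psi' (@cw_map R X C e t) = G e t.
  move=> ot ek; rewrite /psi'.
  have [] := coP (@cw_map R X C e t).
  move: (ce _) (co _) => e' t' ot' t't.
  have ee' : e' = e by exact: (cw_disjoint (c := C) ot' ot t't).
  move: t' ot' t't; rewrite ee' => t' ot' t't; rewrite ek eqxx.
  by rewrite (cw_injective (c := C) ot' ot t't).
have psi'_low x : skeleton k x -> psi' x = psi x.
  move=> [e [t [ek ot tx]]]; rewrite /psi'.
  have [ot' t'x] := coP x.
  have cxe : ce x = e by apply: (cw_disjoint (c := C) ot' ot); rewrite t'x tx.
  by rewrite ifF// cxe ltn_eqF.
have psi'_disc e t : disc t -> cw_dim e = k -> psi' (@cw_map R X C e t) = G e t.
  move=> /disc_cases[ot|st] ek; first exact: psi'E.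
  have [_ GS _] := GE e ek; rewrite GS// psi'_low//.
  by rewrite -ek; exact: skeleton_sphere.
exists psi'; split=> [e|x [e [t [ek ot <-]]]].
  rewrite ltnS leq_eqVlt => /orP[/eqP ek|ek].
    by have [cG _ _] := GE e ek; apply: wc_eq cG => t dt /=; rewrite psi'_disc.
  apply: wc_eq (cpsi e ek) => t dt /=.
  by rewrite psi'_low//; exact: skeleton_disc.
move: ek; rewrite ltnS leq_eqVlt => /orP[/eqP ek|ek].
  have [_ _ Gp] := GE e ek; rewrite psi'E// Gp//; exact: ltW ot.
by rewrite psi'_low ?ppsi//; exists e, t.
Qed.

Lemma cw_lift n : (forall e : cw_cell C, (cw_dim e <= n)%N) ->
  exists2 psi : X -> E, continuous psi & forall x, p (psi x) = phi x.
Proof.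
move=> dimC; have [psi [cpsi ppsi]] := cw_lift_skeleton n.+1.
have skT x : skeleton n.+1 x.
  by have [e [t ot tx]] := cw_cover C x; exists e, t; split=> //; rewrite ltnS.
exists psi; last by move=> x; exact: ppsi.
by apply: wc_setT; apply: wc_sub (skeleton_continuous cpsi) => x _.
Qed.

End Lifting.
End CWLifting.

(** * Maps whose path fibration lifts cells *)

Section LiftingProperties.
Context (R : realType).

Lemma pi_inj0 Z Y (g : Z -> Y) :
  (forall z z', joined R (g z) (g z') -> joined R z z') -> pi_inj R 0 g.
Proof.
move=> gi z h _ [H [cH H0 H1 _]].
have [p [cp p0 p1]] : joined R (h 0) z.
  apply: gi; exists (fun s => H (s, 0)); split.
  - apply: (@wc_comp _ _ _ _ _ (fun s : R => (s, 0 : 'rV[R]_0)) H) cH _.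
      by move=> s s01; split=> //; exact: cube0.
    by apply: wc_pair; [exact: wc_id|exact: wc_cst].
  - by rewrite H0//; exact: cube0.
  - by rewrite H1//; exact: cube0.
exists (fun q => p q.1); split=> [|t _|t _|s t _ [_ [[]]]//]; last 2 first.
- by rewrite /= p0 (rV0_eq0 t).
- by rewrite /= p1.
by apply: (wc_comp _ cp); [move=> q []|wc_auto].
Qed.

Lemma is_loop_cst d Z (z : Z) :
  is_loop z (cst z : 'rV[R]_d -> Z).
Proof. by split=> //; exact: wc_cst. Qed.

Lemma weak_equivalence_pi_inj d Z Y (f : continuousType Z Y) :
  weak_equivalence R f -> pi_inj R d f.
Proof.
move=> [fi _ fb]; case: d => [|d]; first exact: pi_inj0.
move=> z h hl fh; have [inj _] := fb d.+1 z isT.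
exact: inj hl (is_loop_cst d.+1 z) fh.
Qed.

Lemma weak_equivalence_pi_surj d Z Y (f : continuousType Z Y) :
  weak_equivalence R f -> pi_surj R d.+1 f.
Proof. by move=> [_ _ fb] z h hl; have [_] := fb d.+1 z isT; exact. Qed.

Lemma rlp_weak_equivalence d Z Y (f : continuousType Z Y) :
  weak_equivalence R f -> rlp R d (@po_end R Z Y f).
Proof.
move=> wf; case: d => [|d].
  by apply: rlp_path_object0; have [] := wf.
move=> c b cc cb cbE; apply: path_object_lift => //.
- exact: cts_fun.
- exact: weak_equivalence_pi_inj.
- exact: weak_equivalence_pi_surj.
Qed.

Lemma loop_homotopic_sym d Y (y : Y) (f h : 'rV[R]_d -> Y) :
  loop_homotopic y f h -> loop_homotopic y h f.
Proof.
move=> [H [cH H0 H1 Hb]]; exists (fun q => H (1 - q.1, q.2)).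
split=> [|t ct|t ct|s t s01 bt].
- exact: wc_reverse.
- by rewrite /= subr0 H1.
- by rewrite /= subrr H0.
- by rewrite /= Hb//; lra.
Qed.

(** The one-point space ['rV[R]_0] maps to [k0], so the path object consists of the paths issued
    from [k0]; a map lifted through its end point comes with a homotopy from a constant. *)
Lemma rlp_cst d m (K : topologicalType) (k0 : K) :
  path_connected R K -> (d < m)%N ->
  (forall j (x : K), (0 < j)%N -> (j < m)%N -> homotopy_group_trivial R j x) ->
  rlp R d (@po_end R 'rV[R]_0 K (fun=> k0)).
Proof.
move=> [_ pc] dm K0; case: d dm => [|d] dm.
  by apply: rlp_path_object0 => y; exists 0.
move=> c b cc cb cbE; apply: path_object_lift => //.
- exact: cst_continuous.
- move=> z h _ _; exists (fun=> z); split=> // [|t _]; first exact: wc_cst.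
  by rewrite (rV0_eq0 z) (rV0_eq0 (h t)).
- move=> z h hl; exists (cst z); first exact: is_loop_cst.
  by apply: loop_homotopic_sym; exact: K0 hl.
Qed.

Lemma rlp_cube d (E Y : topologicalType) (p : E -> Y)
    (c : 'rV[R]_d -> E) (b : 'rV[R]_d -> Y) : rlp R d p ->
  {within @cube_boundary R d, continuous c} -> {within @cube R d, continuous b} ->
  (forall t, cube_boundary t -> p (c t) = b t) ->
  exists c' : 'rV[R]_d -> E, [/\ {within @cube R d, continuous c'},
    forall t, cube_boundary t -> c' t = c t & forall t, cube t -> p (c' t) = b t].
Proof.
move=> prlp cc cb cbE.
have [|||c' [cc' c'E pc']] := prlp (c \o @disc_cube R d) (b \o @disc_cube R d).
- apply: (wc_comp _ cc); first by move=> y sy; exact/disc_cube_boundary.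
  exact/wc_continuous/disc_cube_continuous.
- apply: (wc_comp _ cb); first exact: disc_cube_cube.
  exact/wc_continuous/disc_cube_continuous.
- by move=> y sy; apply: cbE; exact/disc_cube_boundary.
exists (c' \o @cube_disc R d); split.
- apply: (wc_comp _ cc'); first exact: cube_disc_disc.
  exact/wc_continuous/cube_disc_continuous.
- by move=> t bt; rewrite /= c'E /= ?cube_discK//; exact/cube_disc_sphere.
- by move=> t ct; rewrite /= pc' /= ?cube_discK//; exact: cube_disc_disc.
Qed.

End LiftingProperties.

(** * Free loops *)

Lemma wc_product T (A : set T) (I : Type)
    (K : I -> topologicalType) (f : T -> prod_topology K) :
  (forall i, {within A, continuous (fun t => f t i)}) -> {within A, continuous f}.
Proof.
move=> cf; apply/subspace_continuousP => x Ax.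
apply/cvg_sup => i B [B' [[W oW WB'] hx B'B]].
rewrite -WB' /= in hx.
have /wcP/(_ x W Ax (open_nbhs_nbhs (conj oW hx))) := cf i.
by apply: filterS => y Wy Ay; apply: B'B; rewrite -WB'; exact: Wy.
Qed.

Lemma proj_component_continuous (I : Type) (K : I -> topologicalType) i :
  continuous (fun f : prod_topology K => f i).
Proof.
move=> f; have /cvg_sup/(_ i) H : nbhs f --> (f : prod_topology K) by [].
move=> B nB; apply: H.
exact: (@initial_continuous (prod_topology K) (K i) (fun f => f i) f B nB).
Qed.

Section FreeLoops.
Context (R : realType) (m : nat).
Local Notation cubem := (@cube R m.+1).

(** The boundary value is constant but not prescribed, so these are maps of a sphere. The dimension
    is positive, hence the boundary is not empty. *)
Definition floop Y (a : 'rV[R]_m.+1 -> Y) :=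
  {within cubem, continuous a} /\
  forall t t', cube_boundary t -> cube_boundary t' -> a t = a t'.

Definition fhom Y (a b : 'rV[R]_m.+1 -> Y) :=
  exists H : R * 'rV[R]_m.+1 -> Y, [/\ {within cyl cubem, continuous H},
    forall t, cube t -> H (0, t) = a t, forall t, cube t -> H (1, t) = b t &
    forall s t t', 0 <= s <= 1 -> cube_boundary t -> cube_boundary t' ->
      H (s, t) = H (s, t')].

Lemma sub_boundary_cube d (t : 'rV[R]_d) : cube_boundary t -> cube t.
Proof. by case. Qed.

Lemma floop_comp (Y Y' : topologicalType) (f : Y -> Y') a :
  continuous f -> floop a -> floop (f \o a).
Proof.
move=> cf [ca ab]; split; first exact: wc_compC.
by move=> t t' bt bt'; rewrite /= (ab t t').
Qed.

Lemma is_loop_floop Y (y : Y) (a : 'rV[R]_m.+1 -> Y) :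
  is_loop y a -> floop a.
Proof. by move=> [ca ab]; split=> // t t' bt bt'; rewrite !ab. Qed.

Lemma loop_homotopic_fhom Y (y : Y) (a b : 'rV[R]_m.+1 -> Y) :
  loop_homotopic y a b -> fhom a b.
Proof.
move=> [H [cH H0 H1 Hb]]; exists H; split=> // s t t' s01 bt bt'.
by rewrite !Hb.
Qed.

Lemma fhom_refl Y (a : 'rV[R]_m.+1 -> Y) : floop a -> fhom a a.
Proof.
move=> [ca ab]; exists (fun q => a q.2); split=> // [|s t t' _ bt bt'].
  by apply: (wc_comp _ ca); [move=> q /cylP[]|wc_auto].
exact: ab.
Qed.

Lemma fhom_sym Y (a b : 'rV[R]_m.+1 -> Y) : fhom a b -> fhom b a.
Proof.
move=> [H [cH H0 H1 Hb]]; exists (fun q => H (1 - q.1, q.2)).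
split=> [|t ct|t ct|s t t' s01 bt bt'].
- exact: wc_reverse.
- by rewrite /= subr0 H1.
- by rewrite /= subrr H0.
- by rewrite /= (Hb _ t t')//; lra.
Qed.

Lemma fhom_trans Y (a b c : 'rV[R]_m.+1 -> Y) :
  fhom a b -> fhom b c -> fhom a c.
Proof.
move=> [K [cK K0 K1 Kb]] [L [cL L0 L1 Lb]].
exists (fun q => if q.1 <= 2^-1 then K (2 * q.1, q.2) else L (2 * q.1 - 1, q.2)).
split=> [|t ct|t ct|s t t' s01 bt bt'].
- by apply: wc_concat => // y dy; rewrite K1// L0.
- by rewrite /= invr_ge0 ler0n mulr0 K0.
- rewrite /= ifF; last by apply: lt_geF; lra.
  by rewrite (_ : 2 * 1 - 1 = 1) ?L1//; lra.
- rewrite /=; case: ifPn => s2; first by apply: Kb => //; lra.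
  by apply: Lb => //; rewrite -ltNge in s2; lra.
Qed.

Lemma fhom_comp (Y Y' : topologicalType) (f : Y -> Y') (a b : 'rV[R]_m.+1 -> Y) :
  continuous f -> fhom a b -> fhom (f \o a) (f \o b).
Proof.
move=> cf [H [cH H0 H1 Hb]]; exists (f \o H); split=> [|t ct|t ct|s t t' s01 bt bt'].
- exact: wc_compC.
- by rewrite /= H0.
- by rewrite /= H1.
- by rewrite /= (Hb s t t').
Qed.

Lemma fhom_product (I : Type) (K : I -> topologicalType)
    (a b : 'rV[R]_m.+1 -> prod_topology K) :
  (forall i, fhom (fun t => a t i) (fun t => b t i)) -> fhom a b.
Proof.
move=> ab; pose H i := sval (cid (ab i)).
have HP i := svalP (cid (ab i)); exists (fun q i => H i q).
split=> [|t ct|t ct|s t t' s01 bt bt'].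
- by apply: wc_product => i; have [] := HP i.
- by apply/functional_extensionality_dep => i; have [_ H0 _ _] := HP i; exact: H0.
- by apply/functional_extensionality_dep => i; have [_ _ H1 _] := HP i; exact: H1.
- apply/functional_extensionality_dep => i; have [_ _ _ Hb] := HP i.
  exact: Hb.
Qed.

(** A free null-homotopy is a map on the cone over the sphere, that is on a disc; the chords of the
    disc ending at [spole] turn it into a based one. *)
Lemma fhom_null Y (y y' : Y) (a : 'rV[R]_m.+1 -> Y) :
  is_loop y a -> fhom a (cst y') -> loop_homotopic y a (cst y).
Proof.
move=> [ca ay] [H [cH H0 H1 Hb]]; have [c cc cE] := cone_factor cH H1 Hb.
have ck t : cubem t -> c (kap t) = a t by move=> ct; rewrite cE// H0.
have b0 := @cube_boundary0 R m.
have cs : c (spole R m.+1) = y.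
  by rewrite -(kap_boundary b0) ck ?ay//; exact: cube0.
have := null_of_ext cc; rewrite cs => -[G [cG G0 G1 Gb]].
by exists G; split=> // t ct; rewrite G0//= ck.
Qed.

Lemma cube_consrP d s (t : 'rV[R]_d) : cube (consr s t) <-> 0 <= s <= 1 /\ cube t.
Proof. exact: (@forall_consr R d (fun x => 0 <= x <= 1)). Qed.

Lemma cube_boundary_consrP d s (t : 'rV[R]_d) : cube_boundary (consr s t) <->
  [/\ 0 <= s <= 1, cube t & [\/ s = 0, s = 1 | cube_boundary t]].
Proof.
rewrite /cube_boundary /= cube_consrP.
rewrite (@exists_consr R d (fun x => x = 0 \/ x = 1)).
split=> [[[s01 ct] [[]|]]|[s01 ct []]].
- by move=> s0; split=> //; exact: Or31.
- by move=> s1; split=> //; exact: Or32.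
- by move=> tb; split=> //; exact: Or33.
- by move=> s0; split=> //; left; left.
- by move=> s1; split=> //; left; right.
- by move=> [_ tb]; split=> //; right.
Qed.

Section WeakEquivalence.
Context (Z Y : topologicalType) (f : Z -> Y).
Hypotheses (cf : continuous f) (f_rlp : forall d, rlp R d (@po_end R Z Y f)).

Lemma const_path : (exists z : Z, True) ->
  exists e : Z -> path_object R f, [/\ continuous e,
    forall z, po_start (e z) = z & forall z s, po_path (e z) s = f z].
Proof.
move=> [z _].
have [|||||e [ce eE]] := @po_build R Z Y f Z setT id (fun q => f q.1).
- exact: wc_id.
- by apply: wc_setT; apply: (@wc_compC _ _ _ _ fst f) => //; wc_auto.
- by [].
- by [].
- by exists z.
exists e; split; first exact: wc_setT.
- by move=> z'; rewrite (eE z' I).1.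
- by move=> z' s; rewrite (eE z' I).2.
Qed.

(** [H] is lifted to the path object, with constant paths over both ends; the starting points of the
    lifted paths form the homotopy in [Z]. *)
Lemma fhom_inj (a a' : 'rV[R]_m.+1 -> Z) : floop a -> floop a' ->
  fhom (f \o a) (f \o a') -> fhom a a'.
Proof.
move=> [ca ab] [ca' ab'] [H [cH H0 H1 Hb]].
have [k [ck ks kp]] := const_path (ex_intro _ (a 0) Logic.I).
have c00 : cubem 0 by exact: cube0.
have b00 := @cube_boundary0 R m.
pose c1 (v : 'rV[R]_1) := if v 0 0 <= 2^-1 then k (a 0) else k (a' 0).
have coord0 : continuous (fun v : 'rV[R]_1 => v 0 0) by exact: coord_continuous.
have bd1 (v : 'rV[R]_1) : cube_boundary v -> v 0 0 = 0 \/ v 0 0 = 1.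
  by move=> [_ [i]]; rewrite (ord1 i).
have half0 : (0 <= 2^-1 :> R) by rewrite invr_ge0.
have half1 : (1 <= 2^-1 :> R) = false by apply: lt_geF; lra.
(* The track of the boundary value is lifted once, over an interval, and reused at every boundary
   point, so that the final homotopy stays constant on the boundary of the cube. *)
have [|||q [cq qc qb]] := @rlp_cube R 1 _ _ _ c1 (fun v => H (v 0 0, 0)) (@f_rlp 1).
- apply: wc_if => //.
  + exact: cst_continuous.
  + exact: wc_cst.
  + exact: wc_cst.
  + by move=> v /bd1[] -> h; exfalso; lra.
- apply: (@wc_comp _ _ _ _ _ (fun v : 'rV[R]_1 => (v 0 0, 0 : 'rV[R]_m.+1)) H) cH _.
    by move=> v cv; apply/cylP; split=> //; exact: cv.
  by apply: wc_pair; [exact: wc_continuous|exact: wc_cst].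
- move=> v /bd1[] v0; rewrite /c1 v0 ?half0 ?half1 /po_end kp.
    by rewrite H0.
  by rewrite H1.
pose d0 (s : R) : 'rV[R]_1 := const_mx s.
have q0 : q (d0 0) = k (a 0).
  rewrite qc; first by rewrite /c1 mxE half0.
  by split; [move=> i; rewrite mxE lexx ler01|exists 0; left; rewrite mxE].
have q1 : q (d0 1) = k (a' 0).
  rewrite qc; first by rewrite /c1 mxE half1.
  by split; [move=> i; rewrite mxE lexx ler01|exists 0; right; rewrite mxE].
pose c2 (v : 'rV[R]_m.+2) := if v 0 ord0 <= 0 then k (a (tailr v))
  else if 1 <= v 0 ord0 then k (a' (tailr v)) else q (d0 (v 0 ord0)).
have c2b s t : 0 <= s <= 1 -> cube_boundary t -> c2 (consr s t) = q (d0 s).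
  move=> /andP[s0 s1] bt; rewrite /c2 consr_head tailr_consr.
  case: ifPn => h0.
    by rewrite (_ : s = 0) ?q0 ?(ab _ _ bt b00)//; lra.
  by case: ifPn => h1 //; rewrite (_ : s = 1) ?q1 ?(ab' _ _ bt b00)//; lra.
have c20 t : c2 (consr 0 t) = k (a t).
  by rewrite /c2 consr_head tailr_consr lexx.
have c21 t : c2 (consr 1 t) = k (a' t).
  rewrite /c2 consr_head tailr_consr lexx ifF//.
  by rewrite lt_geF.
have [|||e [ce ec eb]] := @rlp_cube R m.+2 _ _ _ c2
    (fun v => H (v 0 ord0, tailr v)) (@f_rlp m.+2).
- pose G0 : set 'rV[R]_m.+2 := [set v | v 0 ord0 <= 0].
  pose G1 : set 'rV[R]_m.+2 := [set v | 1 <= v 0 ord0].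
  pose G2 : set 'rV[R]_m.+2 := [set v | 1 <= `|2 *: tailr v - const_mx 1|].
  have h0 : continuous (fun v : 'rV[R]_m.+2 => v 0 ord0) by exact: coord_continuous.
  have cst0 (x : R) : continuous (fun _ : 'rV[R]_m.+2 => x) by exact: cst_continuous.
  have clG0 : closed G0 by exact: closed_le_cont.
  have clG1 : closed G1 by exact: closed_le_cont.
  have clG2 : closed G2 by apply: closed_le_cont => //; apply: wc_setT; wc_auto.
  have bP v : cube_boundary v -> [/\ 0 <= v 0 ord0 <= 1, cubem (tailr v) &
      [\/ v 0 ord0 = 0, v 0 ord0 = 1 | cube_boundary (tailr v)]].
    by rewrite -{1}(consr_eta v) => /cube_boundary_consrP.
  have bG2 v : cube_boundary v -> G2 v -> cube_boundary (tailr v).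
    move=> /bP[_ /cubeP ct _] Gv; apply/cube_boundaryP.
    by apply/eqP; rewrite eq_le ct.
  have wcka (A : set 'rV[R]_m.+2) (al : 'rV[R]_m.+1 -> Z) : A `<=` @cube_boundary R _ ->
      {within cubem, continuous al} -> {within A, continuous (fun v => k (al (tailr v)))}.
    move=> AB cal; apply: (@wc_compC _ _ _ _ (fun v => al (tailr v)) k) => //.
    apply: (@wc_comp _ _ _ _ _ (fun v : 'rV[R]_m.+2 => tailr v) al) cal _.
      by move=> v /AB/bP[].
    by wc_auto.
  apply: (@wc_glue _ _ _ G0 (G1 `|` G2)) => //.
  + exact: closedU.
  + move=> v /bP[_ _ [v0|v1|/cube_boundaryP v2]]; [left|right; left|right; right];
      by rewrite /G0 /G1 /G2 /= ?v0 ?v1 ?v2.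
  + apply: (@wc_eq _ _ _ (fun v => k (a (tailr v)))).
      by move=> v [_ v0]; rewrite /c2 ifT.
    by apply: wcka => // v [].
  apply: (@wc_glue _ _ _ G1 G2) => //.
  + by move=> v [_].
  + apply: (@wc_eq _ _ _ (fun v => k (a' (tailr v)))).
      move=> v [_ v1]; rewrite /c2 ifF ?ifT//.
      by apply/negbTE; rewrite -ltNge; apply: lt_le_trans v1; exact: ltr01.
    by apply: wcka => // v [[]].
  + apply: (@wc_eq _ _ _ (fun v : 'rV[R]_m.+2 => q (d0 (v 0 ord0)))).
      move=> v [[bv _] Gv]; rewrite -[in RHS](consr_eta v) c2b//.
        by have [] := bP v bv.
      exact: bG2.
    apply: (@wc_comp _ _ _ _ _ (fun v : 'rV[R]_m.+2 => d0 (v 0 ord0)) q) cq _.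
      by move=> v [[/bP[v01 _ _] _] _] i; rewrite mxE.
    apply: wc_row => i; apply: (@wc_eq _ _ _ (fun v : 'rV[R]_m.+2 => v 0 ord0)).
      by move=> v _; rewrite mxE.
    exact: wc_continuous.
- apply: (@wc_comp _ _ _ _ _ (fun v : 'rV[R]_m.+2 => (v 0 ord0, tailr v)) H) cH _.
    by move=> v; rewrite -{1}(consr_eta v) => /cube_consrP[? ?]; exact/cylP.
  by wc_auto.
- move=> v; rewrite -(consr_eta v) => /cube_boundary_consrP[].
  move: (v 0 ord0) (tailr v) => s t s01 ct; rewrite consr_head tailr_consr.
  case=> [->|->|bt].
  + by rewrite c20 /po_end kp H0.
  + by rewrite c21 /po_end kp H1.
  + rewrite c2b// qb; last by move=> i; rewrite mxE.
    by rewrite mxE; apply: Hb.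
exists (fun q => po_start (e (consr q.1 q.2))); split=> [|t ct|t ct|s t t' s01 bt bt'].
- apply: (@wc_compC _ _ _ _ (fun q : R * 'rV[R]_m.+1 => e (consr q.1 q.2))
    (@po_start R Z Y f)); first exact: po_start_continuous.
  apply: (@wc_comp _ _ _ _ _ (fun q : R * 'rV[R]_m.+1 => consr q.1 q.2) e) ce _.
    by move=> p /cylP[? ?]; exact/cube_consrP.
  by wc_auto.
- rewrite /= ec ?c20 ?ks//; apply/cube_boundary_consrP.
  by rewrite lexx ler01; split=> //; exact: Or31.
- rewrite /= ec ?c21 ?ks//; apply/cube_boundary_consrP.
  by rewrite lexx ler01; split=> //; exact: Or32.
- have bst u : cube_boundary u -> cube_boundary (consr s u).
    move=> bu; apply/cube_boundary_consrP.
    by split=> //; [exact: sub_boundary_cube|exact: Or33].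
  by rewrite /= !ec ?c2b//; exact: bst.
Qed.

(** Over the boundary the lift of [b] is one fixed path [e 0]. Hence the starting points form a free
    loop, and the lifted paths are the homotopy from its image to [b]. *)
Lemma fhom_surj (b : 'rV[R]_m.+1 -> Y) : (exists z, joined R (f z) (b 0)) ->
  floop b -> exists2 a, floop a & fhom (f \o a) b.
Proof.
move=> [z /path_clamp[p [cp p0 p1 pc]]] [cb bb].
have [|||||e [_ eE]] := @po_build R Z Y f 'rV[R]_0 setT (fun=> z) (fun q => p q.2).
- exact: wc_cst.
- by apply: wc_setT; apply: (@wc_compC _ _ _ _ snd p) => //; wc_auto.
- by [].
- by move=> t s _ /=.
- by exists 0.
have [e1 e2] := eE 0 I.
have [|||c [cc cE cb']] := @rlp_cube R m.+1 _ _ _ (fun=> e 0) b (@f_rlp m.+1).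
- exact: wc_cst.
- exact: cb.
- move=> t bt; rewrite /po_end e2 /= p1; apply: bb => //; exact: cube_boundary0.
exists (fun t => po_start (c t)).
  split; last by move=> t t' bt bt'; rewrite !cE.
  apply: (@wc_compC _ _ _ _ c (@po_start R Z Y f)) => //; exact: po_start_continuous.
exists (fun q => po_path (c q.2) q.1); split=> [|t ct|t ct|s t t' s01 bt bt'].
- apply: wc_po_path; last by wc_auto.
  by apply: (wc_comp _ cc); [move=> q /cylP[]|wc_auto].
- by rewrite po_path0.
- by rewrite -cb'.
- by rewrite /= !cE.
Qed.

End WeakEquivalence.
End FreeLoops.

(** * Morphisms of the localized category *)

Section Words.
Context (R : realType) (m : nat).

(** A relation, since a formal inverse acts on free homotopy classes only. On classes it is the
    value at the word of the functor of free loops, extended to the localization. *)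
Fixpoint grel (X Y : topologicalType) (w : word R X Y) :
    ('rV[R]_m.+1 -> X) -> ('rV[R]_m.+1 -> Y) -> Prop :=
  match w in word _ X Y return ('rV[R]_m.+1 -> X) -> ('rV[R]_m.+1 -> Y) -> Prop with
  | word_map _ _ f => fun a b => fhom (f \o a) b
  | word_inv _ _ f _ => fun a b => fhom (f \o b) a
  | word_comp _ Y _ u v => fun a c =>
      exists b : 'rV[R]_m.+1 -> Y, [/\ floop b, grel u a b & grel v b c]
  end.

Lemma grel_fhom X Y (w : word R X Y) a a' b b' :
  floop a -> floop a' -> floop b -> floop b' ->
  fhom a a' -> fhom b b' -> grel w a b -> grel w a' b'.
Proof.
elim: w a a' b b' => [{}X {}Y f|{}X {}Y f hf|{}X {}Y Z u ihu v ihv] a a' b b' fa fa' fb fb' aa bb /=.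
- move=> ab; apply: fhom_trans bb; apply: fhom_trans ab.
  by apply: fhom_sym; apply: fhom_comp => //; exact: cts_fun.
- move=> ab; apply: fhom_trans aa; apply: fhom_trans ab.
  by apply: fhom_sym; apply: fhom_comp => //; exact: cts_fun.
- move=> [c [fc uc vc]]; exists c; split=> //.
    by apply: (ihu _ _ _ _ fa fa' fc fc aa _ uc); exact: fhom_refl.
  by apply: (ihv _ _ _ _ fc fc fb fb' _ bb vc); exact: fhom_refl.
Qed.

Let we_inj X Y (f : continuousType X Y) (a a' : 'rV[R]_m.+1 -> X) :
  weak_equivalence R f -> floop a -> floop a' -> fhom (f \o a) (f \o a') ->
  fhom a a'.
Proof.
by move=> hf; apply: fhom_inj => [|d]; [exact: cts_fun|exact: rlp_weak_equivalence].
Qed.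

Let we_surj X Y (f : continuousType X Y) (b : 'rV[R]_m.+1 -> Y) :
  weak_equivalence R f -> floop b -> exists2 a, floop a & fhom (f \o a) b.
Proof.
move=> hf fb; apply: fhom_surj => [d||//]; first exact: rlp_weak_equivalence.
by have [_] := hf.
Qed.

Lemma grel_fun X Y (w : word R X Y) a b b' :
  floop a -> floop b -> floop b' -> grel w a b -> grel w a b' -> fhom b b'.
Proof.
elim: w a b b' => [{}X {}Y f|{}X {}Y f hf|{}X {}Y Z u ihu v ihv] a b b' fa fb fb' /=.
- by move=> /fhom_sym ab; exact: fhom_trans.
- move=> ab /fhom_sym ab'; apply: (we_inj hf) => //.
  exact: fhom_trans ab ab'.
- move=> [c [fc uc vc]] [c' [fc' uc' vc']].
  apply: (ihv c' b b') => //.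
  apply: (grel_fhom fc fc' fb fb _ (fhom_refl fb) vc).
  exact: (ihu a).
Qed.

(** The two cancellation rules express that a weak equivalence is injective, respectively
    surjective, on free homotopy classes. *)
Lemma grel_eq X Y (u v : word R X Y) : word_eq u v ->
  forall a b, floop a -> floop b -> grel u a b <-> grel v a b.
Proof.
elim=> {X Y u v} [X Y u|X Y u v _ ih|X Y u v w _ ih1 _ ih2|
    X Y Z u u' v v' _ ihu _ ihv|X Y Z T u v w|X Y u|X Y u|X Y Z f g|X Y f hf|X Y f hf] a b fa fb.
- by [].
- by apply: iff_sym; exact: ih.
- by apply: iff_trans (ih1 _ _ fa fb) (ih2 _ _ fa fb).
- split=> -[c [fc uc vc]]; exists c; split=> //.
  + exact/(ihu _ _ fa fc).
  + exact/(ihv _ _ fc fb).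
  + exact/(ihu _ _ fa fc).
  + exact/(ihv _ _ fc fb).
- split=> [[c [fc uc [d [fd vd wd]]]]|[d [fd [c [fc uc vd]] wd]]].
    by exists d; split=> //; exists c.
  by exists c; split=> //; exists d.
- split=> [[c [fc /= ac uc]]|uab].
    by apply: (grel_fhom fc fa fb fb (fhom_sym ac) (fhom_refl fb) uc).
  by exists a; split=> //=; exact: fhom_refl.
- split=> [[c [fc uc /= cb]]|uab].
    by apply: (grel_fhom fa fa fc fb (fhom_refl fa) cb uc).
  by exists b; split=> //=; exact: fhom_refl.
- split=> [[c [fc /= fac gcb]]|/= gf].
    apply: fhom_trans gcb.
    by apply: (fhom_comp (f := g) _ fac); exact: cts_fun.
  have ffa : floop (f \o a) by apply: floop_comp fa; exact: cts_fun.
  by exists (f \o a); split=> //=; exact: fhom_refl.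
- split=> [[c [fc /= ac bc]]|/= ab].
    by apply: (we_inj hf) => //; apply: fhom_trans ac (fhom_sym bc).
  have ffb : floop (f \o b) by apply: floop_comp fb; exact: cts_fun.
  exists (f \o b); split=> //=; last exact: fhom_refl.
  by apply: fhom_comp => //; exact: cts_fun.
- split=> [[c [fc /= ac bc]]|/= ab].
    exact: fhom_trans (fhom_sym ac) bc.
  have [c fc ca] := we_surj hf fa.
  by exists c; split=> //=; exact: fhom_trans ca ab.
Qed.

Lemma word_lift (W Y Z : topologicalType) (C : cw_structure R W) n (w0 : W)
    (w : word R Y Z) (phi : W -> Y) :
  (forall e : cw_cell C, (cw_dim e <= n)%N) -> continuous phi ->
  exists2 psi : W -> Z, continuous psi &
    forall a, floop a -> grel w (phi \o a) (psi \o a).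
Proof.
move=> dimC; elim: w phi => [{}Y {}Z f|{}Z {}Y f hf|{}Y V {}Z u ihu v ihv] phi cphi /=.
- have cfphi : continuous (f \o phi).
    by move=> x; apply: continuous_comp; [exact: cphi|exact: cts_fun].
  by exists (f \o phi) => // a fa; apply: fhom_refl; exact: (floop_comp cfphi).
(* A formal inverse is realized by lifting to the path object and taking starting points. The point
   [w0] shows that this path object is inhabited, as [cw_lift] requires. *)
- have [_ fsurj _] := hf; have [z /path_clamp[p [cp p0 p1 pc]]] := fsurj (phi w0).
  have [|||||e [_ _]] := @po_build R Z Y f 'rV[R]_0 setT (fun=> z) (fun q => p q.2).
  + exact: wc_cst.
  + by apply: wc_setT; apply: (@wc_compC _ _ _ _ snd p) => //; wc_auto.
  + by [].
  + by move=> t s _ /=.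
  + by exists 0.
  have p_rlp (c : cw_cell C) : rlp R (cw_dim c) (@po_end R Z Y f).
    exact: rlp_weak_equivalence.
  have [psi cpsi psiE] := cw_lift (e 0) cphi p_rlp dimC.
  exists (po_start (g := f) \o psi) => [x|a [ca ab]].
    by apply: continuous_comp; [exact: cpsi|exact: po_start_continuous].
  exists (fun q => po_path (psi (a q.2)) q.1); split=> [|t ct|t ct|s t t' s01 bt bt'].
  + apply: wc_po_path; last by wc_auto.
    apply: (@wc_compC _ _ _ _ (fun q : R * 'rV[R]_m.+1 => a q.2) psi) => //.
    by apply: (wc_comp _ ca); [move=> q /cylP[]|wc_auto].
  + by rewrite po_path0.
  + by rewrite /= -psiE.
  + by rewrite /= (ab t t').
- have [psi cpsi psiE] := ihu _ cphi.
  have [chi cchi chiE] := ihv _ cpsi.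
  exists chi => // a fa; exists (psi \o a); split; last exact: chiE.
    exact: floop_comp.
  exact: psiE.
Qed.

(** [f] follows [u] on free loops and [v] leads every class back, so [f] separates the classes. *)
Lemma fhom_of_iso (W P : topologicalType) (C : cw_structure R W) n (w0 : W) :
  (forall e : cw_cell C, (cw_dim e <= n)%N) -> same_homotopy_type R W P ->
  exists2 f : W -> P, continuous f &
    forall a b : 'rV[R]_m.+1 -> W, floop a -> floop b ->
      fhom (f \o a) (f \o b) -> fhom a b.
Proof.
move=> dimC [u [v [uv _]]].
have [f cf fE] : exists2 f : W -> P, continuous f &
    forall a : 'rV[R]_m.+1 -> W, floop a -> grel u a (f \o a).
  by have [|f cf fE] := word_lift w0 u (phi := id) dimC; [move=> x|exists f].
exists f => // a b fa fb fab.
have ffa : floop (f \o a) by exact: floop_comp.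
have ffb : floop (f \o b) by exact: floop_comp.
have [c [fc uac vca]] : grel (word_comp u v) a a.
  by apply/(grel_eq uv fa fa); exact: fhom_refl.
have fac : fhom (f \o a) c := grel_fun fa ffa fc (fE a fa) uac.
have vfb : grel v (f \o b) a.
  apply: (grel_fhom fc ffb fa fa _ (fhom_refl fa) vca).
  exact: fhom_trans (fhom_sym fac) fab.
apply: fhom_sym; apply/(grel_eq uv fb fa).
by exists (f \o b); split=> //; exact: fE.
Qed.

End Words.

Theorem cw_not_product (R : realType) X (C : cw_structure R X)
    (n m : nat) (x : X) : (forall e : cw_cell C, (cw_dim e <= n)%N) -> (n < m)%N ->
  is_product_of_eilenberg_maclane R X -> homotopy_group_trivial R m x.
Proof.
case: m => // m dimC nm [I [A [k [K [KP XK]]]]] a xa.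
have [f cf f_inj] := fhom_of_iso m x dimC XK.
have fa := is_loop_floop xa; have fx := is_loop_floop (is_loop_cst R m.+1 x).
apply: (fhom_null xa (y' := x)); apply: f_inj => //.
apply: fhom_product => i; have [_ pcK _ K0] := KP i.
have cfi : continuous (fun y => f y i).
  move=> y; apply: (@continuous_comp _ _ _ f (fun h : prod_topology K => h i)).
    exact: cf.
  exact: proj_component_continuous.
have fla (b : 'rV[R]_m.+1 -> X) : floop b -> floop (fun t => f (b t) i).
  exact: (floop_comp cfi).
have [km|km] := eqVneq m.+1 (k i); last first.
  apply: (@loop_homotopic_fhom _ _ _ (f x i)).
  apply: (K0 m.+1 (f x i)) => //; have [ca ab] := xa.
  by split=> [|t bt]; [exact: (wc_compC cfi)|rewrite /= ab].
have p_rlp (e : cw_cell C) : rlp R (cw_dim e) (@po_end R 'rV[R]_0 (K i) (fun=> f x i)).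
  apply: (@rlp_cst R _ m.+1 (K i) (f x i) pcK).
    exact: leq_ltn_trans (dimC e) nm.
  by move=> j y j0 jm; apply: K0 => //; rewrite -km ltn_eqF.
have [e0 _] : exists e0 : path_object R (fun _ : 'rV[R]_0 => f x i), True.
  have [|||||e [_ _]] := @po_build R 'rV[R]_0 (K i) (fun=> f x i) 'rV[R]_0 setT
    (fun=> 0) (fun=> f x i); last by exists (e 0).
  - exact: wc_cst.
  - by move=> y; exact: cst_continuous.
  - by [].
  - by [].
  - by exists 0.
have [psi cpsi psiE] := cw_lift e0 cfi p_rlp dimC.
have null (b : 'rV[R]_m.+1 -> X) : floop b -> fhom (cst (f x i)) (fun t => f (b t) i).
  move=> [cb bb]; exists (fun q => po_path (psi (b q.2)) q.1).
  split=> [|t ct|t ct|s t t' s01 bt bt'].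
  - apply: wc_po_path; last by wc_auto.
    apply: (@wc_compC _ _ _ _ (fun q : R * 'rV[R]_m.+1 => b q.2) psi) => //.
    by apply: (wc_comp _ cb); [move=> q /cylP[]|wc_auto].
  - by rewrite po_path0.
  - exact: psiE.
  - by rewrite /= (bb t t').
exact: fhom_trans (fhom_sym (null _ fa)) (null _ fx).
Qed.

(** * The CW structure of the sphere *)

Section SphereCW.
Context (R : realType) (n : nat).
Local Notation S := (sphere R n).

Lemma sphere_prop (x : S) : unit_sphere (set_val x). Proof. exact: set_valP. Qed.

Definition sphere_base : S := exist _ (spole R n) (mem_set (spole_sphere R n)).

Definition to_sphere (v : 'rV[R]_n.+1) : S := insubd sphere_base v.

Lemma to_sphereK v : unit_sphere v -> set_val (to_sphere v) = v.
Proof. by move=> sv; apply: insubdK; exact: mem_set. Qed.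

Lemma set_valK (x : S) : to_sphere (set_val x) = x.
Proof. by apply: val_inj; exact: (to_sphereK (sphere_prop x)). Qed.

Lemma to_sphere_spole : to_sphere (spole R n) = sphere_base.
Proof. by apply: val_inj; apply: to_sphereK; exact: spole_sphere. Qed.

Lemma wc_to_sphere T (A : set T) (f : T -> 'rV[R]_n.+1) :
  (forall t, A t -> unit_sphere (f t)) -> {within A, continuous f} ->
  {within A, continuous (fun t => to_sphere (f t))}.
Proof.
move=> Af cf; apply: wc_subtype; apply: wc_eq cf => t At.
by rewrite to_sphereK//; exact: Af.
Qed.

Lemma sphere_hausdorff : hausdorff_space S.
Proof.
move=> x y xy; apply: val_inj; apply: (@norm_hausdorff R 'rV[R]_n.+1) => A B nA nB.
have cv := @initial_continuous S _ set_val.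
by have [z [Az Bz]] := xy _ _ (cv x A nA) (cv y B nB); exists (set_val z).
Qed.

(** The cells are the base point, for [false], and its complement, for [true]. *)
Definition sphere_cell_dim (e : bool) : nat := if e then n else 0.

Definition sphere_cell_map (e : bool) : 'rV[R]_(sphere_cell_dim e) -> S :=
  if e is true then fun y => to_sphere (collapse y) else fun=> sphere_base.

Lemma sphere_cell_map_true_continuous :
  {within @disc R n, continuous (sphere_cell_map (e := true))}.
Proof.
apply: wc_to_sphere; first by move=> y; exact: collapse_sphere.
exact/wc_continuous/collapse_continuous.
Qed.

Lemma sphere_cell_continuous e :
  {within @disc R (sphere_cell_dim e), continuous (@sphere_cell_map e)}.
Proof. by case: e; [exact: sphere_cell_map_true_continuous|exact: wc_cst]. Qed.

Lemma open_disc_disc d (y : 'rV[R]_d) : open_disc y -> disc y.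
Proof. exact: ltW. Qed.

Lemma open_disc_sphere d (y : 'rV[R]_d) : open_disc y -> unit_sphere y -> False.
Proof. by rewrite /open_disc /unit_sphere/= => + y1; rewrite y1 ltxx. Qed.

Lemma collapse_open_spole d (y : 'rV[R]_d) : open_disc y -> collapse y <> spole R d.
Proof.
rewrite /open_disc/= => y1 /(congr1 (fun w : 'rV_d.+1 => w 0 ord0)).
rewrite !consr_head; lra.
Qed.

Lemma sphere_map_trueE y : disc y ->
  set_val (sphere_cell_map (e := true) y) = collapse y.
Proof. by move=> y1; rewrite to_sphereK//; exact: collapse_sphere. Qed.

Lemma sphere_cell_injective e s t : open_disc s -> open_disc t ->
  @sphere_cell_map e s = @sphere_cell_map e t -> s = t.
Proof.
case: e s t => s t os ot; last by rewrite (rV0_eq0 s) (rV0_eq0 t).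
move=> /(congr1 set_val); rewrite !sphere_map_trueE; try exact: open_disc_disc.
move=> /(collapse_inj (open_disc_disc os) (open_disc_disc ot))[//|[ss _]].
by have := open_disc_sphere os ss.
Qed.

Lemma sphere_cell_open e (U : set 'rV[R]_(sphere_cell_dim e)) :
  open U -> U `<=` @open_disc R _ ->
  exists2 V : set S, open V &
    @sphere_cell_map e @` U = V `&` @sphere_cell_map e @` @open_disc R _.
Proof.
case: e U => U oU Uo.
  exists (~` (sphere_cell_map (e := true) @` (@disc R n `&` ~` U))).
    apply: closed_openC; apply: compact_closed; first exact: sphere_hausdorff.
    apply: continuous_compact.
      by apply: (wc_sub _ sphere_cell_map_true_continuous) => y [].
    by apply: compact_closedI; [exact: compact_disc|exact: open_closedC].
  apply/seteqP; split=> [_ [y Uy <-]|x [H [y oy yx]]].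
    split; last by exists y => //; exact: Uo.
    move=> [z [dz nUz] /(congr1 set_val)].
    have dy := open_disc_disc (Uo _ Uy).
    rewrite !sphere_map_trueE// => /(collapse_inj dz dy)[zy|[_ sy]].
      by apply: nUz; rewrite zy.
    exact: (open_disc_sphere (Uo _ Uy) sy).
  exists y => //; apply: contrapT => nUy; apply: H; rewrite -yx; exists y => //; split=> //.
  exact: open_disc_disc.
have o0 : @open_disc R 0 0 by rewrite /open_disc/= sqnorm0 ltr01.
have [U0|U0] := pselect (U 0).
  exists setT; first exact: openT.
  apply/seteqP; split=> [x [y Uy yx]|x [_ [y oy yx]]]; rewrite -?yx.
    by split=> //; exists y => //; exact: Uo.
  by exists y => //; rewrite (rV0_eq0 y).
exists set0; first exact: open0.
apply/seteqP; split=> [x [y Uy yx]|x []//].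
by case: U0; rewrite -(rV0_eq0 y).
Qed.

Lemma sphere_cell_disjoint e e' s t : open_disc s -> open_disc t ->
  @sphere_cell_map e s = @sphere_cell_map e' t -> e = e'.
Proof.
have aux (y : 'rV[R]_n) : open_disc y -> sphere_cell_map (e := true) y <> sphere_base.
  move=> oy /(congr1 set_val); rewrite sphere_map_trueE; last exact: open_disc_disc.
  exact: collapse_open_spole.
case: e s => s; case: e' t => t os ot //; first by move/(aux _ os).
by move/esym/(aux _ ot).
Qed.

Lemma sphere_cell_cover (x : S) : exists e, (@sphere_cell_map e @` @open_disc R _) x.
Proof.
have [xb|xb] := pselect (set_val x = spole R n).
  exists false, 0; first by rewrite /open_disc/= sqnorm0 ltr01.
  by rewrite /= -to_sphere_spole -xb set_valK.
have [y oy yx] := collapse_surj (sphere_prop x) xb.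
by exists true, y => //=; rewrite yx set_valK.
Qed.

Lemma unit_sphere0F (y : 'rV[R]_0) : unit_sphere y -> False.
Proof. by rewrite /unit_sphere/= (rV0_eq0 y) sqnorm0 => /esym/eqP; rewrite oner_eq0. Qed.

Lemma sphere_cell_closure_finite : (0 < n)%N -> forall e, exists2 F : set bool, finite_set F &
  (forall e', F e' -> (sphere_cell_dim e' < sphere_cell_dim e)%N) /\
  @sphere_cell_map e @` @unit_sphere R _ `<=`
    \bigcup_(e' in F) (@sphere_cell_map e' @` @open_disc R _).
Proof.
move=> n0 [].
  exists [set false]; first exact: finite_set1.
  split=> [e' -> //|_ [y sy <-]]; exists false => //.
  exists 0; first by rewrite /open_disc/= sqnorm0 ltr01.
  by rewrite /= collapse_boundary// to_sphere_spole.
exists set0; first exact: finite_set0.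
by split=> // x [y /unit_sphere0F].
Qed.

(** The base point is reached from the boundary of the disc, which is not empty when [n] is
    positive; the weak topology condition is then about this cell alone. *)
Lemma sphere_cell_onto : (0 < n)%N -> sphere_cell_map (e := true) @` @disc R n = setT.
Proof.
move=> n0; apply/seteqP; split=> // x _.
have [[] [y oy <-]] := sphere_cell_cover x; first by exists y => //; exact: open_disc_disc.
have e1 : sqnorm (delta_mx 0 (Ordinal n0) : 'rV[R]_n) = 1.
  rewrite /sqnorm (bigD1 (Ordinal n0))//= big1 => [|i /negPf i0].
    by rewrite mxE !eqxx expr1n addr0.
  by rewrite mxE i0 andbF expr0n.
exists (delta_mx 0 (Ordinal n0)); first by rewrite /disc/= e1.
by rewrite /= collapse_boundary// to_sphere_spole.
Qed.

Lemma sphere_cell_weak_topology : (0 < n)%N -> forall A : set S,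
  (forall e, closed (A `&` @sphere_cell_map e @` @disc R _)) -> closed A.
Proof. by move=> n0 A /(_ true); rewrite sphere_cell_onto// setIT. Qed.

Definition sphere_cw (n0 : (0 < n)%N) : cw_structure R S :=
  @CWStructure R S bool sphere_cell_dim sphere_cell_map sphere_hausdorff
    sphere_cell_continuous sphere_cell_injective sphere_cell_open
    sphere_cell_disjoint sphere_cell_cover (sphere_cell_closure_finite n0)
    (sphere_cell_weak_topology n0).

Lemma sphere_homotopy_trivial m (x : S) : (0 < n)%N -> (n < m)%N ->
  is_product_of_eilenberg_maclane R S -> homotopy_group_trivial R m x.
Proof.
move=> n0 nm; apply: (@cw_not_product R S (sphere_cw n0) n m x) => //.
by case.
Qed.

End SphereCW.

(** * Antipodally symmetric extensions *)

Section BoxExtension.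
Context (R : realType).

Definition box d : set 'rV[R]_d := [set v | `|v| <= 1].
Definition box_boundary d : set 'rV[R]_d := [set v | `|v| = 1].

Lemma box_ext d X (f : 'rV[R]_d.+1 -> X) :
  (forall x : X, homotopy_group_trivial R d x) ->
  {within @box_boundary d.+1, continuous f} ->
  exists2 f' : 'rV[R]_d.+1 -> X, {within @box d.+1, continuous f'} &
    forall v, box_boundary v -> f' v = f v.
Proof.
move=> X0 cf.
pose u := rescale (@enorm R d.+1) (fun v => `|v|).
pose u' := rescale (fun v => `|v|) (@enorm R d.+1).
have ng := @norm_gauge R d.+1; have eg := @enorm_gauge R d.+1.
have cu : continuous u by exact: rescale_continuous.
have cu' : continuous u' by exact: rescale_continuous.
have [|f' cf' f'E] := @ext_trivial R d X (f \o u) (X0 _).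
  apply: (wc_comp _ cf); last exact: wc_continuous.
  by move=> y /unit_sphereP y1; rewrite /box_boundary /= /u gauge_rescale.
exists (f' \o u').
  apply: (wc_comp _ cf'); last exact: wc_continuous.
  by move=> v v1; apply/discP; rewrite /u' gauge_rescale.
move=> v v1; rewrite /= f'E/= /u /u' ?rescaleK//.
by apply/unit_sphereP; rewrite gauge_rescale.
Qed.

Lemma norm_consr_le d (s : R) (v : 'rV[R]_d) (a : R) : 0 <= a ->
  `|consr s v| <= a <-> `|s| <= a /\ `|v| <= a.
Proof.
move=> a0; rewrite !norm_le//.
exact: (@forall_consr R d (fun x => `|x| <= a)).
Qed.

Lemma box_consrP d (s : R) (v : 'rV[R]_d) : box (consr s v) <-> `|s| <= 1 /\ box v.
Proof. exact: norm_consr_le. Qed.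

Lemma box_boundary_consrP d (s : R) (v : 'rV[R]_d) :
  box_boundary (consr s v) <->
  [/\ `|s| <= 1, box v & `|s| = 1 \/ box_boundary v].
Proof.
have coord (w : 'rV[R]_d.+1) i : `|w 0 i| <= `|w| by exact: le_coord_norm.
split=> [b1|[s1 v1 sv]].
  have : box (consr s v) by rewrite /box/= b1.
  move=> /box_consrP[s1 v1]; split=> //.
  have [sn|sn] := eqVneq `|s| 1; [by left|right].
  apply/eqP; rewrite eq_le (v1 : `|v| <= 1)/= leNgt; apply/negP => v1'.
  pose a := Num.max `|s| `|v|.
  have a0 : 0 <= a by rewrite le_max normr_ge0.
  have : `|consr s v| <= a by apply/(norm_consr_le _ _ a0); rewrite !le_max !lexx orbT.
  by rewrite b1 leNgt gt_max v1' lt_neqAle sn s1.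
apply/eqP; rewrite eq_le; apply/andP; split; first by apply/norm_consr_le.
case: sv => [<-|<-]; first by have := coord (consr s v) ord0; rewrite consr_head.
apply/norm_le => // i; have := coord (consr s v) (lift ord0 i).
by rewrite consr_lift.
Qed.

Lemma box_boundary_box d (v : 'rV[R]_d) : box_boundary v -> box v.
Proof. by rewrite /box_boundary /box /= => ->. Qed.

Lemma consrN d (s : R) (v : 'rV[R]_d) : - consr s v = consr (- s) (- v).
Proof. by apply/rowP => i; rewrite !mxE; case: unliftP => [j|] _; rewrite ?mxE. Qed.

Lemma box_boundaryN d (v : 'rV[R]_d) : box_boundary v -> box_boundary (- v).
Proof. by rewrite /box_boundary/= normrN. Qed.

Lemma boxN d (v : 'rV[R]_d) : box v -> box (- v).
Proof. by rewrite /box/= normrN. Qed.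

Lemma row_mx_consr k d (s : R) (x : 'rV[R]_k) (y : 'rV[R]_d) :
  consr s (row_mx x y) = row_mx (consr s x) y :> 'rV[R]_(k.+1 + d).
Proof.
apply/rowP => i; rewrite [LHS]mxE [RHS]mxE; case: splitP => [j ij|j ij].
  case: unliftP => [i' ii'|i0].
    have [j' jj'] : exists j', j = lift ord0 j'.
      have := ij; rewrite ii' /= /bump /= add1n => jE.
      have lt : (i' < k)%N by have := ltn_ord j; rewrite -jE ltnS.
      by exists (Ordinal lt); apply: val_inj; rewrite /= /bump /= add1n -jE.
    rewrite jj' consr_lift (_ : i' = lshift d j') ?row_mxEl//.
    by apply: val_inj => /=; move: ij; rewrite ii' jj' /= /bump /= !add1n => -[].
  have -> : j = ord0 by apply: val_inj; rewrite /= -ij i0.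
  by rewrite consr_head.
case: unliftP => [i' ii'|i0]; last by move: ij; rewrite i0.
rewrite (_ : i' = rshift k j) ?row_mxEr//.
by apply: val_inj => /=; move: ij; rewrite ii' /= /bump /= add1n addSn => -[].
Qed.

Section SymmetricStep.
Context (X : topologicalType) (r : X -> X).
Hypotheses (cr : continuous r) (rK : involutive r).

(** [g] on the top face and its antipodal conjugate on the bottom face. On the lateral faces both
    formulas agree as soon as [g] is equivariant on its own boundary. *)
Definition sym_boundary d (g : 'rV[R]_d -> X) (w : 'rV[R]_d.+1) : X :=
  if w 0 ord0 <= -1 then r (g (- tailr w)) else g (tailr w).

Lemma sym_boundaryE d (g : 'rV[R]_d -> X) s (v : 'rV[R]_d) : -1 < s ->
  sym_boundary g (consr s v) = g v.
Proof.
by move=> s1; rewrite /sym_boundary consr_head tailr_consr ifF// leNgt s1.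
Qed.

Lemma sym_boundary_bottom d (g : 'rV[R]_d -> X) (v : 'rV[R]_d) :
  sym_boundary g (consr (-1) v) = r (g (- v)).
Proof. by rewrite /sym_boundary consr_head tailr_consr lexx. Qed.

Lemma sym_boundary_side d (g : 'rV[R]_d -> X) s (v : 'rV[R]_d) :
  (forall v, box_boundary v -> g (- v) = r (g v)) -> `|s| <= 1 ->
  box_boundary v -> sym_boundary g (consr s v) = g v.
Proof.
move=> gN s1 bv; have [s'|s'] := leP s (-1); last exact: sym_boundaryE.
have -> : s = -1 by move: s1; rewrite ler_norml => /andP[? _]; lra.
by rewrite sym_boundary_bottom gN// rK.
Qed.

Lemma sym_boundary_continuous d (g : 'rV[R]_d -> X) :
  {within @box d, continuous g} ->
  (forall v, box_boundary v -> g (- v) = r (g v)) ->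
  {within @box_boundary d.+1, continuous (sym_boundary g)}.
Proof.
move=> cg gN.
pose F : set 'rV[R]_d.+1 := [set w | w 0 ord0 <= -1].
pose G : set 'rV[R]_d.+1 :=
  [set w : 'rV[R]_d.+1 | 1 <= w 0 ord0] `|` [set w : 'rV[R]_d.+1 | 1 <= `|tailr w|].
have c0 : continuous (fun w : 'rV[R]_d.+1 => w 0 ord0) by exact: coord_continuous.
have cc (x : R) : continuous (fun _ : 'rV[R]_d.+1 => x) by exact: cst_continuous.
have bP w : box_boundary w -> [/\ `|w 0 ord0| <= 1, box (tailr w) &
    `|w 0 ord0| = 1 \/ box_boundary (tailr w)].
  by rewrite -{1}(consr_eta w) => /box_boundary_consrP.
apply: (@wc_glue _ _ _ F G).
- exact: closed_le_cont.
- apply: closedU; first exact: closed_le_cont.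
  by apply: closed_le_cont => //; apply: wc_setT; wc_auto.
- move=> w /bP[_ _ []]; last by rewrite /box_boundary/= => h; right; right; rewrite /= h.
  move=> /eqP; rewrite eqr_norml => /andP[/orP[]/eqP h _].
    by right; left; rewrite /= h.
  by left; rewrite /F /= h.
- apply: (@wc_eq _ _ _ (fun w : 'rV[R]_d.+1 => r (g (- tailr w)))).
    by move=> w [_ Fw]; rewrite /sym_boundary ifT.
  apply: (@wc_compC _ _ _ _ (fun w : 'rV[R]_d.+1 => g (- tailr w)) r) => //.
  apply: (@wc_comp _ _ _ _ _ (fun w : 'rV[R]_d.+1 => - tailr w) g) cg _.
    by move=> w [/bP[_ bw _] _]; exact: boxN.
  apply: (@wc_eq _ _ _ (fun w : 'rV[R]_d.+1 => (-1 : R) *: tailr w)).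
    by move=> w _; rewrite scaleN1r.
  by wc_auto.
- apply: (@wc_eq _ _ _ (fun w : 'rV[R]_d.+1 => g (tailr w))).
    move=> w [/bP[w1 bw _] Gw]; rewrite -[in RHS](consr_eta w).
    case: Gw => [/= w1'|/= wt]; first by rewrite sym_boundaryE//; lra.
    rewrite sym_boundary_side//; apply/eqP; rewrite eq_le wt andbT; exact: bw.
  apply: (@wc_comp _ _ _ _ _ (fun w : 'rV[R]_d.+1 => tailr w) g) cg _.
    by move=> w [/bP[_ bw _] _].
  by wc_auto.
Qed.

Lemma sym_boundaryN d (g : 'rV[R]_d -> X) (w : 'rV[R]_d.+1) :
  (forall v, box_boundary v -> g (- v) = r (g v)) -> box_boundary w ->
  sym_boundary g (- w) = r (sym_boundary g w).
Proof.
move=> gN; rewrite -(consr_eta w); move: (w 0 ord0) (tailr w) => s v.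
move=> /box_boundary_consrP[s1 bv sv]; rewrite consrN.
have [bb|bb] := pselect (box_boundary v); last first.
  case: sv => // /eqP; rewrite eqr_norml => /andP[/orP[]/eqP -> _].
    by rewrite sym_boundary_bottom opprK sym_boundaryE//; lra.
  by rewrite sym_boundary_bottom opprK sym_boundaryE ?rK//; lra.
rewrite !sym_boundary_side ?gN ?normrN//; exact: box_boundaryN.
Qed.

End SymmetricStep.

Section SymmetricTower.
Context (X : topologicalType) (r : X -> X) (x0 : X) (n : nat) (q : 'rV[R]_n -> X).
Hypotheses (cr : continuous r) (rK : involutive r) (r0 : r x0 = x0).
Hypotheses (q0 : forall y, box_boundary y -> q y = x0).
Hypothesis q1 : exists2 G : 'rV[R]_n.+1 -> X, {within @box n.+1, continuous G} &
  forall w, box_boundary w -> G w = sym_boundary r q w.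
Hypothesis cq : {within @box n, continuous q}.
Hypothesis X0 : forall m (x : X), (n < m)%N -> homotopy_group_trivial R m x.

(** Each step prescribes the boundary by [sym_boundary] and fills the box. The obstruction lies in
    degree [k + n]: above [n] it vanishes by [X0], while for [k = 0] the filling is the hypothesis
    [q1]. *)
Lemma symmetric_tower k : exists g : 'rV[R]_(k + n) -> X,
  [/\ {within @box (k + n), continuous g},
      forall v, box_boundary v -> g (- v) = r (g v),
      forall x y, box x -> box_boundary y -> g (row_mx x y) = x0 &
      forall y, box y -> g (row_mx (const_mx 1) y) = q y].
Proof.
have row0 (x : 'rV[R]_0) (y : 'rV[R]_n) : row_mx x y = y :> 'rV[R]_n.
  apply/rowP => i; transitivity (row_mx x y 0 (rshift 0 i)).
    by congr (row_mx _ _ _ _); exact: val_inj.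
  exact: row_mxEr.
elim: k => [|k [g [cg gN g0 g1]]].
  exists q; split=> // [v bv|x y _ by1|y _]; last 2 first.
  - by rewrite row0 q0.
  - by rewrite row0.
  - by rewrite !q0// ?r0//; exact: box_boundaryN.
have [G cG GE] : exists2 G : 'rV[R]_(k + n).+1 -> X,
    {within @box (k + n).+1, continuous G} &
    forall w, box_boundary w -> G w = sym_boundary r g w.
  case: k g cg gN g0 g1 => [|k] g cg gN g0 g1.
    have gq v : box v -> g v = q v.
      by move=> bv; rewrite -(g1 v bv) row0.
    have [G cG GE] := q1; exists G => // w bw; rewrite GE//.
    have := bw; rewrite -{1}(consr_eta w) => /box_boundary_consrP[_ bt _].
    by rewrite /sym_boundary !gq//; exact: boxN.
  apply: box_ext; last exact: sym_boundary_continuous.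
  by move=> x; apply: X0; rewrite addSn ltnS leq_addl.
exists G; split=> // [v bv|x y bx by1|y byy].
- by rewrite !GE ?sym_boundaryN//; exact: box_boundaryN.
- have bxy : box_boundary (row_mx (tailr x) y).
    move: bx; rewrite -{1}(consr_eta x) => /box_consrP[_ bx].
    apply/eqP; rewrite eq_le; apply/andP; split.
      apply/norm_le => // i; case: (split_ordP i) => j ->; rewrite ?row_mxEl ?row_mxEr.
        exact: le_trans (le_coord_norm _ _) bx.
      by rewrite -[X in _ <= X](by1 : `|y| = 1) le_coord_norm.
    rewrite -[X in X <= _](by1 : `|y| = 1); apply/norm_le => // i.
    by have := le_coord_norm (row_mx (tailr x) y) (rshift k i); rewrite row_mxEr.
  move: bx; rewrite -{1 2}(consr_eta x) => /box_consrP[x1 bx].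
  rewrite -row_mx_consr GE; last first.
    by apply/box_boundary_consrP; split=> //; [exact: box_boundary_box|right].
  by rewrite sym_boundary_side// g0.
- have bxy : box (row_mx (const_mx 1) y : 'rV[R]_(k + n)).
    apply/norm_le => // i; case: (split_ordP i) => j ->; rewrite ?row_mxEl ?row_mxEr.
      by rewrite mxE normr1.
    exact: le_trans (le_coord_norm _ _) byy.
  have -> : const_mx 1 = consr 1 (const_mx 1) :> 'rV[R]_k.+1.
    by apply/rowP => i; rewrite !mxE; case: unliftP => [j|] _; rewrite ?mxE.
  rewrite -row_mx_consr GE.
    by rewrite sym_boundaryE ?g1//; lra.
  by apply/box_boundary_consrP; rewrite normr1; split=> //; left.
Qed.

End SymmetricTower.
End BoxExtension.

(** * Deforming the antipode of R^n, and the collapse of the box *)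

Section Rotation.
Context (R : realType) (n' : nat).
Local Notation n := n'.+2.
Local Notation o := (odd n).
Implicit Types (i : 'I_n) (y z : 'rV[R]_n) (s : R).

Definition first_coord : 'I_n := ord0.
Definition second_coord : 'I_n := lift ord0 ord0.

(* The coordinates are paired up, except the first one when [n] is odd. *)
Definition partner_nat (i : nat) : nat :=
  if (i < o)%N then i else if odd (i - o) then i.-1 else i.+1.

Lemma partner_subproof i : (partner_nat i < n)%N.
Proof.
have := ltn_ord i; rewrite /partner_nat; have [io|oi] := ltnP i o; first by lia.
by have [oio|oio] := boolP (odd (i - o)); lia.
Qed.

Definition partner i : 'I_n := Ordinal (partner_subproof i).

Lemma partner_lt i : (partner i < o)%N = (i < o)%N.
Proof.
rewrite /partner /= /partner_nat; have [io|oi] := ltnP i o; first by rewrite io.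
by have [oio|oio] := boolP (odd (i - o)); lia.
Qed.

Lemma partner_odd i : (o <= i)%N -> odd (partner i - o) = ~~ odd (i - o).
Proof.
move=> oi; rewrite /partner /= /partner_nat ltnNge oi /=.
by have [oio|oio] := boolP (odd (i - o)); lia.
Qed.

Lemma partnerK : involutive partner.
Proof.
move=> i; apply: val_inj; rewrite [LHS]/= {1}/partner_nat partner_lt.
have [io|oi] := ltnP i o; first by rewrite /= /partner_nat io.
rewrite partner_odd// /partner /= /partner_nat ltnNge oi /=.
by have [oio|oio] := boolP (odd (i - o)); rewrite /=; lia.
Qed.

Definition sign i : R := if (i < o)%N then 0 else if odd (i - o) then 1 else -1.

Definition weight i : R := (~~ (i < o)%N)%:R.

Lemma eps_partner i : sign (partner i) = - sign i.
Proof.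
rewrite /sign partner_lt; case: ltnP => oi; first by rewrite oppr0.
by rewrite partner_odd//; case: odd; rewrite ?opprK.
Qed.

(* A path of invertible matrices from [z |-> flip (- z)], at -1, to the identity,
   at 1: on each pair of coordinates it is [s] plus a multiple of a rotation by a
   right angle. *)
Definition rot s z : 'rV[R]_n := \row_i
  (if (i < o)%N then z 0 i else s * z 0 i + (1 - s ^+ 2) * sign i * z 0 (partner i)).

(** On a pair of coordinates the squared norm is multiplied by s^2 + (1 - s^2)^2 = (s^2 - 1/2)^2 +
    3/4. *)
Lemma sqnorm_rot s z : 3 / 4 * sqnorm z <= sqnorm (rot s z).
Proof.
have wp : \sum_i weight i * z 0 (partner i) ^+ 2 = \sum_i weight i * z 0 i ^+ 2.
  rewrite [RHS](reindex_inj (inv_inj partnerK)); apply: eq_bigr => i _.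
  by rewrite /weight partner_lt.
(* The cross terms of the square cancel within each pair, because [sign] takes opposite values on
   partners. *)
have ep : \sum_i sign i * z 0 i * z 0 (partner i) = 0.
  set E := \sum_i _; have : E = - E; last by lra.
  rewrite {1}/E (reindex_inj (inv_inj partnerK)) -sumrN; apply: eq_bigr => i _.
  by rewrite eps_partner partnerK; ring.
have -> : sqnorm (rot s z) = \sum_i (1 - weight i + s ^+ 2 * weight i) * z 0 i ^+ 2 +
    (1 - s ^+ 2) ^+ 2 * (\sum_i weight i * z 0 (partner i) ^+ 2) +
    2 * s * (1 - s ^+ 2) * (\sum_i sign i * z 0 i * z 0 (partner i)).
  rewrite !mulr_sumr -!big_split /=; apply: eq_bigr => i _.
  rewrite mxE /weight /sign; case: ltnP => oi /=; first by ring.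
  by case: odd; ring.
rewrite wp ep mulr0 addr0 /sqnorm !mulr_sumr -big_split /=.
apply: ler_sum => i _; rewrite [X in _ + X]mulrA -mulrDl; apply: ler_wpM2r; first exact: sqr_ge0.
have := sqr_ge0 (s ^+ 2 - 2^-1); rewrite /weight; case: (_ < _)%N => /= h; last nra.
by rewrite subr0 !mulr0 addr0; lra.
Qed.

Lemma rot1 z : rot 1 z = z.
Proof. by apply/rowP => i; rewrite mxE expr1n subrr mul0r mul0r addr0 mul1r if_same. Qed.

(** The identity for even [n]; for odd [n], when the antipode reverses orientation, the reflection
    that compensates for it. *)
Definition flip z : 'rV[R]_n := \row_i (if (i < o)%N then - z 0 i else z 0 i).

Lemma rotN1 z : rot (-1) z = flip (- z).
Proof.
apply/rowP => i; rewrite !mxE sqrrN expr1n subrr mul0r mul0r addr0 mulN1r.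
by case: ifP; rewrite ?opprK.
Qed.

Lemma flipK : involutive flip.
Proof.
by move=> z; apply/rowP => i; rewrite !mxE; case: (i < o)%N; rewrite ?opprK.
Qed.

Lemma sqnorm_flip z : sqnorm (flip z) = sqnorm z.
Proof.
by apply: eq_bigr => i _; rewrite mxE; case: ifP; rewrite ?sqrrN.
Qed.

Lemma flipZ (a : R) z : flip (a *: z) = a *: flip z.
Proof. by apply/rowP => i; rewrite !mxE; case: ifP; rewrite ?mulrN. Qed.

Lemma clip_flip z : clip (flip z) = flip (clip z).
Proof. by rewrite /clip /enorm sqnorm_flip flipZ. Qed.

Lemma flip0 : flip 0 = 0.
Proof. by apply/rowP => i; rewrite !mxE oppr0 if_same. Qed.

(* Coordinates of R^n which [flip] permutes. *)
Definition chart z : 'rV[R]_n := if o then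
  \row_i (if i == first_coord then z 0 first_coord + z 0 second_coord else
          if i == second_coord then z 0 second_coord - z 0 first_coord else z 0 i) else z.

Definition unchart y : 'rV[R]_n := if o then
  \row_i (if i == first_coord then (y 0 first_coord - y 0 second_coord) / 2 else
          if i == second_coord then (y 0 first_coord + y 0 second_coord) / 2 else y 0 i) else y.

(** Sperner labels will name negative coordinates: a symmetry that permutes the coordinates acts on
    such labels, one that changes signs does not. *)
Definition swap i : 'I_n := if o then tperm first_coord second_coord i else i.

Lemma swapK : involutive swap.
Proof. by rewrite /swap => i; case: o => //; rewrite tpermK. Qed.

Lemma chartZ (a : R) z : chart (a *: z) = a *: chart z.
Proof.
rewrite /chart; case: o => //; apply/rowP => i; rewrite !mxE.
by case: eqP => _; [ring|case: eqP => _; [ring|]].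
Qed.

Lemma unchartZ (a : R) y : unchart (a *: y) = a *: unchart y.
Proof.
rewrite /unchart; case: o => //; apply/rowP => i; rewrite !mxE.
by case: eqP => _; [ring|case: eqP => _; [ring|]].
Qed.

Lemma unchartK y : chart (unchart y) = y.
Proof.
rewrite /chart /unchart; case: o => //; apply/rowP => i; rewrite !mxE !eqxx /=.
by case: eqP => [->|_]; [field|case: eqP => [->|_]; [field|]].
Qed.

Lemma chartK z : unchart (chart z) = z.
Proof.
rewrite /chart /unchart; case: o => //; apply/rowP => i; rewrite !mxE !eqxx /=.
by case: eqP => [->|_]; [field|case: eqP => [->|_]; [field|]].
Qed.

Lemma chart_flip z i : chart (flip z) 0 i = chart z 0 (swap i).
Proof.
rewrite /chart /swap; have [on|en] := boolP o; last first.
  by rewrite mxE (negbTE en).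
rewrite !mxE on; case: tpermP => [->|->|/eqP/negbTE ni0 /eqP/negbTE ni1].
- by rewrite eqxx /= addrC.
- by rewrite eqxx /= opprK addrC.
- rewrite ni0 ni1 ifF//; apply/negbTE.
  by move: ni0; rewrite -leqNgt lt0n -val_eqE /= => ->.
Qed.

Lemma sqnorm_unchart y i : y 0 i ^+ 2 / 2 <= sqnorm (unchart y).
Proof.
have h1 (w : 'rV[R]_n) j : w 0 j ^+ 2 / 2 <= sqnorm w.
  by apply: le_trans (le_coord_sqnorm w j); have := sqr_ge0 (w 0 j); lra.
rewrite /unchart; have [on|_] := boolP o; last exact: h1.
set w := \row_j _; have [ii|ni] := boolP ((i == first_coord) || (i == second_coord)); last first.
  move: ni; rewrite negb_or => /andP[/negbTE ni0 /negbTE ni1].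
  by have := h1 w i; rewrite mxE ni0 ni1.
have : w 0 first_coord ^+ 2 + w 0 second_coord ^+ 2 <= sqnorm w.
  rewrite /sqnorm (bigD1 first_coord)//= (bigD1 second_coord)//= addrA lerDl.
  by apply: sumr_ge0 => j _; exact: sqr_ge0.
apply: le_trans; rewrite !mxE !eqxx /=.
have := sqr_ge0 (y 0 first_coord); have := sqr_ge0 (y 0 second_coord).
by case/orP: ii => /eqP ->; nra.
Qed.

Lemma wc_rot T (A : set T) (f : T -> R) (g : T -> 'rV[R]_n) :
  {within A, continuous f} -> {within A, continuous g} ->
  {within A, continuous (fun t => rot (f t) (g t))}.
Proof.
move=> ff cg; apply: wc_row => i.
apply: (@wc_eq _ _ _ (fun t => if (i < o)%N then g t 0 i else
    f t * g t 0 i + (1 - f t * f t) * sign i * g t 0 (partner i))).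
  by move=> t _; rewrite mxE expr2.
by case: (i < o)%N; wc_auto.
Qed.

Lemma wc_flip T (A : set T) (g : T -> 'rV[R]_n) :
  {within A, continuous g} -> {within A, continuous (fun t => flip (g t))}.
Proof.
move=> cg; apply: wc_row => i.
apply: (@wc_eq _ _ _ (fun t => if (i < o)%N then - g t 0 i else g t 0 i)).
  by move=> t _; rewrite mxE.
by case: (i < o)%N; wc_auto.
Qed.

Lemma wc_unchart T (A : set T) (g : T -> 'rV[R]_n) :
  {within A, continuous g} -> {within A, continuous (fun t => unchart (g t))}.
Proof.
move=> cg; rewrite /unchart; case: o => //; apply: wc_row => i.
apply: (@wc_eq _ _ _ (fun t => if i == first_coord then (g t 0 first_coord - g t 0 second_coord) / 2 else
          if i == second_coord then (g t 0 first_coord + g t 0 second_coord) / 2 else g t 0 i)).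
  by move=> t _; rewrite mxE.
by case: (i == first_coord); [wc_auto|case: (i == second_coord); wc_auto].
Qed.

Lemma wc_chart T (A : set T) (g : T -> 'rV[R]_n) :
  {within A, continuous g} -> {within A, continuous (fun t => chart (g t))}.
Proof.
move=> cg; rewrite /chart; case: o => //; apply: wc_row => i.
apply: (@wc_eq _ _ _ (fun t => if i == first_coord then g t 0 first_coord + g t 0 second_coord else
          if i == second_coord then g t 0 second_coord - g t 0 first_coord else g t 0 i)).
  by move=> t _; rewrite mxE.
by case: (i == first_coord); [wc_auto|case: (i == second_coord); wc_auto].
Qed.

Local Notation S := (sphere R n).

Definition sphere_flip (x : S) : S :=
  to_sphere (consr (set_val x 0 ord0) (flip (tailr (set_val x)))).

Lemma flip_unit_sphere (v : 'rV[R]_n.+1) : unit_sphere v ->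
  unit_sphere (consr (v 0 ord0) (flip (tailr v))).
Proof.
by rewrite /unit_sphere/= sqnorm_consr sqnorm_flip -{1}(consr_eta v) sqnorm_consr.
Qed.

Lemma sphere_flipE (x : S) :
  set_val (sphere_flip x) = consr (set_val x 0 ord0) (flip (tailr (set_val x))).
Proof. by rewrite to_sphereK//; exact/flip_unit_sphere/sphere_prop. Qed.

Lemma sphere_flip_continuous : continuous sphere_flip.
Proof.
have cv : {within [set: S], continuous set_val} by apply: wc_set_val; exact: wc_id.
apply: wc_setT; apply: wc_to_sphere.
  by move=> x _; exact/flip_unit_sphere/sphere_prop.
apply: wc_consr; first exact: wc_coord.
by apply: wc_flip; exact: wc_tailr.
Qed.

Lemma sphere_flipK : involutive sphere_flip.
Proof.
move=> x; apply: val_inj; rewrite -[LHS]/(set_val _) sphere_flipE sphere_flipE.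
by rewrite consr_head tailr_consr flipK consr_eta.
Qed.

Lemma sphere_flip_base : sphere_flip (sphere_base R n) = sphere_base R n.
Proof.
apply: val_inj; rewrite -[LHS]/(set_val _) sphere_flipE.
by rewrite -[set_val _]/(spole R n) consr_head tailr_consr flip0.
Qed.

Lemma collapse_flip z : to_sphere (collapse (clip (flip z))) =
  sphere_flip (to_sphere (collapse (clip z))).
Proof.
apply: val_inj; rewrite -[RHS]/(set_val _) sphere_flipE.
have sc (w : 'rV[R]_n) : disc w -> set_val (to_sphere (collapse w)) = collapse w.
  by move=> dw; rewrite to_sphereK//; exact: collapse_sphere.
rewrite -[LHS]/(set_val _) !sc; [|exact: clip_disc..].
rewrite clip_flip; move: (clip z) => u.
by rewrite /collapse sqnorm_flip consr_head tailr_consr flipZ.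
Qed.

(** The factor 2 pushes the boundary of the box out of the unit disc, where everything goes to the
    base point. *)
Definition fold_map y : S := to_sphere (collapse (clip (2 *: unchart y))).

Lemma fold_map_out y : 1 <= enorm y -> to_sphere (collapse (clip y)) = sphere_base R n.
Proof.
move=> y1; rewrite collapse_boundary; first exact: to_sphere_spole.
exact: clip_sphere.
Qed.

Lemma enorm_ge1 y : (1 <= enorm y) = (1 <= sqnorm y).
Proof. by rewrite leNgt enorm_lt1 -leNgt. Qed.

(** Some coordinate of [y] is 1 or -1, so the squared norm is at least 4 (3/4) (1/2) = 3/2, by the
    bounds for the factor 2, for [rot] and for [unchart]. *)
Lemma rot_out s y : box_boundary y -> 1 <= enorm (2 *: rot s (unchart y)).
Proof.
move=> y1; rewrite enorm_ge1 sqnormZ.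
have [|i yi] := @norm_attained R n y.
  by rewrite -normr_eq0 (y1 : `|y| = 1) oner_eq0.
have := sqnorm_rot s (unchart y); have := sqnorm_unchart y i.
have -> : y 0 i ^+ 2 = 1 by rewrite -real_normK ?num_real// -yi (y1 : `|y| = 1) expr1n.
lra.
Qed.

Lemma fold_map_boundary y : box_boundary y -> fold_map y = sphere_base R n.
Proof. by move=> y1; apply: fold_map_out; rewrite -(rot1 (unchart y)) rot_out. Qed.

Lemma wc_fold T (A : set T) (g : T -> 'rV[R]_n) :
  {within A, continuous g} ->
  {within A, continuous (fun t => to_sphere (collapse (clip (g t))))}.
Proof.
move=> cg; apply: wc_to_sphere; first by move=> t _; apply/collapse_sphere/clip_disc.
apply: (@wc_compC _ _ _ _ (fun t => clip (g t)) (@collapse R n)).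
  exact: collapse_continuous.
exact: wc_clip.
Qed.

(** The first coordinate of the box is the parameter of [rot]: the identity on the top face, the
    corrected antipode on the bottom face, and the base point on the lateral faces by [rot_out]. *)
Lemma fold_map_homotopy : exists2 G : 'rV[R]_n.+1 -> S,
  {within @box R n.+1, continuous G} &
  forall w, box_boundary w -> G w = sym_boundary sphere_flip fold_map w.
Proof.
exists (fun w : 'rV[R]_n.+1 => to_sphere (collapse (clip (2 *: rot (w 0 ord0) (unchart (tailr w)))))).
  apply: wc_fold; apply: wcZ; first exact: wc_cst.
  apply: wc_rot; first by apply: wc_coord; exact: wc_id.
  by apply: wc_unchart; apply: wc_tailr; exact: wc_id.
move=> w; rewrite -(consr_eta w); move: (w 0 ord0) (tailr w) => s v.
rewrite consr_head tailr_consr => /box_boundary_consrP[s1 bv sv].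
have [bb|nb] := pselect (box_boundary v).
  rewrite sym_boundary_side//; last 2 first.
  - exact: sphere_flipK.
  - move=> u bu; rewrite !fold_map_boundary ?sphere_flip_base//; exact: box_boundaryN.
  by rewrite fold_map_boundary// fold_map_out// rot_out.
case: sv => // /eqP; rewrite eqr_norml => /andP[/orP[]/eqP -> _].
  by rewrite sym_boundaryE ?rot1//; lra.
rewrite sym_boundary_bottom rotN1 -flipZ collapse_flip /fold_map.
by rewrite -scaleN1r -(scaleN1r v) unchartZ.
Qed.

Lemma thom_trivialization : (forall m (x : S), (n < m)%N -> homotopy_group_trivial R m x) ->
  exists Phi : 'rV[R]_(n + n + n) -> S,
  [/\ {within @box R _, continuous Phi},
      forall v, box_boundary v -> Phi (- v) = sphere_flip (Phi v),
      forall x y, box x -> box_boundary y -> Phi (row_mx x y) = sphere_base R n &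
      forall y, box y -> Phi (row_mx (const_mx 1) y) = fold_map y].
Proof.
move=> S0; apply: symmetric_tower => //.
- exact: sphere_flip_continuous.
- exact: sphere_flipK.
- exact: sphere_flip_base.
- exact: fold_map_boundary.
- exact: fold_map_homotopy.
- by apply: wc_fold; apply: wcZ; [exact: wc_cst|apply: wc_unchart; exact: wc_id].
Qed.

End Rotation.

(** * A Sperner lemma *)

Lemma involution_even (T : finType) (f : T -> T) (A : {set T}) :
  (forall x, x \in A -> [/\ f x \in A, f (f x) = x & f x != x]) -> ~~ odd #|A|.
Proof.
have [n] := ubnP #|A|; elim: n A => // n IH A An fA.
have [->|[x xA]] := set_0Vmem A; first by rewrite cards0.
have [fxA ffx fx] := fA x xA.
have fxA' : f x \in A :\ x by rewrite !inE fx.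
rewrite (cardsD1 x) xA (cardsD1 (f x)) fxA' /= negbK.
apply: IH => [|y].
  by move: An; rewrite (cardsD1 x) xA (cardsD1 (f x)) fxA' /=; lia.
rewrite !inE => /and3P[yfx yx yA]; have [fyA ffy fy] := fA y yA.
split=> //; rewrite fyA andbT; apply/andP; split.
  by apply: contra_neq yx => h; rewrite -ffy h ffx.
by apply: contra_neq yfx => h; rewrite -ffy h.
Qed.

Section Sperner.
Context (N k : nat).
Local Notation D := N.+1.
Local Notation c := (k.+1).*2.
Local Notation M := c.*2.
Local Notation vertex := {ffun 'I_D -> 'I_M.+1}.
Local Notation label := (option (option 'I_N)).
Implicit Types (v : vertex) (i : 'I_D).

Definition extreme (a : 'I_M.+1) := (a == 0%N :> nat) || (a == M :> nat).

Definition mirror v : vertex := [ffun i => if i == ord0 then v i else rev_ord (v i)].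

Lemma mirrorK : involutive mirror.
Proof. by move=> v; apply/ffunP => i; rewrite !ffunE; case: eqP => // _; rewrite rev_ordK. Qed.

Context (pi : 'I_N -> 'I_N) (piK : involutive pi).

Definition relabel (l : label) : label := omap (omap pi) l.

Lemma relabelK : involutive relabel.
Proof. by case=> [[i|]|] //=; rewrite piK. Qed.

(* The label [None] marks the far vertices.  Position [ord0] is the homotopy
   parameter; the other positions are the coordinates of the cube whose opposite
   sides are identified. *)
Context (lam : vertex -> label).
Hypothesis lam_mirror : forall v i, i != ord0 -> extreme (v i) ->
  lam (mirror v) = relabel (lam v).
Hypothesis no_full : forall f : label -> vertex, (forall l, lam (f l) = l) ->
  (forall l l' i, f l i <= (f l' i).+1)%N -> False.
Hypothesis no_bottom : forall f : option 'I_N -> vertex,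
  (forall l, lam (f l) = Some l) -> (forall l l' i, f l i <= (f l' i).+1)%N ->
  (forall l, f l ord0 = 0%N :> nat) -> False.
Hypothesis top_lt : forall v (j : 'I_N), v ord0 = M :> nat -> lam v = Some (Some j) ->
  (v (lift ord0 j) < c)%N /\ (forall j' : 'I_N, (j' < j)%N -> (c <= v (lift ord0 j'))%N).
Hypothesis top_ge : forall v, v ord0 = M :> nat -> lam v = Some None ->
  forall j : 'I_N, (c <= v (lift ord0 j))%N.
Hypothesis top_near : forall v, v ord0 = M :> nat ->
  (forall j : 'I_N, c.-1 <= v (lift ord0 j) <= c)%N -> lam v <> None.

(* A maximal simplex of the triangulation: its vertices are obtained from the
   even point by moving the coordinates one after the other to the odd point, in
   the order given by the permutation. *)
Definition simplex : Type := (vertex * vertex * 'S_D)%type.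
Implicit Types (s : simplex) (e o : vertex).

Definition adjacent (a b : 'I_M.+1) :=
  [&& ~~ odd a, odd b & (b == a.+1 :> nat) || (a == b.+1 :> nat)].

(** These are the simplices of the Union Jack triangulation. As [M] is even, reversing a coordinate
    preserves parity, so [mirror] maps simplices to simplices and opposite sides can be
    identified. *)
Definition valid (s : simplex) := [forall i, adjacent (s.1.1 i) (s.1.2 i)].

Definition vert (s : simplex) (j : nat) : vertex :=
  [ffun i => if (s.2 i < j)%N then s.1.2 i else s.1.1 i].

Lemma vert_close s (j j' : nat) i : valid s -> (vert s j i <= (vert s j' i).+1)%N.
Proof.
move=> /forallP/(_ i)/and3P[_ _]; rewrite !ffunE.
by case: ifP => _; case: ifP => _; lia.
Qed.

(** A simplex with an omitted vertex encodes a facet together with one side of it. There are as many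
    remaining vertices as near labels, so each label occurs once. *)
Definition full (p : simplex * 'I_D.+1) := valid p.1 &&
  [forall l : option 'I_N, [exists j : 'I_D.+1, (j != p.2) && (lam (vert p.1 j) == Some l)]].

Lemma full_labels p : full p -> exists g : option 'I_N -> 'I_D.+1,
  [/\ forall l, g l != p.2, forall l, lam (vert p.1 (g l)) = Some l &
      forall j, j != p.2 -> exists l, j = g l].
Proof.
move=> /andP[_ /forallP fp].
have gP l : {j : 'I_D.+1 | (j != p.2) && (lam (vert p.1 j) == Some l)}.
  by apply: sigW; exact/existsP.
pose g l := sval (gP l).
have g1 l : g l != p.2 by rewrite /g; case: (gP l) => j /= /andP[].
have g2 l : lam (vert p.1 (g l)) = Some l.
  by rewrite /g; case: (gP l) => j /= /andP[_ /eqP].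
exists g; split=> // j jp.
have gI : injective g by move=> l l' e; apply: Some_inj; rewrite -!g2 e.
have : [set g l | l : option 'I_N]%SET = (~: [set p.2])%SET.
  apply/eqP; rewrite eqEcard; apply/andP; split.
    by apply/fintype.subsetP => _ /imsetP[l _ ->]; rewrite !inE.
  by rewrite cardsC1 card_imset// card_option !card_ord.
move=> /setP/(_ j); rewrite !inE jp => /imsetP[l _ ->]; by exists l.
Qed.

Definition swap_equal (p : simplex * 'I_D.+1) : simplex * 'I_D.+1 :=
  (p.1, odflt p.2 [pick j : 'I_D.+1 | (j != p.2) && (lam (vert p.1 j) == lam (vert p.1 p.2))]).

Lemma full_other p : full p -> exists l, lam (vert p.1 p.2) = Some l.
Proof.
move=> fp; have [g [g1 g2 _]] := full_labels fp; have /andP[vs _] := fp.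
case E: (lam (vert p.1 p.2)) => [l|]; first by exists l.
exfalso; apply: (no_full (f := fun l => vert p.1 (if l is Some l' then g l' else p.2))).
  by case=> [l|]; rewrite ?g2.
by move=> l l' i; exact: vert_close.
Qed.

(** By [no_full] the omitted vertex is near and repeats the label of exactly one other vertex;
    omitting either of the two gives the two full facets of the simplex. *)
Lemma swap_equalP p : full p ->
  [/\ full (swap_equal p), swap_equal (swap_equal p) = p & swap_equal p != p].
Proof.
case: p => s j0 fp; have [g [g1 g2 g3]] := full_labels fp.
have [l El] := full_other fp; have /andP[vs _] := fp.
rewrite /= in g1 g2 g3 El vs.
have uniq_lab j l' : j != j0 -> lam (vert s j) = Some l' -> j = g l'.
  by move=> /g3[l'' ->]; rewrite g2 => -[->].
have -> : swap_equal (s, j0) = (s, g l).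
  rewrite /swap_equal /=; congr (_, _); case: pickP => [j|/(_ (g l))] /=.
    by rewrite El => /andP[jj /eqP]; exact: uniq_lab.
  by rewrite g1 g2 El eqxx.
split.
- apply/andP; split=> //=; apply/forallP => l'; apply/existsP.
  have [->|ll] := eqVneq l' l; first by exists j0; rewrite eq_sym g1 El eqxx.
  exists (g l'); rewrite g2 eqxx andbT; apply: contra_neq ll => h.
  by apply: Some_inj; rewrite -!g2 h.
- rewrite /swap_equal /=; congr (_, _); case: pickP => [j|/(_ j0)] /=.
    rewrite g2 => /andP[jg /eqP jl]; apply/eqP; apply: contraTT jg => jj.
    by rewrite negbK; apply/eqP; exact: uniq_lab.
  by rewrite eq_sym g1 g2 El eqxx.
- by rewrite xpair_eqE negb_and g1 orbT.
Qed.

Definition update v i (a : nat) : vertex := [ffun j => if j == i then inord a else v j].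

Definition mover (s : simplex) (t : 'I_D) : 'I_D := (s.2^-1)%g t.

Lemma mover_time s t : s.2 (mover s t) = t.
Proof. exact: permKV. Qed.

Lemma moverE s t i : (i == mover s t) = (s.2 i == t).
Proof. by rewrite -[LHS](inj_eq (@perm_inj _ s.2)) mover_time. Qed.

(** The first coordinate to move starts from the other even neighbour of its odd value. This stays
    in the grid, odd values being strictly between 0 and [M]. *)
Definition reflect_even (s : simplex) : simplex :=
  let i := mover s ord0 in (update s.1.1 i ((s.1.2 i).*2 - s.1.1 i), s.1.2, s.2).

(** This leaves the grid exactly when the last coordinate to move starts at 0 or [M], that is when
    the facet lies on the boundary. *)
Definition reflect_odd (s : simplex) : simplex :=
  let i := mover s ord_max in (s.1.1, update s.1.2 i ((s.1.1 i).*2 - s.1.2 i), s.2).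

Definition reflect_order (t : nat) (s : simplex) : simplex :=
  (s.1, (s.2 * tperm (inord t.-1) (inord t))%g).

Definition reflect_mirror (s : simplex) : simplex :=
  (mirror s.1.1, mirror s.1.2, s.2).

Lemma ord_val_inj (a b : 'I_M.+1) : a = b :> nat -> a = b. Proof. exact: val_inj. Qed.

Lemma reflect_evenP s : valid s ->
  [/\ valid (reflect_even s), reflect_even (reflect_even s) = s,
      reflect_even s != s &
      forall j, (0 < j)%N -> vert (reflect_even s) j = vert s j].
Proof.
case: s => [[e o] sg] vs; set s := (e, o, sg); pose i := mover s ord0.
have lt : ((o i).*2 - e i < M.+1)%N.
  by have := forallP vs i; rewrite /adjacent /=; have := ltn_ord (o i); lia.
have mE : mover (reflect_even s) ord0 = i by [].
split.
- apply/forallP => j; have := forallP vs j; rewrite /= ffunE.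
  case: eqP => // ->; rewrite /adjacent /= -/i inordK//=; lia.
- rewrite /reflect_even mE /= -/i; congr (_, _, _); apply/ffunP => j.
  rewrite !ffunE; case: eqP => // ->; rewrite eqxx.
  apply: ord_val_inj; rewrite inordK inordK//.
    by have := forallP vs i; rewrite /adjacent /=; lia.
  by have := forallP vs i; rewrite /adjacent /=; have := ltn_ord (e i); lia.
- apply/eqP => -[/ffunP/(_ i)]; rewrite ffunE eqxx => /(congr1 (@nat_of_ord _)).
  rewrite -/i inordK//; have := forallP vs i; rewrite /adjacent /=; lia.
- move=> j j0; apply/ffunP => i'; rewrite !ffunE /=.
  case: ltnP => // ji; rewrite ifF//; apply/negbTE.
  by rewrite -/i moverE /=; apply/eqP => h; move: ji; rewrite h /=; lia.
Qed.

Lemma reflect_oddP s : valid s -> ~~ extreme (s.1.1 (mover s ord_max)) ->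
  [/\ valid (reflect_odd s), reflect_odd (reflect_odd s) = s,
      reflect_odd s != s &
      forall j, (j <= N)%N -> vert (reflect_odd s) j = vert s j].
Proof.
case: s => [[e o] sg] vs; set s := (e, o, sg); pose i := mover s ord_max.
rewrite /extreme negb_or -/i /= => /andP[ei0 eiM].
have lt : ((e i).*2 - o i < M.+1)%N.
  by have := forallP vs i; rewrite /adjacent /=; have := ltn_ord (e i); lia.
have mE : mover (reflect_odd s) ord_max = i by [].
split.
- apply/forallP => j; have := forallP vs j; rewrite /= ffunE.
  case: eqP => // ->; rewrite /adjacent /= -/i inordK//=; lia.
- rewrite /reflect_odd mE /= -/i; congr (_, _, _); apply/ffunP => j.
  rewrite !ffunE; case: eqP => // ->; rewrite eqxx.
  apply: ord_val_inj; rewrite inordK inordK//.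
    by have := forallP vs i; rewrite /adjacent /=; lia.
  by have := forallP vs i; rewrite /adjacent /=; have := ltn_ord (o i); lia.
- apply/eqP => -[/ffunP/(_ i)]; rewrite ffunE eqxx => /(congr1 (@nat_of_ord _)).
  rewrite -/i inordK//; have := forallP vs i; rewrite /adjacent /=; lia.
- move=> j jN; apply/ffunP => i'; rewrite !ffunE /=.
  case: ltnP => // ji; rewrite ifF//; apply/negbTE.
  by rewrite -/i moverE /=; apply/eqP => h; move: ji; rewrite h /=; lia.
Qed.

Lemma reflect_orderP t s : (0 < t <= N)%N -> valid s ->
  [/\ valid (reflect_order t s), reflect_order t (reflect_order t s) = s,
      reflect_order t s != s &
      forall j, j != t -> vert (reflect_order t s) j = vert s j].
Proof.
case: s => [[e o] sg] /andP[t0 tN] vs.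
split=> //.
- by rewrite /reflect_order /= -mulgA tperm2 mulg1.
- apply/eqP => -[/permP/(_ ((sg^-1)%g (inord t)))].
  by rewrite permM permKV tpermR => /(congr1 val) /=; rewrite !inordK//; lia.
- move=> j jt; apply/ffunP => i; rewrite !ffunE /= permM.
  case: tpermP => [->|->|//]; rewrite !inordK//; try lia.
    by have -> : (t < j)%N = (t.-1 < j)%N by lia.
  by have -> : (t.-1 < j)%N = (t < j)%N by lia.
Qed.

Lemma mirror_adjacent e o i : adjacent (e i) (o i) ->
  adjacent (mirror e i) (mirror o i).
Proof.
rewrite !ffunE; case: eqP => // _; rewrite /adjacent /=.
by have := ltn_ord (e i); have := ltn_ord (o i); lia.
Qed.

Lemma reflect_mirrorP s : valid s ->
  [/\ valid (reflect_mirror s), reflect_mirror (reflect_mirror s) = s &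
      forall j, vert (reflect_mirror s) j = mirror (vert s j)].
Proof.
case: s => [[e o] sg] vs; split.
- by apply/forallP => i; apply: mirror_adjacent; exact: (forallP vs i).
- by rewrite /reflect_mirror /= !mirrorK.
- by move=> j; apply/ffunP => i; rewrite !ffunE /=; case: eqP => // _; case: ifP.
Qed.

Lemma full_eq s s' (j0 : 'I_D.+1) : valid s' ->
  (forall j : 'I_D.+1, j != j0 -> vert s' j = vert s j) -> full (s, j0) -> full (s', j0).
Proof.
move=> vs' ss' /andP[/= _ /forallP fs]; apply/andP; split=> //=.
apply/forallP => l; apply/existsP; have /existsP[j /andP[jj jl]] := fs l.
by exists j; rewrite jj ss'.
Qed.

Lemma full_mirror s : extreme (s.1.1 (mover s ord_max)) -> mover s ord_max != ord0 ->
  full (s, ord_max) -> full (reflect_mirror s, ord_max).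
Proof.
move=> ei i0 /andP[/= vs /forallP fs]; have [vs' _ vE] := reflect_mirrorP vs.
apply/andP; split=> //=.
apply/forallP => l; apply/existsP.
have /existsP[j /andP[jj /eqP jl]] := fs (omap pi l).
exists j; rewrite jj vE (lam_mirror i0); last first.
  rewrite ffunE mover_time ifF//=; apply/negbTE; rewrite -leqNgt.
  by move: jj; rewrite -val_eqE /=; have := ltn_ord j; lia.
by rewrite jl; case: {jl} l => [l|] //=; rewrite piK.
Qed.

(** The facets contained in the bottom or in the top of the cylinder, the only ones across which
    there is no neighbour. *)
Definition end_cell (p : simplex * 'I_D.+1) :=
  [&& p.2 == ord_max, mover p.1 ord_max == ord0 & extreme (p.1.1.1 ord0)].

Definition cross (p : simplex * 'I_D.+1) : simplex * 'I_D.+1 :=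
  (if p.2 == 0%N :> nat then reflect_even p.1
   else if (p.2 <= N)%N then reflect_order p.2 p.1
   else if extreme (p.1.1.1 (mover p.1 ord_max)) then reflect_mirror p.1
   else reflect_odd p.1, p.2).

Lemma crossP p : full p -> ~~ end_cell p ->
  [/\ full (cross p) && ~~ end_cell (cross p), cross (cross p) = p & cross p != p].
Proof.
case: p => s j0 fp ep; have /andP[/= vs _] := fp.
have lp : (j0 <= N.+1)%N by have := ltn_ord j0.
have neq s' : s' != s -> (s', j0) != (s, j0).
  by apply: contra_neq => -[].
rewrite /cross /=; have [j00|j0p] := eqVneq (j0 : nat) 0%N.
  have [v1 v2 v3 v4] := reflect_evenP vs.
  rewrite v2 neq//; split=> //; rewrite (full_eq _ _ fp)//=.
    by rewrite /end_cell /= -val_eqE /= j00.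
  by move=> j; rewrite -val_eqE /= => jj; apply: v4; lia.
have [jN|Nj] := leqP j0 N.
  have j0N : (0 < j0 <= N)%N by lia.
  have [v1 v2 v3 v4] := reflect_orderP j0N vs.
  rewrite v2 neq//.
  split=> //; rewrite (full_eq _ _ fp)//=; last first.
    by move=> j; rewrite -val_eqE; exact: v4.
  by rewrite /end_cell /= -val_eqE /=; lia.
have {lp} jm : j0 = ord_max by apply: val_inj => /=; lia.
rewrite {}jm in fp ep neq *; rewrite {}/end_cell /= eqxx /= in ep *.
case: ifPn => ex.
  have m0 : mover s ord_max != ord0 by apply: contraNneq ep => h; rewrite h eqxx -h.
  have [v1 v2 v3] := reflect_mirrorP vs.
  have mE : mover (reflect_mirror s) ord_max = mover s ord_max by [].
  rewrite mE (negbTE m0) /=.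
  have -> : extreme (mirror s.1.1 (mover s ord_max)).
    rewrite ffunE (negbTE m0).
    by move: ex; rewrite /extreme /=; have := ltn_ord (s.1.1 (mover s ord_max)); lia.
  split; [by rewrite full_mirror|by rewrite v2|].
  apply: neq; apply/eqP => h; have := congr1 (fun s => s.1.1 (mover s ord_max)) h.
  rewrite mE /= ffunE (negbTE m0) => /(congr1 val) /=.
  by move: ex; rewrite /extreme /=; lia.
have [v1 v2 v3 v4] := reflect_oddP vs ex.
have mE : mover (reflect_odd s) ord_max = mover s ord_max by [].
rewrite mE /= (negbTE ex) v2 neq//; split=> //; rewrite (full_eq _ _ fp)//=.
by move=> j; rewrite -val_eqE /= => jj; apply: v4; have := ltn_ord j; lia.
Qed.

Definition full_set := [set p | full p]%SET.
Definition end_set := [set p | full p && end_cell p]%SET.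

Lemma full_set_even : ~~ odd #|full_set|.
Proof.
apply: (@involution_even _ swap_equal) => p; rewrite !inE => fp.
by have [] := swap_equalP fp.
Qed.

(** All full pairs are matched by [swap_equal], and those off the two ends by [cross]; the remaining
    ones are even in number. *)
Lemma end_set_even : ~~ odd #|end_set|.
Proof.
have h : ~~ odd #|full_set :\: end_set|.
  apply: (@involution_even _ cross) => p; rewrite !inE => /andP[ep fp].
  rewrite fp /= in ep; have [/andP[h1 h2] h3 h4] := crossP fp ep.
  by rewrite h1 h2.
have := full_set_even; rewrite -(cardsID end_set full_set) oddD (negbTE h) addbF.
congr (~~ odd #|pred_of_set _|); apply/setP => p; rewrite !inE.
by case: (full p).
Qed.

Definition top_even : vertex := [ffun i => inord (if i == ord0 then M else c)].
Definition top_odd : vertex := [ffun i => inord (if i == ord0 then M.-1 else c.-1)].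
(** Its even point is the centre of the top. The parameter moves last, so the facet without the odd
    point lies in the top; the other coordinates become negative from the last to the first, and the
    first negative one takes every value. *)
Definition top_simplex : simplex := (top_even, top_odd, perm (@rev_ord_inj D)).

Lemma mover_last s i : mover s ord_max = ord0 -> i != ord0 -> (s.2 i < N)%N.
Proof.
move=> m0 i0; have : s.2 i != ord_max by rewrite -moverE m0.
by rewrite -val_eqE /=; have := ltn_ord (s.2 i); lia.
Qed.

Lemma vert_last s (j : 'I_D.+1) : mover s ord_max = ord0 -> j != ord_max ->
  vert s j ord0 = s.1.1 ord0.
Proof.
move=> m0 jm; rewrite ffunE ifF//; apply/negbTE; rewrite -leqNgt -m0 mover_time.
by move: jm; rewrite -val_eqE /=; have := ltn_ord j; lia.
Qed.

(** The bottom is excluded by [no_bottom]. On the top each coordinate is at least [c] at one vertex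
    and below it at another, hence goes from [c], which is even, to [c.-1]; the vertex labelled [j]
    has no earlier negative coordinate, so later coordinates move sooner. *)
Lemma end_set_sub (p : simplex * 'I_D.+1) : p \in end_set -> p = (top_simplex, ord_max).
Proof.
rewrite inE => /andP[fp /and3P[]]; case: p fp => [s j0] fp /= /eqP jm /eqP m0 ex.
rewrite {}jm in fp *; have /andP[/= vs _] := fp.
have [g [g1 g2 _]] := full_labels fp; rewrite /= in g1 g2.
have eM : s.1.1 ord0 = M :> nat.
  case/orP: ex => /eqP // e0; exfalso; apply: (no_bottom (f := fun l => vert s (g l))).
  - exact: g2.
  - by move=> *; exact: vert_close.
  - by move=> l; rewrite vert_last.
have gM l : vert s (g l) ord0 = M :> nat by rewrite vert_last.
have lt j := top_lt (gM _) (g2 (Some j)).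
have ge := top_ge (gM _) (g2 None).
have eo (j : 'I_N) : s.1.1 (lift ord0 j) = c :> nat /\ s.1.2 (lift ord0 j) = c.-1 :> nat.
  have := forallP vs (lift ord0 j); have := ge j; have [+ _] := lt j.
  rewrite !ffunE /adjacent; case: ifP => _; case: ifP => _ h1 h2 /and3P[h3 h4 h5];
    split; lia.
have tE l (j : 'I_N) : (vert s (g l) (lift ord0 j) < c)%N = (s.2 (lift ord0 j) < g l)%N.
  by rewrite ffunE; have [e1 e2] := eo j; case: ifP; rewrite ?e1 ?e2 => _; lia.
have dec (j j' : 'I_N) : (j' < j)%N -> (s.2 (lift ord0 j) < s.2 (lift ord0 j'))%N.
  move=> jj; have [a /(_ j' jj)] := lt j; rewrite tE in a.
  by rewrite leqNgt tE -leqNgt; exact: leq_trans.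
have sN (j : 'I_N) : (s.2 (lift ord0 j) < N)%N by apply: mover_last.
(* The times of the [N] coordinates decrease strictly below [N]; the bounds [up] and [dn] leave only
   the reversal. *)
have up m (j : 'I_N) : j = m :> nat -> (s.2 (lift ord0 j) + j < N)%N.
  elim: m j => [|m IH] j jm; first by rewrite jm addn0.
  have mN : (m < N)%N by have := ltn_ord j; lia.
  by have := IH (Ordinal mN) erefl; have := dec j (Ordinal mN); rewrite /= jm; lia.
have dn m (j : 'I_N) : (j + m.+1 = N)%N -> (m <= s.2 (lift ord0 j))%N.
  elim: m j => [//|m IH] j jm.
  have mN : (j.+1 < N)%N by lia.
  by have := IH (Ordinal mN); have := dec (Ordinal mN) j; rewrite /=; lia.
have key (j : 'I_N) : s.2 (lift ord0 j) = (N - j.+1)%N :> nat.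
  have := up j j erefl; have := dn (N - j.+1)%N j.
  by have := ltn_ord j; lia.
congr (_, _); case: s {dec sN up dn fp g1 g2 ex lt ge tE gM} vs m0 eM eo key => [[e o] sg].
move=> /= vs m0 eM eo key; congr (_, _, _).
- apply/ffunP => i; rewrite ffunE; apply: ord_val_inj.
  case: (unliftP ord0 i) => [j|] -> /=; rewrite inordK//; last lia.
  by have [] := eo j.
- apply/ffunP => i; rewrite ffunE; apply: ord_val_inj.
  case: (unliftP ord0 i) => [j|] -> /=; rewrite inordK//; try lia.
    by have [] := eo j.
  by have := forallP vs ord0; rewrite /adjacent /=; have := ltn_ord (o ord0); lia.
- apply/permP => i; rewrite permE; apply: val_inj.
  case: (unliftP ord0 i) => [j|] -> /=.
    by rewrite key.
  by have := mover_time (e, o, sg) ord_max; rewrite m0 /= => ->; rewrite subn1.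
Qed.

Lemma top_simplex_end : (top_simplex, ord_max) \in end_set.
Proof.
have tM : top_even ord0 = M :> nat by rewrite ffunE inordK.
have tc (j : 'I_N) : top_even (lift ord0 j) = c :> nat.
  by rewrite ffunE /= inordK//; lia.
have oc (j : 'I_N) : top_odd (lift ord0 j) = c.-1 :> nat.
  by rewrite ffunE /= inordK//; lia.
have m0 : mover top_simplex ord_max = ord0.
  by apply/eqP; rewrite eq_sym moverE permE -val_eqE /= subn1.
have vs : valid top_simplex.
  apply/forallP => i; case: (unliftP ord0 i) => [j|] ->; rewrite /adjacent /=.
    by rewrite tc oc /=; lia.
  by rewrite tM ffunE inordK//=; lia.
have vM (j : 'I_D.+1) : j != ord_max -> vert top_simplex j ord0 = M :> nat.
  by move=> jm; rewrite vert_last.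
have vE (j : 'I_D.+1) (i : 'I_N) : vert top_simplex j (lift ord0 i) =
    (if (N - i.+1 < j)%N then c.-1 else c) :> nat.
  by rewrite ffunE /= permE /= /bump /= add1n subSS; case: ifP; rewrite ?tc ?oc.
have nn (j : 'I_D.+1) : j != ord_max -> lam (vert top_simplex j) <> None.
  move=> jm; apply: top_near; first exact: vM.
  by move=> i; rewrite vE; case: ifP; lia.
rewrite inE /end_cell /= m0 !eqxx /= /extreme tM eqxx orbT !andbT.
apply/andP; split=> //=; apply/forallP => -[i|]; apply/existsP; last first.
  exists ord0; rewrite /=; have := nn ord0 isT.
  case E: (lam _) => [[i|]|] // _; have [] := top_lt (vM ord0 isT) E.
  by rewrite vE ltn0 ltnn.
have jN : (N - i < D.+1)%N by lia.
have jm : Ordinal jN != ord_max by rewrite -val_eqE /=; have := ltn_ord i; lia.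
exists (Ordinal jN); rewrite jm /=; have := nn _ jm.
case E: (lam _) => [[i'|]|] // _.
  have [] := top_lt (vM _ jm) E; rewrite vE /= => h1 h2; apply/eqP; congr (Some (Some _)).
  apply: val_inj => /=; case: (ltngtP i' i) => // h.
    by move: h1; have := ltn_ord i; case: ifP; lia.
  by have := h2 i h; rewrite (vE (Ordinal jN)) /=; have := ltn_ord i; case: ifP; lia.
by have := top_ge (vM _ jm) E i; rewrite vE /=; have := ltn_ord i; case: ifP; lia.
Qed.

Lemma sperner_contradiction : False.
Proof.
have := end_set_even; rewrite (_ : end_set = [set (top_simplex, ord_max)]%SET).
  by rewrite cards1.
apply/setP => p; rewrite inE; apply/idP/eqP => [|->]; first exact: end_set_sub.
exact: top_simplex_end.
Qed.

End Sperner.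

(** * Zeros on a cylinder *)

Lemma compact_lower_bound (R : realType) T (A : set T) (f : T -> R) :
  compact A -> {within A, continuous f} -> (forall x, A x -> 0 < f x) ->
  exists2 eta, 0 < eta & forall x, A x -> eta <= f x.
Proof.
move=> cA cf f0; have [A0|A0] := pselect (A !=set0); last first.
  by exists 1 => // x Ax; exfalso; apply: A0; exists x.
have [x /set_mem Ax xm] := compact_EVT_min A0 cA cf.
by exists (f x) => [|y Ay]; [exact: f0|apply: xm; exact/mem_set].
Qed.

Lemma wcBr (R : realType) T (A : set T) n (f g : T -> 'rV[R]_n) :
  {within A, continuous f} -> {within A, continuous g} ->
  {within A, continuous (fun x => f x - g x)}.
Proof.
move=> /subspace_continuousP cf /subspace_continuousP cg.
by apply/subspace_continuousP => x Ax; apply: cvgB; [exact: cf|exact: cg].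
Qed.

Lemma uniformly_continuous_on (R : realType) d e (A : set 'rV[R]_d)
    (f : 'rV[R]_d -> 'rV[R]_e) (eta : R) :
  compact A -> {within A, continuous f} -> 0 < eta ->
  exists2 del, 0 < del & forall x y, A x -> A y -> `|x - y| < del -> `|f x - f y| < eta.
Proof.
move=> cA cf eta0.
pose dist (q : 'rV[R]_d * 'rV[R]_d) := `|f q.1 - f q.2|.
have c1 : {within A `*` A, continuous (fun q : 'rV[R]_d * 'rV[R]_d => f q.1)}.
  apply: (wc_comp _ cf); last exact/wc_continuous/fst_continuous.
  by move=> q [].
have c2 : {within A `*` A, continuous (fun q : 'rV[R]_d * 'rV[R]_d => f q.2)}.
  apply: (wc_comp _ cf); last exact/wc_continuous/snd_continuous.
  by move=> q [].
have cd : {within A `*` A, continuous dist}.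
  exact: (wc_norm (wcBr c1 c2)).
have cC := compact_wc_closed cd (compact_setX cA cA) (@closed_ge R eta).
have [||del del0 dm] := compact_lower_bound (f := fun q : 'rV[R]_d * 'rV[R]_d => `|q.1 - q.2|) cC.
- apply: wc_norm; apply: wcBr.
    exact/wc_continuous/fst_continuous.
  exact/wc_continuous/snd_continuous.
- move=> [x y] [_ /= xy]; rewrite normr_gt0 subr_eq0; apply/eqP => e1.
  by move: xy; rewrite /dist /= e1 subrr normr0; lra.
exists del => // x y Ax Ay xy; rewrite ltNge; apply/negP => h.
have := dm (x, y); rewrite /= => /(_ _)/wrap[]; last by rewrite leNgt xy.
by split.
Qed.

Lemma natr_rev (R : pzRingType) m (a : 'I_m.+1) : (rev_ord a)%:R = m%:R - a%:R :> R.
Proof. by rewrite /= subSS natrB// -ltnS. Qed.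

Section Cylinder.
Context (R : realType) (N : nat).
Implicit Types (s : R) (x : 'rV[R]_N) (w : 'rV[R]_N.+1).

Definition cylinder : set 'rV[R]_N.+1 := @box R N.+1 `&` [set w | 0 <= w 0 ord0].

Lemma cylinder_consr s x : cylinder (consr s x) <-> 0 <= s <= 1 /\ box x.
Proof.
rewrite /cylinder /setI/= consr_head; split=> [[/box_consrP[s1 bx] s0]|[/andP[s0 s1] bx]].
  by move: s1; rewrite ger0_norm// s0.
by split=> //; apply/box_consrP; rewrite ger0_norm.
Qed.

Lemma compact_cylinder : compact cylinder.
Proof.
apply: compact_closedI; first exact: compact_norm1.
by apply: closed_le_cont; [exact: cst_continuous|exact: coord_continuous].
Qed.

Context (h : 'rV[R]_N.+1 -> R) (L : 'rV[R]_N.+1 -> 'rV[R]_N) (pi : 'I_N -> 'I_N).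
Hypotheses (ch : {within cylinder, continuous h}) (cL : {within cylinder, continuous L}).
Hypothesis piK : involutive pi.
Hypothesis hL : forall w, cylinder w -> h w = 0 -> L w = 0 -> False.
Hypothesis L_bottom : forall x, box x -> L (consr 0 x) <> 0.
Hypothesis sides : forall s x, 0 <= s <= 1 -> box_boundary x ->
  h (consr s x) <= 0 /\ h (consr s (- x)) <= 0 \/
  h (consr s (- x)) = h (consr s x) /\
  forall i, L (consr s (- x)) 0 i = L (consr s x) 0 (pi i).
Hypothesis L_top : forall x, box x -> 0 < h (consr 1 x) ->
  forall i, (L (consr 1 x) 0 i < 0) = (x 0 i < 0).
Hypothesis h_top : forall x, box_boundary x -> h (consr 1 x) <= 0.
Hypothesis h_center : 0 < h (consr 1 0).

Lemma cylinder_mesh : exists2 del, 0 < del & forall w0, cylinder w0 ->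
  [/\ (forall i, exists w w' : 'rV[R]_N.+1,
        [/\ cylinder w, cylinder w', `|w0 - w| < del, `|w0 - w'| < del &
            L w 0 i < 0 <= L w' 0 i]) ->
      w0 0 ord0 != 0 /\ (forall w w', cylinder w -> cylinder w' ->
        `|w0 - w| < del -> `|w0 - w'| < del -> 0 < h w -> 0 < h w') &
      `|w0 - consr 1 0| < del -> 0 < h w0].
Proof.
have c1 : cylinder (consr 1 0).
  by apply/cylinder_consr; rewrite lexx ler01 /box/= normr0.
have cN : {within cylinder, continuous (fun w => Num.max `|h w| `|L w|)}.
  apply: (@wc_max _ _ _ (fun w => `|h w|) (fun w => `|L w|)).
    apply: (@wc_compC _ _ _ _ h (fun t : R => `|t|)) => //; exact: norm_continuous.
  exact: wc_norm.
have [|e1 e10 he1] := compact_lower_bound compact_cylinder cN.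
  move=> w cw; rewrite lt_max !normr_gt0 -negb_and; apply/negP => /andP[/eqP + /eqP].
  exact: hL.
have cB : compact (cylinder `&` (fun w => w 0 ord0) @^-1` [set t : R | t <= 0]).
  apply: compact_wc_closed; [|exact: compact_cylinder|exact: closed_le].
  exact/wc_continuous/coord_continuous.
have [||e2 e20 he2] := compact_lower_bound (f := fun w => `|L w|) cB.
- by apply: wc_norm; apply: wc_sub cL => w [].
- move=> w [cw /= w0]; rewrite normr_gt0; apply/eqP.
  have wE : w 0 ord0 = 0 by apply/eqP; rewrite eq_le w0 cw.2.
  rewrite -(consr_eta w) wE; apply: L_bottom.
  by move: cw; rewrite -{1}(consr_eta w) => /cylinder_consr[].
pose m := Num.min (Num.min e1 e2) (h (consr 1 0)); pose eta := m / 2.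
have m0 : 0 < m by rewrite !lt_min e10 e20.
have [m1 m2 m3] : [/\ m <= e1, m <= e2 & m <= h (consr 1 0)].
  by rewrite !ge_min !lexx !orbT.
have [eta0 em1 em2 em3] : [/\ 0 < eta, eta < e1, eta < e2 & eta < h (consr 1 0)].
  by rewrite /eta; split; lra.
have [del del0 dh] := uniformly_continuous_on (f := fun w => consr (h w) (L w))
  compact_cylinder (wc_consr ch cL) eta0.
have near w w' : cylinder w -> cylinder w' -> `|w - w'| < del ->
    `|h w - h w'| < eta /\ forall i, `|L w 0 i - L w' 0 i| < eta.
  move=> cw cw' ww'; have := dh w w' cw cw' ww' => lt.
  split=> [|i]; apply: le_lt_trans lt.
    by have := le_coord_norm (consr (h w) (L w) - consr (h w') (L w')) ord0;
      rewrite !mxE unlift_none.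
  by have := le_coord_norm (consr (h w) (L w) - consr (h w') (L w')) (lift ord0 i);
    rewrite !mxE liftK.
exists del => // w0 cw0; split; last first.
  by move=> /(near _ _ cw0 c1)[+ _]; rewrite ltr_norml => /andP[? ?]; lra.
move=> Lsmall.
have L0 : `|L w0| <= eta.
  apply/norm_le; first exact: ltW.
  move=> i; have [w [w' [cw cw' ww ww' /andP[l1 l2]]]] := Lsmall i.
  have [_ /(_ i)] := near _ _ cw0 cw ww; have [_ /(_ i)] := near _ _ cw0 cw' ww'.
  by rewrite !ltr_norml ler_norml => /andP[? ?] /andP[? ?]; apply/andP; split; lra.
have h0 : e1 <= `|h w0|.
  by have := he1 _ cw0; rewrite le_max => /orP[//|]; lra.
split.
  by apply/eqP => w00; have := he2 w0; rewrite /= w00 => /(_ (conj cw0 (lexx _))); lra.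
move=> w w' cw cw' /(near _ _ cw0 cw)[+ _] /(near _ _ cw0 cw')[+ _].
move: h0; rewrite ler_normr !ltr_norml => /orP[] ? /andP[? ?] /andP[? ?]; lra.
Qed.

(** * Grid points and their labels *)

Section Grid.
Context (k : nat).
Local Notation M := (k.+1).*2.*2.
Local Notation vertex := {ffun 'I_N.+1 -> 'I_M.+1}.
Local Notation label := (option (option 'I_N)).
Implicit Type v : vertex.

Definition grid_pt v : 'rV[R]_N.+1 := consr ((v ord0)%:R / M%:R)
  (\row_i (2 * (v (lift ord0 i))%:R / M%:R - 1)).

Lemma resolution_gt0 : 0 < M%:R :> R. Proof. by rewrite ltr0n. Qed.

Lemma grid_coord v i : 0 <= ((v i)%:R / M%:R : R) <= 1.
Proof.
rewrite divr_ge0// ler_pdivrMr ?resolution_gt0// mul1r ler_nat; exact: (ltn_ord (v i)).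
Qed.

Lemma grid_cyl v : cylinder (grid_pt v).
Proof.
apply/cylinder_consr; split; first exact: grid_coord.
apply/norm_le => // i; rewrite mxE ler_norml.
by have /andP[] := grid_coord v (lift ord0 i); rewrite -mulrA => ? ?; apply/andP; split; lra.
Qed.

Lemma grid_box v : box (tailr (grid_pt v)).
Proof. by have := grid_cyl v; rewrite -{1}(consr_eta (grid_pt v)) => /cylinder_consr[]. Qed.

Lemma grid_time v : 0 <= grid_pt v 0 ord0 <= 1.
Proof. by have := grid_cyl v; rewrite -{1}(consr_eta (grid_pt v)) => /cylinder_consr[]. Qed.

Lemma grid_close v v' : (forall i, (v i <= (v' i).+1)%N) ->
  (forall i, (v' i <= (v i).+1)%N) -> `|grid_pt v - grid_pt v'| <= 2 / M%:R.
Proof.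
move=> vv' v'v.
have close i : `|(v i)%:R / M%:R - (v' i)%:R / M%:R| <= 1 / M%:R :> R.
  rewrite -mulrBl normrM [X in _ * X]gtr0_norm ?invr_gt0 ?resolution_gt0//.
  rewrite ler_wpM2r ?invr_ge0//; have := vv' i; have := v'v i.
  by rewrite -!(ler_nat R) -!natr1 ler_norml => ? ?; apply/andP; split; lra.
have i0 : 0 < 1 / M%:R :> R by rewrite divr_gt0 ?resolution_gt0.
apply/norm_le; first by rewrite divr_ge0.
move=> i; rewrite !mxE; case: unliftP => [j|] _; last first.
  by apply: le_trans (close ord0) _; rewrite ler_pM2r ?invr_gt0 ?resolution_gt0//; lra.
rewrite !mxE; have := close (lift ord0 j).
by rewrite !ler_norml => /andP[? ?]; apply/andP; split; lra.
Qed.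

Lemma grid_mirror v :
  grid_pt (mirror v) = consr (grid_pt v 0 ord0) (- tailr (grid_pt v)).
Proof.
rewrite /grid_pt consr_head tailr_consr ffunE /=; congr consr.
apply/rowP => i; rewrite [LHS]mxE [RHS]mxE [in RHS]mxE.
have -> : mirror v (lift ord0 i) = rev_ord (v (lift ord0 i)) by rewrite ffunE.
rewrite natr_rev.
have := resolution_gt0; move: M%:R (v _)%:R => m a m0.
by field; rewrite gt_eqF.
Qed.

Lemma grid_extreme v i : i != ord0 -> extreme (v i) -> box_boundary (tailr (grid_pt v)).
Proof.
case: (unliftP ord0 i) => [j|] -> //= _ ej; apply/eqP.
rewrite eq_le; apply/andP; split; first exact: grid_box.
apply: le_trans (le_coord_norm _ j); rewrite tailr_consr mxE.
case/orP: ej => /eqP ->; first by rewrite mulr0 mul0r sub0r normrN normr1.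
by rewrite -mulrA divff ?gt_eqF ?resolution_gt0// ger0_norm; lra.
Qed.

Definition base_label v : label :=
  if h (grid_pt v) <= 0 then None else
  Some [pick i : 'I_N | (L (grid_pt v) 0 i < 0) &&
    [forall j : 'I_N, (j < i)%N ==> (0 <= L (grid_pt v) 0 j)]].

(** The first negative coordinate is not compatible with the permutation [pi]. On the sides the
    label is therefore taken from one vertex of each antipodal pair, the one whose picked extreme
    coordinate is 0, and transported to the other. *)
Definition grid_label v : label :=
  if [pick i : 'I_N.+1 | (i != ord0) && extreme (v i)] is Some i then
    if v i == 0%N :> nat then base_label v else relabel pi (base_label (mirror v))
  else base_label v.

Lemma base_labelP v : match base_label v with
  | None => h (grid_pt v) <= 0
  | Some None => 0 < h (grid_pt v) /\ forall i, 0 <= L (grid_pt v) 0 i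
  | Some (Some i) => [/\ 0 < h (grid_pt v), L (grid_pt v) 0 i < 0 &
                       forall j : 'I_N, (j < i)%N -> 0 <= L (grid_pt v) 0 j]
  end.
Proof.
rewrite /base_label; case: ifPn => //; rewrite -ltNge => h0.
case: pickP => [i /andP[Li /forallP Lj]|none].
  by split=> // j ji; have := Lj j; rewrite ji.
split=> // i; rewrite leNgt; apply/negP => Li.
have [j Lj jm] := arg_minnP (fun j : 'I_N => j : nat) (Li : (fun i => L (grid_pt v) 0 i < 0) i).
have := none j; rewrite Lj => /negP; apply; apply/forallP => j'; apply/implyP => jj.
by rewrite leNgt; apply/negP => /jm; rewrite leqNgt jj.
Qed.

Lemma grid_mirror_sides v i : i != ord0 -> extreme (v i) ->
  h (grid_pt v) <= 0 /\ h (grid_pt (mirror v)) <= 0 \/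
  h (grid_pt (mirror v)) = h (grid_pt v) /\
  forall i, L (grid_pt (mirror v)) 0 i = L (grid_pt v) 0 (pi i).
Proof.
move=> i0 ei; rewrite grid_mirror.
have := sides (grid_time v) (grid_extreme i0 ei); rewrite consr_eta; exact.
Qed.

Lemma grid_labelP v : match grid_label v with
  | None => h (grid_pt v) <= 0
  | Some None => 0 < h (grid_pt v) /\ forall i, 0 <= L (grid_pt v) 0 i
  | Some (Some i) => 0 < h (grid_pt v) /\ L (grid_pt v) 0 i < 0
  end.
Proof.
have bv := base_labelP v; rewrite /grid_label; case: pickP => [i /andP[i0 ei]|_]; last first.
  by case: base_label bv => [[i|]|] // [].
case: ifP => _; first by case: base_label bv => [[j|]|] // [].
have := base_labelP (mirror v); have := grid_mirror_sides i0 ei.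
case: base_label => [[j|]|] /= [[h1 h2]|[h1 h2]].
- by case=> h3; lra.
- by case; rewrite h1 h2.
- by case=> h3; lra.
- by rewrite h1 => -[? Lj]; split=> // j; rewrite -(piK j) -h2.
- by [].
- by rewrite h1.
Qed.

Lemma grid_label_mirror v i : i != ord0 -> extreme (v i) ->
  grid_label (mirror v) = relabel pi (grid_label v).
Proof.
move=> i0 ei; rewrite /grid_label.
have -> : [pick i : 'I_N.+1 | (i != ord0) && extreme (mirror v i)] =
    [pick i : 'I_N.+1 | (i != ord0) && extreme (v i)].
  apply: eq_pick => j /=; case: eqVneq => //= j0; rewrite ffunE (negbTE j0).
  by rewrite /extreme /=; have := ltn_ord (v j); lia.
case: pickP => [j /andP[j0 ej]|/(_ i)]; last by rewrite i0 ei.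
rewrite mirrorK ffunE (negbTE j0); move: ej; rewrite /extreme /=.
have [->|vj] := eqVneq (v j : nat) 0%N; first by rewrite subSS subn0.
by move=> /eqP ->; rewrite subSS subnn eqxx relabelK.
Qed.

(** At the top the sides are far by [h_top], so near vertices keep the label of their first negative
    coordinate, on which the uniqueness of the top simplex rests. *)
Lemma grid_label_interior v : 0 < h (grid_pt v) -> v ord0 = M :> nat ->
  grid_label v = base_label v.
Proof.
move=> hv vM; rewrite /grid_label; case: pickP => // i /andP[i0 ei].
have := h_top (grid_extreme i0 ei); have -> : 1 = grid_pt v 0 ord0.
  by rewrite consr_head vM divff// gt_eqF ?resolution_gt0.
by rewrite consr_eta leNgt hv.
Qed.

Lemma grid_sign v j : (grid_pt v 0 (lift ord0 j) < 0) = (v (lift ord0 j) < (k.+1).*2)%N.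
Proof.
rewrite consr_lift mxE subr_lt0 ltr_pdivrMr ?resolution_gt0// mul1r -natrM ltr_nat.
by lia.
Qed.

Lemma grid_top v : v ord0 = M :> nat -> grid_pt v = consr 1 (tailr (grid_pt v)).
Proof.
move=> vM; rewrite -{1}(consr_eta (grid_pt v)); congr consr.
by rewrite consr_head vM divff// gt_eqF ?resolution_gt0.
Qed.

Lemma L_top_sign v (j : 'I_N) : v ord0 = M :> nat -> 0 < h (grid_pt v) ->
  (L (grid_pt v) 0 j < 0) = (v (lift ord0 j) < (k.+1).*2)%N.
Proof.
move=> vM; rewrite (grid_top vM) => /(L_top (grid_box v)) ->.
by rewrite -grid_sign mxE.
Qed.

End Grid.

Lemma cylinder_contradiction : False.
Proof.
have [del del0 mesh] := cylinder_mesh.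
have [k kd] : exists k : nat, 2 / (k.+1).*2.*2%:R < del.
  have d0 : 0 <= 2 / del by rewrite divr_ge0// ltW.
  exists (Num.bound (2 / del)); rewrite ltr_pdivrMr ?ltr0n// mulrC -ltr_pdivrMr//.
  apply: lt_le_trans (archi_boundP d0) _; rewrite ler_nat; lia.
have near (v v' : {ffun 'I_N.+1 -> 'I_((k.+1).*2.*2).+1}) :
    (forall i, (v i <= (v' i).+1)%N) -> (forall i, (v' i <= (v i).+1)%N) ->
    `|grid_pt v - grid_pt v'| < del.
  by move=> h1 h2; exact: le_lt_trans (grid_close h1 h2) kd.
apply: (sperner_contradiction (k := k) piK (@grid_label_mirror k)).
- move=> f fl fc.
  have lab l := grid_labelP (f l).
  have fn l l' : `|grid_pt (f l) - grid_pt (f l')| < del by apply: near.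
  have [m _] := mesh _ (grid_cyl (f None)); have [|_ hpos] := m.
    move=> i; exists (grid_pt (f (Some (Some i)))), (grid_pt (f (Some None))).
    split=> //; [exact: grid_cyl|exact: grid_cyl|].
    have := lab (Some (Some i)); have := lab (Some None); rewrite !fl.
    by move=> [_ ->] [_ ->].
  have := lab (Some None); have := lab None; rewrite !fl => hn [hp _].
  have := hpos _ _ (grid_cyl (f (Some None))) (grid_cyl (f None)) (fn _ _) (fn _ _) hp.
  by rewrite ltNge hn.
- move=> f fl fc f0.
  have lab l := grid_labelP (f l).
  have fn l l' : `|grid_pt (f l) - grid_pt (f l')| < del by apply: near.
  have [m _] := mesh _ (grid_cyl (f None)); have [|+ _] := m.
    move=> i; exists (grid_pt (f (Some i))), (grid_pt (f None)).
    split=> //; [exact: grid_cyl|exact: grid_cyl|].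
    have := lab (Some i); have := lab None; rewrite !fl.
    by move=> [_ ->] [_ ->].
  by rewrite consr_head f0 mul0r eqxx.
- move=> v j vM lv; have := grid_labelP v; rewrite lv => -[hv _].
  move: lv; rewrite grid_label_interior// => lv; have := base_labelP v; rewrite lv.
  move=> [_]; rewrite (L_top_sign _ vM hv) => vj Lj; split=> // j' /Lj.
  by rewrite leNgt (L_top_sign _ vM hv) -leqNgt.
- move=> v vM lv j; have := grid_labelP v; rewrite lv => -[hv /(_ j)].
  by rewrite leNgt (L_top_sign _ vM hv) -leqNgt.
- move=> v vM vc lv; have := grid_labelP v; rewrite lv; apply/negP; rewrite -ltNge.
  have [_] := mesh _ (grid_cyl v); apply; rewrite (grid_top vM).
  apply: le_lt_trans kd; apply/norm_le; first by rewrite divr_ge0.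
  have i0 : 0 < 1 / (k.+1).*2.*2%:R :> R by rewrite divr_gt0.
  move=> i; rewrite !mxE; case: unliftP => [j|] _; last first.
    by rewrite subrr normr0; lra.
  rewrite tailr_consr !mxE subr0.
  have vj : ((k.+1).*2.*2 <= 2 * v (lift ord0 j) + 2)%N /\
      (2 * v (lift ord0 j) <= (k.+1).*2.*2)%N.
    by have := vc j; move: (v _ : nat) => a; split; lia.
  case: vj; rewrite -!(ler_nat R) natrD natrM.
  have := resolution_gt0 k; move: (_.*2%:R) (v _)%:R => m a mp v1 v2.
  rewrite (_ : 2 * a / m - 1 = (2 * a - m) / m); last by field; rewrite gt_eqF.
  rewrite normrM [X in _ * X]gtr0_norm ?invr_gt0//; apply: ler_wpM2r.
    by rewrite invr_ge0 ltW.
  by rewrite ler_norml; apply/andP; split; lra.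
Qed.

End Cylinder.

(** * Spheres *)

Section RowBlocks.
Context (R : realType) (p q : nat).

Lemma norm_row_mx (x : 'rV[R]_p) (y : 'rV[R]_q) : `|row_mx x y| = Num.max `|x| `|y|.
Proof.
have mx0 : 0 <= Num.max `|x| `|y| by rewrite le_max normr_ge0.
apply/eqP; rewrite eq_le; apply/andP; split.
  apply/norm_le => // i; case: (split_ordP i) => j ->; rewrite ?row_mxEl ?row_mxEr.
    by rewrite le_max le_coord_norm.
  by rewrite le_max le_coord_norm orbT.
rewrite ge_max; apply/andP; split; apply/norm_le => // i.
  by have := le_coord_norm (row_mx x y) (lshift q i); rewrite row_mxEl.
by have := le_coord_norm (row_mx x y) (rshift p i); rewrite row_mxEr.
Qed.

Context (T : topologicalType) (A : set T).

Lemma wc_row_mx (f : T -> 'rV[R]_p) (g : T -> 'rV[R]_q) :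
  {within A, continuous f} -> {within A, continuous g} ->
  {within A, continuous (fun t => row_mx (f t) (g t))}.
Proof.
move=> cf cg; apply: wc_row => i; case: (split_ordP i) => j ->.
  apply: (@wc_eq _ _ _ (fun t => f t 0 j)); last exact: wc_coord.
  by move=> t _; rewrite row_mxEl.
apply: (@wc_eq _ _ _ (fun t => g t 0 j)); last exact: wc_coord.
by move=> t _; rewrite row_mxEr.
Qed.

Lemma wc_lsubmx (f : T -> 'rV[R]_(p + q)) :
  {within A, continuous f} -> {within A, continuous (fun t => lsubmx (f t))}.
Proof.
move=> cf; apply: wc_row => i.
apply: (@wc_eq _ _ _ (fun t => f t 0 (lshift q i))); last exact: wc_coord.
by move=> t _; rewrite mxE.
Qed.

Lemma wc_rsubmx (f : T -> 'rV[R]_(p + q)) :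
  {within A, continuous f} -> {within A, continuous (fun t => rsubmx (f t))}.
Proof.
move=> cf; apply: wc_row => i.
apply: (@wc_eq _ _ _ (fun t => f t 0 (rshift p i))); last exact: wc_coord.
by move=> t _; rewrite mxE.
Qed.

End RowBlocks.

(** * The pair of values of Phi on the cylinder *)

Section SphereContradiction.
Context (R : realType) (n' : nat).
Local Notation n := n'.+2.
Local Notation N := (n + n)%N.
Local Notation S := (sphere R n).
Implicit Types (a : S) (s : R) (x : 'rV[R]_N) (y : 'rV[R]_n) (w : 'rV[R]_N.+1).

Definition height a : R := set_val a 0 ord0.
(** At positive height these vanish only at the centre, and [sphere_flip] permutes them. *)
Definition coords a : 'rV[R]_n := chart (tailr (set_val a)).

Lemma height_flip a : height (sphere_flip a) = height a.
Proof. by rewrite /height sphere_flipE consr_head. Qed.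

Lemma coords_flip a i : coords (sphere_flip a) 0 i = coords a 0 (swap i).
Proof. by rewrite /coords sphere_flipE tailr_consr chart_flip. Qed.

Lemma height_base : height (sphere_base R n) = -1.
Proof. by rewrite /height -[set_val _]/(spole R n) consr_head. Qed.

Lemma height_sqr a : height a ^+ 2 + sqnorm (tailr (set_val a)) = 1.
Proof. by rewrite /height -sqnorm_consr consr_eta; exact: sphere_prop. Qed.

(** The last [n] coordinates have squared norm at most n / (n + 1)^2 < 1, so the height must carry
    the rest. This fixes the size of [shift]. *)
Lemma height_neq0 a (b : R) : `|b| <= (n.+1)%:R^-1 -> coords a = const_mx b -> height a != 0.
Proof.
move=> bn ab; have tE : tailr (set_val a) = unchart (const_mx b) by rewrite -ab chartK.
have : sqnorm (tailr (set_val a)) <= n%:R * b ^+ 2.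
  rewrite tE /sqnorm (_ : n%:R * b ^+ 2 = \sum_(i < n) b ^+ 2); last first.
    by rewrite sumr_const card_ord mulr_natl.
  apply: ler_sum => i _; rewrite /unchart; case: odd; rewrite !mxE ?lexx//.
  case: eqP => _; first by rewrite subrr mul0r expr0n sqr_ge0.
  by case: eqP => _; rewrite ?lexx// le_eqVlt; apply/orP; left; apply/eqP; field.
have : n%:R * b ^+ 2 < 1 :> R.
  rewrite -real_normK ?num_real//.
  have n0 : 0 < n%:R :> R by rewrite ltr0n.
  have : `|b| * n.+1%:R <= 1 by rewrite -ler_pdivlMr ?ltr0n// mul1r.
  rewrite -natr1; have := normr_ge0 b; nra.
move=> h1 h2; apply/eqP => h0; have := height_sqr a; rewrite h0 expr0n /= add0r.
lra.
Qed.

(** At positive height the clipping is inactive, and [chart] undoes [unchart]; only positive factors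
    remain. *)
Lemma fold_map_coords y : 0 < height (fold_map y) ->
  exists2 c, 0 < c & coords (fold_map y) = c *: y.
Proof.
rewrite /height /coords to_sphereK; last exact/collapse_sphere/clip_disc.
rewrite consr_head tailr_consr => h0.
have u1 : enorm (2 *: unchart y) < 1.
  rewrite ltNge; apply/negP => /clip_sphere; rewrite /unit_sphere /= => u1.
  by move: h0; rewrite u1; lra.
move: h0; rewrite clip_id; last exact/discP/ltW.
move: u1; rewrite enorm_lt1 => u1 _.
exists (2 * Num.sqrt (1 - sqnorm (2 *: unchart y)) * 2).
  by rewrite !mulr_gt0// sqrtr_gt0 subr_gt0.
by rewrite !chartZ unchartK scalerA.
Qed.

Lemma height_fold_map0 : 0 < height (fold_map (0 : 'rV[R]_n)).
Proof.
have u0 : unchart (0 : 'rV[R]_n) = 0.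
  by rewrite -[X in unchart X](scale0r (0 : 'rV[R]_n)) unchartZ scale0r.
rewrite /fold_map u0 /height to_sphereK; last exact/collapse_sphere/clip_disc.
rewrite consr_head scaler0 clip_id ?sqnorm0 ?mulr0 ?subr0//.
by rewrite /disc/= sqnorm0.
Qed.

Definition swap_blocks (i : 'I_N) : 'I_N :=
  match fintype.split i with inl j => lshift n (swap j) | inr j => rshift n (swap j) end.

Lemma swap_blocks_l j : swap_blocks (lshift n j) = lshift n (swap j).
Proof. by rewrite /swap_blocks (unsplitK (inl j)). Qed.

Lemma swap_blocks_r j : swap_blocks (rshift n j) = rshift n (swap j).
Proof. by rewrite /swap_blocks (unsplitK (inr j)). Qed.

Lemma swap_blocksK : involutive swap_blocks.
Proof.
move=> i; case: (split_ordP i) => j ->; first by rewrite !swap_blocks_l swapK.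
by rewrite !swap_blocks_r swapK.
Qed.

Context (Phi : 'rV[R]_(N + n) -> S).
Hypothesis cPhi : {within @box R _, continuous Phi}.
Hypothesis PhiN : forall v, box_boundary v -> Phi (- v) = sphere_flip (Phi v).
Hypothesis Phi_base : forall x y, box x -> box_boundary y ->
  Phi (row_mx x y) = sphere_base R n.
Hypothesis Phi_fold : forall y, box y -> Phi (row_mx (const_mx 1) y) = fold_map y.

(** The deformation has two halves. Up to 1/2 only the fibre coordinate grows and [x] stays fixed,
    which preserves the antipodal symmetry. After 1/2 [x] slides to the corner, when the boundary is
    already far. *)
Definition spread s : R := Num.min 1 (2 * s).
Definition drift s : R := Num.max 0 (2 * s - 1).

Definition arg s x y : 'rV[R]_(N + n) :=
  row_mx ((1 - drift s) *: x + drift s *: const_mx 1) (spread s *: y).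

Definition left_pt w : S := Phi (arg (w 0 ord0) (tailr w) (lsubmx (tailr w))).
Definition right_pt w : S := Phi (arg (w 0 ord0) (tailr w) (rsubmx (tailr w))).

(* The constant separates the two blocks at [s = 0], where both points agree. *)
Definition shift s : R := (1 - drift s) * (n.+1)%:R^-1.

Definition far_fun w : R := Num.min (height (left_pt w)) (height (right_pt w)).
Definition dir_fun w : 'rV[R]_N :=
  row_mx (coords (left_pt w)) (coords (right_pt w) + shift (w 0 ord0) *: const_mx 1).

Lemma drift_bound s : 0 <= s <= 1 -> 0 <= drift s <= 1.
Proof.
move=> /andP[s0 s1]; rewrite /drift le_max lexx /= ge_max ler01 /=; lra.
Qed.

Lemma spread_bound s : 0 <= s <= 1 -> 0 <= spread s <= 1.
Proof.
move=> /andP[s0 s1]; rewrite /spread ge_min lexx /= andbT le_min ler01 /=; lra.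
Qed.

Lemma drift_box s x : 0 <= s <= 1 -> box x ->
  box ((1 - drift s) *: x + drift s *: const_mx 1).
Proof.
move=> /drift_bound/andP[t0 t1] bx; apply/norm_le => // i; rewrite !mxE.
have := le_trans (le_coord_norm x i) bx; rewrite !ler_norml => /andP[? ?].
by apply/andP; split; nra.
Qed.

Lemma spread_box s y : 0 <= s <= 1 -> box y -> box (spread s *: y).
Proof.
move=> /spread_bound/andP[t0 t1] by1; rewrite /box/= normrZ ger0_norm//.
by apply: le_trans (ler_pM _ _ t1 by1) _; rewrite ?mul1r.
Qed.

Lemma arg_box s x y : 0 <= s <= 1 -> box x -> box y -> box (arg s x y).
Proof.
move=> s01 bx by1; rewrite /box/= norm_row_mx ge_max.
by apply/andP; split; [exact: drift_box|exact: spread_box].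
Qed.

Lemma box_lsubmx x : box x -> box (lsubmx x).
Proof. by rewrite /box/= -{1}(hsubmxK x) norm_row_mx ge_max => /andP[]. Qed.

Lemma box_rsubmx x : box x -> box (rsubmx x).
Proof. by rewrite /box/= -{1}(hsubmxK x) norm_row_mx ge_max => /andP[]. Qed.

Lemma wc_arg (f : 'rV[R]_N.+1 -> 'rV[R]_n) :
  {within @cylinder R N, continuous f} ->
  (forall w, cylinder w -> box (f w)) ->
  {within @cylinder R N, continuous (fun w => Phi (arg (w 0 ord0) (tailr w) (f w)))}.
Proof.
move=> cf bf.
have c0 : {within @cylinder R N, continuous (fun w : 'rV[R]_N.+1 => w 0 ord0)}.
  exact/wc_continuous/coord_continuous.
have cd : {within @cylinder R N, continuous (fun w : 'rV[R]_N.+1 => drift (w 0 ord0))}.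
  apply: (@wc_max _ _ _ (fun=> 0) (fun w : 'rV[R]_N.+1 => 2 * w 0 ord0 - 1)); by wc_auto.
have cs : {within @cylinder R N, continuous (fun w : 'rV[R]_N.+1 => spread (w 0 ord0))}.
  apply: (@wc_min _ _ _ (fun=> 1) (fun w : 'rV[R]_N.+1 => 2 * w 0 ord0)); by wc_auto.
apply: (@wc_comp _ _ _ _ _ (fun w : 'rV[R]_N.+1 => arg (w 0 ord0) (tailr w) (f w)) Phi) cPhi _.
  move=> w cw; move: (cw); rewrite -{1}(consr_eta w) => /cylinder_consr[s01 bx].
  by apply: arg_box => //; exact: bf.
apply: wc_row_mx; last exact: wcZ.
apply: wcDr.
  apply: wcZ; last by apply: wc_tailr; exact: wc_id.
  by apply: wcB => //; exact: wc_cst.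
by apply: wcZ => //; exact: wc_cst.
Qed.

Lemma left_continuous : {within @cylinder R N, continuous left_pt}.
Proof.
apply: wc_arg; first by apply: wc_lsubmx; apply: wc_tailr; exact: wc_id.
by move=> w; rewrite -{1}(consr_eta w) => /cylinder_consr[_ /box_lsubmx].
Qed.

Lemma right_continuous : {within @cylinder R N, continuous right_pt}.
Proof.
apply: wc_arg; first by apply: wc_rsubmx; apply: wc_tailr; exact: wc_id.
by move=> w; rewrite -{1}(consr_eta w) => /cylinder_consr[_ /box_rsubmx].
Qed.

Lemma wc_height (f : 'rV[R]_N.+1 -> S) : {within @cylinder R N, continuous f} ->
  {within @cylinder R N, continuous (fun w => height (f w))}.
Proof. by move=> cf; apply: wc_coord; exact: wc_set_val. Qed.

Lemma wc_coords (f : 'rV[R]_N.+1 -> S) : {within @cylinder R N, continuous f} ->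
  {within @cylinder R N, continuous (fun w => coords (f w))}.
Proof. by move=> cf; apply: wc_chart; apply: wc_tailr; exact: wc_set_val. Qed.

Lemma far_continuous : {within @cylinder R N, continuous far_fun}.
Proof.
apply: wc_min; apply: wc_height; [exact: left_continuous|exact: right_continuous].
Qed.

Lemma dir_continuous : {within @cylinder R N, continuous dir_fun}.
Proof.
apply: wc_row_mx; first by apply: wc_coords; exact: left_continuous.
apply: wcDr; first by apply: wc_coords; exact: right_continuous.
apply: wcZ; last exact: wc_cst.
apply: wcM; last exact: wc_cst.
apply: wcB; first exact: wc_cst.
apply: (@wc_max _ _ _ (fun=> 0) (fun w : 'rV[R]_N.+1 => 2 * w 0 ord0 - 1)); by wc_auto.
Qed.

(** One of the two blocks of [x] is on the boundary of its own box; at full spread the corresponding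
    value of [Phi] is the base point, of height -1. *)
Lemma far_late s x : 0 <= s <= 1 -> 2^-1 <= s -> box_boundary x -> far_fun (consr s x) <= 0.
Proof.
move=> s01 s2 bx; rewrite /far_fun /left_pt /right_pt consr_head tailr_consr ge_min.
have sp : spread s = 1 by apply: min_l; lra.
have bx' : box x by exact: box_boundary_box.
have : Num.max `|lsubmx x| `|rsubmx x| = 1 by rewrite -norm_row_mx hsubmxK.
rewrite /arg sp !scale1r; case: (leP `|lsubmx x| `|rsubmx x|) => _ h1.
  rewrite [X in _ || (height X <= 0)]Phi_base ?height_base//; last exact: drift_box.
  by rewrite lerN10 orbT.
by rewrite Phi_base ?height_base ?lerN10//; exact: drift_box.
Qed.

(** Before 1/2 the argument of [Phi] is on the boundary and odd in [x], so [PhiN] applies; the shift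
    is compatible with [swap_blocks] because all its entries are equal. *)
Lemma far_dir_sides s x : 0 <= s <= 1 -> box_boundary x ->
  far_fun (consr s x) <= 0 /\ far_fun (consr s (- x)) <= 0 \/
  far_fun (consr s (- x)) = far_fun (consr s x) /\
  forall i, dir_fun (consr s (- x)) 0 i = dir_fun (consr s x) 0 (swap_blocks i).
Proof.
move=> s01 bx; have [s2|s2] := leP (2^-1) s.
  by left; split; apply: far_late => //; exact: box_boundaryN.
right; have d0 : drift s = 0 by apply: max_l; lra.
have argN y : box y -> Phi (arg s (- x) (- y)) = sphere_flip (Phi (arg s x y)).
  move=> by1; rewrite -PhiN /arg d0 subr0 !scale1r scale0r !addr0.
    by rewrite opp_row_mx scalerN.
  rewrite /box_boundary /= norm_row_mx (bx : `|x| = 1).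
  by apply: max_l; exact: spread_box.
have bx' : box x by exact: box_boundary_box.
have lN : left_pt (consr s (- x)) = sphere_flip (left_pt (consr s x)).
  rewrite /left_pt !consr_head !tailr_consr -argN; last exact: box_lsubmx.
  by congr (Phi (arg _ _ _)); apply/rowP => i; rewrite !mxE.
have rN : right_pt (consr s (- x)) = sphere_flip (right_pt (consr s x)).
  rewrite /right_pt !consr_head !tailr_consr -argN; last exact: box_rsubmx.
  by congr (Phi (arg _ _ _)); apply/rowP => i; rewrite !mxE.
rewrite /far_fun /dir_fun lN rN !height_flip !consr_head; split=> // i.
case: (split_ordP i) => j ->.
  by rewrite swap_blocks_l !row_mxEl coords_flip.
by rewrite swap_blocks_r !row_mxEr !mxE coords_flip.
Qed.

Lemma shift_bound s : 0 <= s <= 1 -> `|- shift s| <= (n.+1)%:R^-1.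
Proof.
move=> /drift_bound/andP[t0 t1]; rewrite normrN ger0_norm; last first.
  by rewrite mulr_ge0 ?subr_ge0.
by rewrite -[X in _ <= X]mul1r ler_wpM2r//; lra.
Qed.

(** A zero of [dir_fun] gives the two points coordinates all equal to 0, respectively to minus the
    shift, too small for either height to vanish. *)
Lemma far_dir w : cylinder w -> far_fun w = 0 -> dir_fun w = 0 -> False.
Proof.
rewrite -{1}(consr_eta w) => /cylinder_consr[s01 bx] f0 /(congr1 (fun z => (lsubmx z, rsubmx z))).
rewrite row_mxKl row_mxKr => -[l0 r0].
have hl : height (left_pt w) != 0.
  apply: (@height_neq0 _ 0); first by rewrite normr0.
  by rewrite l0; apply/rowP => i; rewrite !mxE.
have hr : height (right_pt w) != 0.
  apply: (@height_neq0 _ (- shift (w 0 ord0))); first exact: shift_bound.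
  apply/rowP => i; have /rowP/(_ i) := r0; rewrite !mxE mulr1 => /eqP.
  by rewrite addr_eq0 => /eqP.
by move: f0; rewrite /far_fun; case: leP => _ h0; [move: hl|move: hr]; rewrite h0 eqxx.
Qed.

Lemma dir_bottom x : box x -> dir_fun (consr 0 x) <> 0.
Proof.
move=> bx /(congr1 (fun z => (lsubmx z, rsubmx z))).
rewrite row_mxKl row_mxKr => -[l0]; rewrite consr_head.
have -> : right_pt (consr 0 x) = left_pt (consr 0 x).
  rewrite /left_pt /right_pt !consr_head /arg (_ : spread 0 = 0) ?scale0r//.
  by rewrite /spread mulr0 min_r.
rewrite l0 => /rowP/(_ ord0); rewrite !mxE add0r mulr1 /shift.
have -> : drift 0 = 0 :> R by apply: max_l; lra.
by move/eqP; rewrite subr0 mul1r invr_eq0 pnatr_eq0.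
Qed.

Lemma arg1 x y : arg 1 x y = row_mx (const_mx 1) y.
Proof.
rewrite /arg (_ : drift 1 = 1); last by rewrite /drift max_r; lra.
rewrite (_ : spread 1 = 1); last by rewrite /spread; apply: min_l; lra.
by rewrite subrr scale0r add0r !scale1r.
Qed.

Lemma dir_top x : box x -> 0 < far_fun (consr 1 x) ->
  forall i, (dir_fun (consr 1 x) 0 i < 0) = (x 0 i < 0).
Proof.
move=> bx; rewrite /far_fun /dir_fun /left_pt /right_pt consr_head tailr_consr !arg1.
rewrite !Phi_fold; [|exact: box_rsubmx|exact: box_lsubmx].
rewrite lt_min => /andP[/fold_map_coords[c1 c10 ->] /fold_map_coords[c2 c20 ->]].
have -> : shift 1 = 0.
  rewrite /shift (_ : drift 1 = 1) ?subrr ?mul0r//.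
  by rewrite /drift max_r; lra.
move=> i; rewrite scale0r addr0; case: (split_ordP i) => j ->.
  by rewrite row_mxEl !mxE pmulr_rlt0.
by rewrite row_mxEr !mxE pmulr_rlt0.
Qed.

Lemma far_center : 0 < far_fun (consr 1 0).
Proof.
rewrite /far_fun /left_pt /right_pt consr_head tailr_consr !arg1.
have b0 : box (0 : 'rV[R]_n) by rewrite /box/= normr0.
have -> : lsubmx (0 : 'rV[R]_N) = 0 by apply/rowP => i; rewrite !mxE.
have -> : rsubmx (0 : 'rV[R]_N) = 0 by apply/rowP => i; rewrite !mxE.
by rewrite !Phi_fold// lt_min height_fold_map0.
Qed.

Lemma sphere_contradiction : False.
Proof.
apply: (cylinder_contradiction far_continuous dir_continuous swap_blocksK far_dir
  dir_bottom far_dir_sides dir_top _ far_center).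
by move=> x bx; apply: far_late => //; [rewrite ler01 lexx|lra].
Qed.

End SphereContradiction.

Theorem sphere_not_product (R : realType) n : (2 <= n)%N ->
  ~ is_product_of_eilenberg_maclane R (sphere R n).
Proof.
case: n => [|[|n]] // _ pS.
have [] := @thom_trivialization R n.
  by move=> m x nm; exact: sphere_homotopy_trivial.
move=> Phi [cPhi PhiN Phi0 Phi1]; exact: (sphere_contradiction cPhi PhiN Phi0 Phi1).
Qed.

Theorem proposition5p5 (R : realType) :
  (forall (X : topologicalType) (C : cw_structure R X) (n : nat),
     (1 <= n)%N -> cw_dimension C n -> connected [set: X] ->
     (exists (m : nat) (x : X), (n < m)%N /\ ~ homotopy_group_trivial R m x) ->
     ~ is_product_of_eilenberg_maclane R X) /\
  (forall n : nat, (2 <= n)%N ->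
     ~ is_product_of_eilenberg_maclane R (sphere R n)).
Proof.
split=> [X C n _ [_ dimC] _ [m [x [nm nontriv]]] XK|n]; last exact: sphere_not_product.
by apply: nontriv; exact: cw_not_product dimC nm XK.
Qed.
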